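(* Let $1\le p\le\infty$ and let $g\in H(\mathbb{D})$ be a non-constant function such that $V_g\colon H^p\to H^p$ is continuous. Then $[V_g,H^p]=[T_g,H^p]$ as linear subspaces of $H(\mathbb{D})$ and with isometric norms (i.e. $\|f\|_{[V_g,H^p]}=\|f\|_{[T_g,H^p]}$ for all $f$). In particular, $([T_g,H^p],\|\cdot\|_{[T_g,H^p]})$ is a Banach space.
   Context: $\mathbb{D}=\{z\in\mathbb{C}:|z|<1\}$; $H(\mathbb{D})$ is the Fréchet space of all analytic functions on $\mathbb{D}$ with the topology of uniform convergence on compact sets; $H^p$ ($1\le p\le\infty$) is the classical Hardy space on $\mathbb{D}$ with norm $\|f\|_p:=\sup_{0\le r<1}\left(\frac1{2\pi}\int_0^{2\pi}|f(re^{i\theta})|^p\,d\theta\right)^{1/p}$ for $p<\infty$ and $\|f\|_\infty:=\sup_{z\in\mathbb{D}}|f(z)|$. For $g,f\in H(\mathbb{D})$, $(V_gf)(z):=\int_0^z f(\xi)g'(\xi)\,d\xi$ for $z\in\mathbb{D}$, and $(T_gf)(z):=\frac1z\int_0^z f(\xi)g'(\xi)\,d\xi$ for $z\in\mathbb{D}\setminus\{0\}$, $(T_gf)(0):=f(0)g'(0)$. For $X$ a Banach space continuously included in $H(\mathbb{D})$ and $T\colon H(\mathbb{D})\to H(\mathbb{D})$ continuous linear with $T(X)\subseteq X$, the optimal domain is $[T,X]:=\{f\in H(\mathbb{D}):Tf\in X\}$ with (semi-)norm $\|f\|_{[T,X]}:=\|Tf\|_X$. Saying that $T\colon X\to X$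 is continuous includes that $T(X)\subseteq X$. *)

(* Defs.v *)
From HB Require Import structures.
From mathcomp Require Import all_boot all_order all_algebra.
From mathcomp Require Import all_classical all_reals all_analysis.
From mathcomp Require Import complex.

Set Implicit Arguments.
Unset Strict Implicit.
Unset Printing Implicit Defensive.

Import Order.TTheory GRing.Theory Num.Theory.
Import numFieldNormedType.Exports.

Local Open Scope classical_set_scope.
Local Open Scope ring_scope.
Local Open Scope complex_scope.

Definition disk (R : realType) := {z : R[i] | `|z| < 1}.

Section Disk.
Context {R : realType}.

Local Notation C := (R[i]).
Local Notation mu := (@lebesgue_measure R).

(* `|z| lives in R[i]; the modulus is its (real) value in R. *)
Definition modulus (z : C) : R := complex.Re `|z|.

Definition ext0 (f : disk R -> C) (z : C) : C := oapp f 0 (insub z).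

(* H(D): the disk being open, the values of [ext0 f] outside of it do not
   matter for complex differentiability at a point of the disk. *)
Definition HD : set (disk R -> C) :=
  [set f | forall z : disk R, derivable (ext0 f : C^o -> C^o) (val z) 1].

Definition cderiv (f : disk R -> C) (z : C) : C :=
  derive1 (ext0 f : C^o -> C^o) z.

Definition Cintegral (D : set R) (h : R -> C) : C :=
  (\int[mu]_(t in D) complex.Re (h t)) +i* (\int[mu]_(t in D) complex.Im (h t)).

(* \int_0^z h along the segment t |-> t z, 0 <= t <= 1. *)
Definition segment_integral (h : C -> C) (z : C) : C :=
  Cintegral `[0, 1] (fun t => h (t%:C * z) * z).

(* [Volterra g] is V_g, [Cesaro g] is T_g (the generalized Cesaro operator). *)
Definition Volterra (g f : disk R -> C) : disk R -> C :=
  fun z => segment_integral (fun xi => ext0 f xi * cderiv g xi) (val z).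

Definition Cesaro (g f : disk R -> C) : disk R -> C :=
  fun z => if val z == 0 then f z * cderiv g 0
           else (val z)^-1 * segment_integral
                  (fun xi => ext0 f xi * cderiv g xi) (val z).

Definition circle_point (r t : R) : C := (r * cos t) +i* (r * sin t).

Definition integral_mean (p : R) (f : disk R -> C) (r : R) : \bar R :=
  ((2 * pi)^-1%R%:E *
    \int[mu]_(t in `[0%R, (2 * pi)%R])
      ((modulus (ext0 f (circle_point r t)) `^ p)%R)%:E)%E `^ p^-1.

(* The value at p = -oo is irrelevant: only 1 <= p is used. *)
Definition hardy_norm (p : \bar R) (f : disk R -> C) : \bar R :=
  match p with
  | p'%:E => ereal_sup [set integral_mean p' f r | r in `[0, 1[%classic]
  | +oo%E => ereal_sup (range (fun z : disk R => (modulus (f z))%:E))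
  | -oo%E => 0%E
  end.

Definition Hardy (p : \bar R) : set (disk R -> C) :=
  [set f | HD f /\ (hardy_norm p f < +oo)%E].

(* Here and below a normed space is given by its carrier X, a set of vectors
   of V, and a norm N on it; N is \bar R-valued as it is total on V. *)
Definition continuous_on_space (V : zmodType) (X : set V) (N : V -> \bar R)
    (T : V -> V) : Prop :=
  (forall f, X f -> X (T f)) /\
  (forall f, X f -> forall e : R, 0 < e ->
     exists2 d : R, 0 < d &
       forall h, X h -> (N (h - f)%R < d%:E)%E -> (N (T h - T f)%R < e%:E)%E).

Definition optimal_domain (T : (disk R -> C) -> disk R -> C)
    (X : set (disk R -> C)) : set (disk R -> C) :=
  [set f | HD f /\ X (T f)].

Definition optimal_norm (T : (disk R -> C) -> disk R -> C)
    (N : (disk R -> C) -> \bar R) (f : disk R -> C) : \bar R := N (T f).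

Record is_Banach_space (V : lmodType C) (X : set V) (N : V -> \bar R) : Prop :=
  IsBanachSpace {
    banach_zero : X 0 ;
    banach_add : forall x y, X x -> X y -> X (x + y) ;
    banach_scale : forall (a : C) x, X x -> X (a *: x) ;
    banach_norm_ge0 : forall x, X x -> (0 <= N x)%E ;
    banach_norm_lty : forall x, X x -> (N x < +oo)%E ;
    banach_norm_eq0 : forall x, X x -> N x = 0%E -> x = 0 ;
    banach_normZ : forall (a : C) x, X x ->
      N (a *: x) = ((modulus a)%:E * N x)%E ;
    banach_normD : forall x y, X x -> X y -> (N (x + y)%R <= N x + N y)%E ;
    banach_complete : forall u : nat -> V, (forall n, X (u n)) ->
      (forall e : R, 0 < e -> exists n0 : nat, forall m n : nat,
         (n0 <= m)%N -> (n0 <= n)%N -> (N (u m - u n)%R < e%:E)%E) ->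
      exists2 l, X l & N (u n - l) @[n --> \oo] --> 0%E }.

End Disk.

(* Main.v *)
(** With [U z = \int_0^1 (f g') (t z) dt], a holomorphic function on the disc,
    [T_g f = U] and [V_g f = z U]. Integral means over circles are nondecreasing
    in the radius, so multiplication by [z] does not change the [H^p] norm: this
    gives the equality of the two domains with their norms, for every [p].
    For the completeness, choose a circle free of zeros of [g'], arbitrarily
    close to the unit circle. On it [f = (V_g f)' / g'] is bounded by a multiple
    of the norm of [V_g f], by the point evaluation bound of [H^p] and the Cauchy
    estimates, and by the maximum principle so is [f] inside. Hence a Cauchy
    sequence converges locally uniformly, and the norm passes to the limit.
    The complex analysis rests on Goursat's theorem for rectangles, which yields
    the maximum principle; the latter gives removability of singularities, hence
    holomorphy of difference quotients, without power series. *)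

Require Import Defs.
From mathcomp Require Import all_boot all_order all_algebra.
From mathcomp Require Import all_classical all_reals all_analysis.
From mathcomp Require Import complex.
From mathcomp Require Import measurable_realfun.
From mathcomp Require Import ring lra.

Set Implicit Arguments.
Unset Strict Implicit.
Unset Printing Implicit Defensive.

Import Order.TTheory GRing.Theory Num.Theory.
Import numFieldNormedType.Exports.

Local Open Scope classical_set_scope.
Local Open Scope ring_scope.
Local Open Scope complex_scope.

(** * Modulus and complex derivatives *)

(** Sharp inequalities are obtained from lossy ones by applying the latter to all powers of a
    function and removing the constant with [le_of_pow_le]. This is why a crude bound on the
    integral of [1/z] yields the maximum principle, why bounded isolated singularities do not spoil
    it, and why a zero of infinite order spreads. The isometry tolerates no loss either: dividing by
    [z] on a circle of radius [r] costs [1/r], and only a passage to radii near 1 makes this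
    harmless. Hence the monotonicity of means for every finite [p >= 1]. It is proved by duality,
    pairing [F] with a weight that may jump at its zeros when [p = 1]; integrals are therefore
    developed for bounded measurable functions. Young's inequality with a free constant does the
    work of the Hölder inequality, and gives Minkowski's through convexity. The obstacle to
    completeness is that [g'] may have zeros, possibly accumulating at the unit circle; the identity
    theorem supplies circles that avoid them, and the constants lost there are harmless since
    completeness only asks for some bound on each smaller disc. *)

Section Modulus.
Context {R : realType}.
Local Notation C := (R[i]).
Implicit Types (x y z w : C).

Lemma modulusE z : modulus z = Num.sqrt (complex.Re z ^+ 2 + complex.Im z ^+ 2).
Proof. by rewrite /modulus normc_def. Qed.

Lemma normc_modulus z : `|z| = (modulus z)%:C.
Proof. by rewrite modulusE normc_def. Qed.

Lemma modulus_ge0 z : 0 <= modulus z.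
Proof. by rewrite modulusE sqrtr_ge0. Qed.
Hint Resolve modulus_ge0 : core.

Lemma modulus0 : modulus (0 : C) = 0.
Proof. by rewrite /modulus normr0. Qed.

Lemma modulus1 : modulus (1 : C) = 1.
Proof. by rewrite /modulus normr1. Qed.

Lemma modulus_eq0 z : (modulus z == 0) = (z == 0).
Proof. by rewrite -[RHS]normr_eq0 normc_modulus eq_complex /= eqxx andbT. Qed.

Lemma modulus_gt0 z : (0 < modulus z) = (z != 0).
Proof. by rewrite lt_def modulus_eq0 modulus_ge0 andbT. Qed.

Lemma modulusM z w : modulus (z * w) = modulus z * modulus w.
Proof. by apply: complexI; rewrite -normc_modulus normrM !normc_modulus rmorphM. Qed.

Lemma modulusD z w : modulus (z + w) <= modulus z + modulus w.
Proof. by rewrite -lecR rmorphD /= -!normc_modulus ler_normD. Qed.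

Lemma modulusN z : modulus (- z) = modulus z.
Proof. by rewrite /modulus normrN. Qed.

Lemma modulusB z w : modulus (z - w) <= modulus z + modulus w.
Proof. by rewrite -(modulusN w) modulusD. Qed.

Lemma modulusC z w : modulus (z - w) = modulus (w - z).
Proof. by rewrite -modulusN opprB. Qed.

Lemma modulus_triangle y z w :
  modulus (z - w) <= modulus (z - y) + modulus (y - w).
Proof. by rewrite (_ : z - w = (z - y) + (y - w)) ?modulusD//; ring. Qed.

Lemma modulusV z : modulus z^-1 = (modulus z)^-1.
Proof. by apply: complexI; rewrite -normc_modulus normfV normc_modulus fmorphV. Qed.

Lemma modulusX z n : modulus (z ^+ n) = modulus z ^+ n.
Proof. by apply: complexI; rewrite -normc_modulus normrX normc_modulus rmorphXn. Qed.

Lemma modulus_real (x : R) : modulus x%:C = `|x|.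
Proof. by rewrite modulusE /= expr0n addr0 sqrtr_sqr. Qed.

Lemma modulus_conj z : modulus z^*%C = modulus z.
Proof. by rewrite /modulus normcJ. Qed.

Lemma ger0_modulus (x : R) : 0 <= x -> modulus x%:C = x.
Proof. by move=> x0; rewrite modulus_real ger0_norm. Qed.

Lemma modulus_i : modulus ('i : C) = 1.
Proof. by rewrite modulusE /= expr0n add0r expr1n sqrtr1. Qed.

Lemma Re_modulus z : `|complex.Re z| <= modulus z.
Proof. by rewrite -lecR -normc_modulus normc_ge_Re. Qed.

Lemma Re_le_modulus z : complex.Re z <= modulus z.
Proof. exact: le_trans (ler_norm _) (Re_modulus z). Qed.

Lemma ReMc z w : complex.Re (z * w) =
  complex.Re z * complex.Re w - complex.Im z * complex.Im w.
Proof. by case: z w => [a b] [c d]. Qed.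

Lemma ImMc z w : complex.Im (z * w) =
  complex.Re z * complex.Im w + complex.Im z * complex.Re w.
Proof. by case: z w => [a b] [c d]. Qed.

Lemma ReD z w : complex.Re (z + w) = complex.Re z + complex.Re w.
Proof. by case: z w => [a b] [c d]. Qed.

Lemma ImD z w : complex.Im (z + w) = complex.Im z + complex.Im w.
Proof. by case: z w => [a b] [c d]. Qed.

Lemma ReN z : complex.Re (- z) = - complex.Re z.
Proof. by case: z. Qed.

Lemma ImN z : complex.Im (- z) = - complex.Im z.
Proof. by case: z. Qed.

Lemma ReB z w : complex.Re (z - w) = complex.Re z - complex.Re w.
Proof. by rewrite ReD ReN. Qed.

Lemma ImB z w : complex.Im (z - w) = complex.Im z - complex.Im w.
Proof. by rewrite ImD ImN. Qed.

Lemma Im_modulus z : `|complex.Im z| <= modulus z.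
Proof.
have := Re_modulus (z * 'i).
by rewrite ReMc /= mulr0 mulr1 sub0r normrN modulusM modulus_i mulr1.
Qed.

Lemma complex_eqP z w : complex.Re z = complex.Re w ->
  complex.Im z = complex.Im w -> z = w.
Proof. by case: z w => [a b] [c d] /= -> ->. Qed.

Lemma modulus_le_ReIm z : modulus z <= `|complex.Re z| + `|complex.Im z|.
Proof.
case: z => a b /=.
have -> : a +i* b = a%:C + b%:C * 'i by apply: complex_eqP => /=; ring.
by rewrite (le_trans (modulusD _ _))// modulusM modulus_i mulr1 !modulus_real.
Qed.

Lemma sqr_modulus z : modulus z ^+ 2 = complex.Re z ^+ 2 + complex.Im z ^+ 2.
Proof. by rewrite modulusE sqr_sqrtr// addr_ge0 ?sqr_ge0. Qed.

Lemma mulc_conj z : z * z^*%C = (modulus z ^+ 2)%:C.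
Proof. by rewrite -sqr_normc normc_modulus rmorphXn. Qed.

Lemma normc_lt1 z : (`|z| < 1) = (modulus z < 1).
Proof. by rewrite normc_modulus -[1 in LHS]/((1 : R)%:C) ltcR. Qed.

Lemma modulus_lb z w : modulus z - modulus w <= modulus (z - w).
Proof. by rewrite lerBlDr -{1}(subrK w z) modulusD. Qed.

End Modulus.
#[export] Hint Resolve modulus_ge0 : core.

(** * Complex differentiability in epsilon-delta form *)

Section Derivative.
Context {R : realType}.
Local Notation C := (R[i]).
Implicit Types (F G : C -> C) (z w a b d e : C).

Definition continuous_pt F z := forall e : R, 0 < e -> exists2 d : R, 0 < d &
  forall w, modulus (w - z) < d -> modulus (F w - F z) < e.

(** The non-strict bound makes the case [w = z] harmless, so no punctured neighbourhood appears. *)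
Definition has_deriv F z d := forall e : R, 0 < e -> exists2 r : R, 0 < r &
  forall w, modulus (w - z) < r ->
    modulus (F w - F z - d * (w - z)) <= e * modulus (w - z).

Definition diff_pt F z := exists d, has_deriv F z d.

Definition lim_pt F z l := forall e : R, 0 < e -> exists2 r : R, 0 < r &
  forall w, w != z -> modulus (w - z) < r -> modulus (F w - l) < e.

(** In [R[i]] the relation [0 < e] forces the imaginary part of [e] to vanish, so the radii of
    complex balls are real numbers in disguise. *)
Lemma lim_ptP F z l :
  (F : C^o -> C^o) @ (z : C^o)^' --> (l : C^o) <-> lim_pt F z l.
Proof.
split.
- move=> /cvgrPdist_lt H e e0.
  have e0' : 0 < e%:C by rewrite ltcR.
  have /nbhs_ballP[[r ri] /= ] := H _ e0'.
  rewrite ltcE /= => /andP[/eqP -> r0] Hr.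
  exists r => // w wz wr.
  have := Hr w; rewrite /ball /= => /(_ _ wz).
  rewrite -normrN opprB normc_modulus ltcR => /(_ wr).
  by rewrite -normrN opprB normc_modulus ltcR.
- move=> H; apply/cvgrPdist_lt => -[e ei].
  rewrite ltcE /= => /andP[/eqP -> e0].
  have [r r0 Hr] := H e e0.
  apply/nbhs_ballP; exists r%:C; first by rewrite /= ltcR.
  move=> w /=; rewrite /ball /= => wr wz.
  rewrite complexr0 -normrN opprB normc_modulus ltcR; apply: Hr => //.
  by move: wr; rewrite -normrN opprB normc_modulus ltcR.
Qed.

Lemma has_deriv_lim F z d :
  lim_pt (fun h => h^-1 * (F (h + z) - F z)) 0 d <-> has_deriv F z d.
Proof.
split=> H e e0.
- have [r r0 Hr] := H _ e0; exists r => // w wr.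
  have [->|wz] := eqVneq w z; first by rewrite !subrr mulr0 subr0 modulus0 mulr0.
  have wz0 : w - z != 0 by rewrite subr_eq0.
  have := Hr (w - z) wz0; rewrite subr0 subrK => /(_ wr) /ltW.
  rewrite -(ler_pM2r (x := modulus (w - z))) ?modulus_gt0// -modulusM.
  suff -> : ((w - z)^-1 * (F w - F z) - d) * (w - z) = F w - F z - d * (w - z) by [].
  by field.
- have [r r0 Hr] := H (e / 2) ltac:(by rewrite divr_gt0); exists r => // w w0.
  rewrite subr0 => wr; have := Hr (w + z); rewrite addrK => /(_ wr).
  move=> K; rewrite (le_lt_trans (y := e / 2)) //; last by lra.
  rewrite -(ler_pM2r (x := modulus w)) ?modulus_gt0// -modulusM.
  suff -> : (w^-1 * (F (w + z) - F z) - d) * w = F (w + z) - F z - d * w by [].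
  by field.
Qed.

Lemma has_derivP F z d :
  (fun h : C^o => h^-1 *: ((F : C^o -> C^o) (h *: 1 + z) - F z)) @ (0 : C^o)^' --> (d : C^o)
  <-> has_deriv F z d.
Proof.
rewrite -has_deriv_lim -lim_ptP.
have -> : (fun h : C^o => h^-1 *: ((F : C^o -> C^o) (h *: (1 : C^o) + z) - F z)) =
   (fun h => h^-1 * (F (h + z) - F z)) by apply/funext => h; rewrite /GRing.scale /= mulr1.
by [].
Qed.

Lemma diff_ptP F z : derivable (F : C^o -> C^o) z 1 <-> diff_pt F z.
Proof.
split.
- by move=> /cvg_ex [d] /= Hd; exists d; apply/has_derivP.
- by move=> [d] /has_derivP Hd; apply/cvg_ex; exists d.
Qed.

Lemma has_deriv_derive1 F z d : has_deriv F z d -> derive1 (F : C^o -> C^o) z = d.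
Proof.
move=> /has_derivP Hd; rewrite derive1E /derive.
by apply: cvg_lim => //; apply: Hd.
Qed.

Lemma has_deriv_isP F z d : is_derive (z : C^o) (1 : C^o) (F : C^o -> C^o) (d : C^o) <-> has_deriv F z d.
Proof.
split.
- move=> [/diff_ptP [d' Hd']] dd; move: (has_deriv_derive1 Hd').
  by rewrite derive1E dd => ->.
- move=> Hd; split; first by apply/diff_ptP; exists d.
  by rewrite -derive1E; exact: has_deriv_derive1.
Qed.

Lemma has_deriv_near F G z d (r : R) : 0 < r ->
  (forall w, modulus (w - z) < r -> F w = G w) ->
  has_deriv F z d -> has_deriv G z d.
Proof.
move=> r0 FG HF e e0; have [s s0 Hs] := HF e e0.
exists (Num.min r s); first by rewrite lt_min r0.
move=> w; rewrite lt_min => /andP[wr ws].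
rewrite -!FG ?Hs//; by rewrite subrr modulus0.
Qed.

Lemma has_deriv_cst (c : C) z : has_deriv (fun _ => c) z 0.
Proof. by apply/has_deriv_isP; exact: is_derive_cst. Qed.

Lemma has_deriv_id z : has_deriv (fun w => w) z 1.
Proof. by apply/has_deriv_isP; exact: is_derive_id. Qed.

Lemma has_derivD F G z d d' : has_deriv F z d -> has_deriv G z d' ->
  has_deriv (fun w => F w + G w) z (d + d').
Proof. move=> /has_deriv_isP ? /has_deriv_isP ?; apply/has_deriv_isP; exact: is_deriveD. Qed.

Lemma has_derivB F G z d d' : has_deriv F z d -> has_deriv G z d' ->
  has_deriv (fun w => F w - G w) z (d - d').
Proof. move=> /has_deriv_isP ? /has_deriv_isP ?; apply/has_deriv_isP; exact: is_deriveB. Qed.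

Lemma has_derivM F G z d d' : has_deriv F z d -> has_deriv G z d' ->
  has_deriv (fun w => F w * G w) z (F z * d' + d * G z).
Proof.
move=> HF HG; rewrite [d * G z]mulrC.
exact: (has_deriv_isP _ _ _).1
  (@is_deriveM C C^o F G z 1 d d' ((has_deriv_isP F z d).2 HF) ((has_deriv_isP G z d').2 HG)).
Qed.

Lemma has_derivV F z d : F z != 0 -> has_deriv F z d ->
  has_deriv (fun w => (F w)^-1) z (- (d / F z ^+ 2)).
Proof.
move=> Fz /has_deriv_isP [dF dFE]; apply/has_deriv_isP.
split; first exact: (@derivableV _ _ (F : C^o -> C^o)).
rewrite (@deriveV _ _ (F : C^o -> C^o))// dFE /GRing.scale /=.
by rewrite mulNr mulrC.
Qed.

Lemma has_deriv_affine F (a b z d : C) : has_deriv F (a * z + b) d ->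
  has_deriv (fun w => F (a * w + b)) z (a * d).
Proof.
move=> H e e0.
(* The added 1 covers [a = 0]. *)
have a1 : 0 < modulus a + 1 by have := @modulus_ge0 R a; lra.
have [r r0 Hr] := H (e / (modulus a + 1)) ltac:(by rewrite divr_gt0).
exists (r / (modulus a + 1)); first by rewrite divr_gt0.
move=> w wr.
have E : a * w + b - (a * z + b) = a * (w - z) by ring.
have am : modulus (a * (w - z)) <= (modulus a + 1) * modulus (w - z).
  by rewrite modulusM; have := modulus_ge0 (w - z); nra.
have := Hr (a * w + b); rewrite E => /(_ _).
move=> /(_ _) K.
rewrite (_ : a * d * (w - z) = d * (a * (w - z))); last by ring.
apply: le_trans (K _) _.
  by apply: le_lt_trans am _; rewrite mulrC -ltr_pdivlMr.
by rewrite mulrAC ler_pdivrMr// -mulrA ler_wpM2l ?(ltW e0)// [leRHS]mulrC.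
Qed.

Lemma diff_pt_near F G z (r : R) : 0 < r ->
  (forall w, modulus (w - z) < r -> F w = G w) -> diff_pt F z -> diff_pt G z.
Proof. by move=> r0 FG [d Hd]; exists d; exact: (has_deriv_near r0 FG Hd). Qed.

Lemma diff_pt_cst (c : C) z : diff_pt (fun _ => c) z.
Proof. by exists 0; exact: has_deriv_cst. Qed.

Lemma diff_pt_id z : diff_pt (fun w => w) z.
Proof. by exists 1; exact: has_deriv_id. Qed.

Lemma diff_ptD F G z : diff_pt F z -> diff_pt G z -> diff_pt (fun w => F w + G w) z.
Proof. by move=> [d Hd] [d' Hd']; eexists; exact: (has_derivD Hd Hd'). Qed.

Lemma diff_ptB F G z : diff_pt F z -> diff_pt G z -> diff_pt (fun w => F w - G w) z.
Proof. by move=> [d Hd] [d' Hd']; eexists; exact: (has_derivB Hd Hd'). Qed.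

Lemma diff_ptM F G z : diff_pt F z -> diff_pt G z -> diff_pt (fun w => F w * G w) z.
Proof. by move=> [d Hd] [d' Hd']; eexists; exact: (has_derivM Hd Hd'). Qed.

Lemma diff_ptX F z n : diff_pt F z -> diff_pt (fun w => F w ^+ n) z.
Proof.
move=> H; elim: n => [|n IH]; first by under eq_fun do rewrite expr0; exact: diff_pt_cst.
by under eq_fun do rewrite exprS; exact: diff_ptM.
Qed.

Lemma diff_ptV F z : F z != 0 -> diff_pt F z -> diff_pt (fun w => (F w)^-1) z.
Proof. by move=> F0 [d Hd]; eexists; exact: (has_derivV F0 Hd). Qed.

Lemma diff_pt_affine F (a b z : C) : diff_pt F (a * z + b) ->
  diff_pt (fun w => F (a * w + b)) z.
Proof. by move=> [d Hd]; eexists; exact: (has_deriv_affine Hd). Qed.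

Lemma diff_pt_continuous F z : diff_pt F z -> continuous_pt F z.
Proof.
move=> [d Hd] e e0; have [r r0 Hr] := Hd 1 ltr01.
have d1 : 0 < modulus d + 2 by have := @modulus_ge0 R d; lra.
exists (Num.min r (e / (modulus d + 2))); first by rewrite lt_min r0 divr_gt0.
move=> w; rewrite lt_min => /andP[wr we].
have := Hr w wr; rewrite mul1r => K.
rewrite (_ : F w - F z = (F w - F z - d * (w - z)) + d * (w - z)); last by ring.
apply: le_lt_trans (modulusD _ _) _; rewrite modulusM.
have : modulus (w - z) * (modulus d + 2) < e by rewrite -ltr_pdivlMr.
have := modulus_ge0 (w - z); nra.
Qed.

End Derivative.

(** * Integrals of bounded measurable functions on segments *)

Section Integral.
Context {R : realType}.
Local Notation C := (R[i]).
Local Notation mu := (@lebesgue_measure R).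
Implicit Types (a b c : R).

(** A bound at every point makes the class stable under products, and measurability instead of
    continuity admits the weight [dual], which may jump at zeros when [p = 1]. *)
Definition bmeas a b (h : R -> R) := measurable_fun `[a, b] h /\
  exists M : R, forall t, a <= t <= b -> `|h t| <= M.

Lemma bmeas_integrable a b h : bmeas a b h -> mu.-integrable `[a, b] (EFin \o h).
Proof.
move=> [mh [M hM]]; apply: measurable_bounded_integrable => //.
  exact: compact_finite_measure (@segment_compact _ a b).
exists M; split; first exact: num_real.
move=> N MN t /=; rewrite in_itv /= => tab.
exact: le_trans (hM t tab) (ltW MN).
Qed.

Lemma bmeas_cst a b (k : R) : bmeas a b (fun=> k).
Proof. by split => //; exists `|k|. Qed.

Lemma bmeasD a b f g : bmeas a b f -> bmeas a b g -> bmeas a b (fun t => f t + g t).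
Proof.
move=> [mf [M fM]] [mg [N gN]]; split; first exact: measurable_funD.
exists (M + N) => t tab; rewrite (le_trans (ler_normD _ _))//.
by rewrite lerD ?fM ?gN.
Qed.

Lemma bmeasM a b f g : bmeas a b f -> bmeas a b g -> bmeas a b (fun t => f t * g t).
Proof.
move=> [mf [M fM]] [mg [N gN]]; split; first exact: measurable_funM.
exists (M * N) => t tab; rewrite normrM.
by rewrite ler_pM ?fM ?gN.
Qed.

Lemma bmeasN a b f : bmeas a b f -> bmeas a b (fun t => - f t).
Proof.
move=> [mf [M fM]]; split; first exact: measurableT_comp.
by exists M => t tab; rewrite normrN fM.
Qed.

Lemma bmeasB a b f g : bmeas a b f -> bmeas a b g -> bmeas a b (fun t => f t - g t).
Proof. by move=> hf hg; apply: bmeasD => //; exact: bmeasN. Qed.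

Lemma within_continuousP a b (h : R -> R) :
  (forall t, a <= t <= b -> forall e : R, 0 < e -> exists2 d : R, 0 < d &
     forall s, a <= s <= b -> `|s - t| < d -> `|h s - h t| < e) ->
  {within `[a, b], continuous h}.
Proof.
move=> H.
  rewrite continuous_subspace_in => t; rewrite inE /= in_itv /= => tab.
  apply/cvgrPdist_lt => e e0; have [d d0 Hd] := H t tab e e0.
  have := @nbhs_subspace_in _ `[a, b]%classic t.
  rewrite /= in_itv /= => /(_ tab).
  rewrite /prop_near1 => <-.
  rewrite /within /=; apply/nbhs_ballP; exists d => // s; rewrite /ball /= => st.
  by rewrite in_itv /= => sab; rewrite distrC Hd// distrC.
Qed.

Lemma bmeas_continuous a b (h : R -> R) :
  (forall t, a <= t <= b -> forall e : R, 0 < e -> exists2 d : R, 0 < d &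
     forall s, a <= s <= b -> `|s - t| < d -> `|h s - h t| < e) -> bmeas a b h.
Proof.
move=> /within_continuousP ch.
split; first by apply: subspace_continuous_measurable_fun.
have /compact_bounded[M [_ mrt]] := continuous_compact ch (@segment_compact _ a b).
exists (M + 1) => t tab; apply: mrt; first by rewrite ltrDl.
by exists t => //=; rewrite in_itv.
Qed.

Definition bmeasC a b (h : R -> C) :=
  bmeas a b (fun t => complex.Re (h t)) /\ bmeas a b (fun t => complex.Im (h t)).

Lemma bmeasC_cst a b (k : C) : bmeasC a b (fun=> k).
Proof. by split; exact: bmeas_cst. Qed.

Lemma bmeasCD a b f g : bmeasC a b f -> bmeasC a b g -> bmeasC a b (fun t => f t + g t).
Proof.
move=> [f1 f2] [g1 g2]; split.
- by under eq_fun do rewrite ReD; exact: bmeasD.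
- by under eq_fun do rewrite ImD; exact: bmeasD.
Qed.

Lemma bmeasCM a b f g : bmeasC a b f -> bmeasC a b g -> bmeasC a b (fun t => f t * g t).
Proof.
move=> [f1 f2] [g1 g2]; split.
- by under eq_fun do rewrite ReMc; apply: bmeasB; exact: bmeasM.
- by under eq_fun do rewrite ImMc; apply: bmeasD; exact: bmeasM.
Qed.

Lemma bmeasCB a b f g : bmeasC a b f -> bmeasC a b g -> bmeasC a b (fun t => f t - g t).
Proof.
move=> [f1 f2] [g1 g2]; split.
- by under eq_fun do rewrite ReB; exact: bmeasB.
- by under eq_fun do rewrite ImB; exact: bmeasB.
Qed.

Definition continuousC a b (h : R -> C) :=
  forall t, a <= t <= b -> forall e : R, 0 < e -> exists2 d : R, 0 < d &
     forall s, a <= s <= b -> `|s - t| < d -> modulus (h s - h t) < e.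

Lemma bmeasC_continuous a b h : continuousC a b h -> bmeasC a b h.
Proof.
move=> H; split; apply: bmeas_continuous => t tab e e0;
  have [d d0 Hd] := H t tab e e0; exists d => // s sab st; have := Hd s sab st.
- by apply: le_lt_trans; rewrite -ReB Re_modulus.
- by apply: le_lt_trans; rewrite -ImB Im_modulus.
Qed.

Lemma bmeas_modulus a b h : bmeasC a b h -> bmeas a b (fun t => modulus (h t)).
Proof.
move=> [[m1 [M1 b1]] [m2 [M2 b2]]]; split.
  rewrite (_ : (fun t => _) = Num.sqrt \o
    (fun t => complex.Re (h t) ^+ 2 + complex.Im (h t) ^+ 2)); last first.
    by apply/funext => t; rewrite modulusE.
  apply: (@measurableT_comp _ _ _ _ _ _ (@Num.sqrt R)).
    exact: measurable_sqrt || (apply: continuous_measurable_fun; exact: sqrt_continuous).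
  by apply: measurable_funD; exact: measurable_funX.
exists (M1 + M2) => t tab; rewrite ger0_norm ?modulus_ge0//.
by rewrite (le_trans (modulus_le_ReIm _))// lerD ?b1 ?b2.
Qed.

Definition Cint a b (h : R -> C) : C := Cintegral `[a, b] h.

Lemma eq_Cint a b f g : (forall t, a <= t <= b -> f t = g t) -> Cint a b f = Cint a b g.
Proof.
by move=> fg; congr (_ +i* _); apply: eq_Rintegral => t;
  rewrite inE /= in_itv /= => tab; rewrite fg.
Qed.

Lemma CintD a b f g : bmeasC a b f -> bmeasC a b g ->
  Cint a b (fun t => f t + g t) = Cint a b f + Cint a b g.
Proof.
move=> [f1 f2] [g1 g2]; apply: complex_eqP => /=.
- under eq_Rintegral do rewrite ReD.
  by rewrite RintegralD//; exact: bmeas_integrable.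
- under eq_Rintegral do rewrite ImD.
  by rewrite RintegralD//; exact: bmeas_integrable.
Qed.

Lemma CintB a b f g : bmeasC a b f -> bmeasC a b g ->
  Cint a b (fun t => f t - g t) = Cint a b f - Cint a b g.
Proof.
move=> [f1 f2] [g1 g2]; apply: complex_eqP => /=.
- under eq_Rintegral do rewrite ReB.
  by rewrite RintegralB//; exact: bmeas_integrable.
- under eq_Rintegral do rewrite ImB.
  by rewrite RintegralB//; exact: bmeas_integrable.
Qed.

Lemma CintZ a b (k : C) f : bmeasC a b f ->
  Cint a b (fun t => k * f t) = k * Cint a b f.
Proof.
move=> [f1 f2]; apply: complex_eqP; rewrite ?ReMc ?ImMc /=.
- under eq_Rintegral do rewrite ReMc.
  rewrite RintegralB// ?RintegralZl//;
    by apply: bmeas_integrable => //; apply: bmeasM => //; exact: bmeas_cst.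
- under eq_Rintegral do rewrite ImMc.
  rewrite RintegralD// ?RintegralZl//;
    by apply: bmeas_integrable => //; apply: bmeasM => //; exact: bmeas_cst.
Qed.

Lemma Rint_cst a b (k : R) : a <= b -> \int[mu]_(_ in `[a, b]) k = k * (b - a).
Proof.
move=> ab; rewrite Rintegral_cst//= lebesgue_measure_itv /= lte_fin.
by case: ltgtP ab => // -> _; rewrite subrr.
Qed.

Lemma Cint_cst a b (k : C) : a <= b -> Cint a b (fun=> k) = k * (b - a)%:C.
Proof.
by move=> ab; apply: complex_eqP; rewrite ?ReMc ?ImMc /= Rint_cst// mulr0 ?subr0 ?add0r.
Qed.

Lemma Rint_split a b c h : a <= b -> b <= c -> bmeas a c h ->
  \int[mu]_(t in `[a, c]) h t = \int[mu]_(t in `[a, b]) h t + \int[mu]_(t in `[b, c]) h t.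
Proof.
move=> ab bc hh; have hi := bmeas_integrable hh.
have := @Rintegral_itvB R h (BLeft a) (BRight c) b hi.
rewrite !bnd_simp => /(_ ab bc) E.
rewrite -[LHS](subrK (\int[mu]_(t in `[a, b]) h t)) E addrC; congr (_ + _).
rewrite Rintegral_itv_obnd_cbnd//.
apply: integrableS hi => //; apply: subset_itvr; rewrite bnd_simp //.
Qed.

Lemma Cint_split a b c h : a <= b -> b <= c -> bmeasC a c h ->
  Cint a c h = Cint a b h + Cint b c h.
Proof. by move=> ab bc [h1 h2]; apply: complex_eqP => /=; exact: Rint_split. Qed.

Lemma RintZ a b f c : bmeas a b f ->
  \int[mu]_(t in `[a, b]) (c * f t) = c * \int[mu]_(t in `[a, b]) f t.
Proof.
by move=> hf; apply: RintegralZl; [exact: measurable_itv|exact: bmeas_integrable].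
Qed.

Lemma RintD a b f g : bmeas a b f -> bmeas a b g ->
  \int[mu]_(t in `[a, b]) (f t + g t) =
  \int[mu]_(t in `[a, b]) f t + \int[mu]_(t in `[a, b]) g t.
Proof.
by move=> hf hg; apply: RintegralD; [exact: measurable_itv|exact: bmeas_integrable..].
Qed.

Lemma le_Rint a b f g : bmeas a b f -> bmeas a b g ->
  (forall t, a <= t <= b -> f t <= g t) ->
  \int[mu]_(t in `[a, b]) f t <= \int[mu]_(t in `[a, b]) g t.
Proof.
move=> hf hg fg; apply: le_Rintegral => //; try exact: bmeas_integrable.
Qed.

(** A unimodular factor [u] turns the integral into its modulus; the real part of [u * h t] is then
    compared with [modulus (h t)]. *)
Lemma modulus_Cint a b h : bmeasC a b h ->
  modulus (Cint a b h) <= \int[mu]_(t in `[a, b]) modulus (h t).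
Proof.
move=> hh; set I := Cint a b h.
have [->|I0] := eqVneq I 0.
  by rewrite modulus0; apply: Rintegral_ge0.
pose u := I^*%C / (modulus I)%:C.
have mI0 : modulus I != 0 by rewrite modulus_eq0.
have mI0C : (modulus I)%:C != 0 by rewrite eq_complex /= eqxx andbT.
have uI : u * I = (modulus I)%:C.
  by rewrite /u mulrAC [_ * I]mulrC mulc_conj rmorphXn /= expr2 mulfK.
have u1 : modulus u = 1.
  by rewrite /u modulusM modulus_conj modulusV ger0_modulus// divff.
have -> : modulus I = complex.Re (Cint a b (fun t => u * h t)) by rewrite CintZ// uI.
have uh : bmeasC a b (fun t => u * h t) by apply: bmeasCM => //; exact: bmeasC_cst.
apply: le_Rint; [exact: (proj1 uh)|exact: bmeas_modulus|].
by move=> t tab; rewrite (le_trans (Re_le_modulus _))// modulusM u1 mul1r.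
Qed.

Lemma modulus_Cint_le a b h (M : R) : a <= b -> bmeasC a b h ->
  (forall t, a <= t <= b -> modulus (h t) <= M) -> modulus (Cint a b h) <= M * (b - a).
Proof.
move=> ab hh hM; apply: le_trans (modulus_Cint hh) _; rewrite -Rint_cst//.
by apply: le_Rint => //; [exact: bmeas_modulus|exact: bmeas_cst].
Qed.

End Integral.

(** * Goursat's theorem *)

Section Goursat.
Context {R : realType}.
Local Notation C := (R[i]).
Local Notation mu := (@lebesgue_measure R).
Implicit Types (F G : C -> C).

Lemma halving (S r : R) : 0 < r -> exists n : nat, S / 2 ^+ n < r.
Proof.
move=> r0; pose n := Num.bound (`|S| / r).
have Hn : `|S| / r < n%:R by apply: archi_boundP; rewrite divr_ge0// ltW.
exists n; rewrite ltr_pdivrMr ?exprn_gt0//.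
rewrite (le_lt_trans (ler_norm S))//.
have : `|S| < n%:R * r by rewrite -ltr_pdivrMr.
move=> /lt_le_trans; apply; rewrite mulrC ler_wpM2l ?(ltW r0)//.
by rewrite -natrX ler_nat ltnW// ltn_expl.
Qed.

(** If [M < x], then [(x / M) ^+ n] grows at least linearly by Bernoulli's inequality and exceeds
    [K / c]. This erases multiplicative constants from estimates valid for all powers. *)
Lemma le_of_pow_le (x M c K : R) : 0 <= x -> 0 <= M -> 0 < c ->
  (forall n, x ^+ n * c <= M ^+ n * K) -> x <= M.
Proof.
move=> x0 M0 c0 H; rewrite leNgt; apply/negP => Mx.
have [M00|] := eqVneq M 0.
  by have := H 1%N; rewrite !expr1 M00 mul0r; rewrite M00 in Mx; nra.
move=> Mn0; have Mp : 0 < M by rewrite lt_def Mn0.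
pose t := x / M - 1.
have t0 : 0 < t by rewrite subr_gt0 ltr_pdivlMr// mul1r.
have xE : x = M * (1 + t) by rewrite /t; field.
have bern n : 1 + n%:R * t <= (1 + t) ^+ n.
  elim: n => [|n IH]; first by rewrite mul0r addr0 expr0.
  rewrite exprS -natr1.
  have nt : 0 <= n%:R * t :> R by rewrite mulr_ge0// ltW.
  nra.
pose n := Num.bound (`|K| / (c * t)).
have ct : 0 < c * t by rewrite mulr_gt0.
have Hn : `|K| / (c * t) < n%:R by apply: archi_boundP; rewrite divr_ge0// ltW.
have := H n; rewrite xE exprMn -mulrA ler_pM2l ?exprn_gt0// => H1.
rewrite ltr_pdivrMr// in Hn.
have := bern n; have := ler_norm K; nra.
Qed.

(** The left ends increase and stay below every [u n + w / 2 ^+ n], so their supremum lies in all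
    the dyadic intervals. *)
Lemma nested_intervals (u : nat -> R) (w : R) : 0 <= w ->
  (forall n, u n <= u n.+1 <= u n + w / 2 ^+ n.+1) ->
  exists l, forall n, u n <= l <= u n + w / 2 ^+ n.
Proof.
move=> w0 H.
have half n : w / 2 ^+ n = w / 2 ^+ n.+1 + w / 2 ^+ n.+1.
  by rewrite exprS; field; rewrite expf_neq0.
(* Subtracting [w / 2 ^+ (n + k)] makes the bound inductive: each step uses at most half of what is
   left. *)
have K n k : u n <= u (n + k)%N <= u n + w / 2 ^+ n - w / 2 ^+ (n + k).
  elim: k => [|k /andP[IH1 IH2]]; first by rewrite addn0 addrK lexx.
  have /andP[H1 H2] := H (n + k)%N; rewrite addnS (le_trans IH1)//=.
  have := half (n + k)%N; lra.
have ub n : ubound (range u) (u n + w / 2 ^+ n).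
  move=> _ [m _ <-].
  have [nm|mn] := leqP n m.
    have /andP[_] := K n (m - n)%N; rewrite subnKC// => /le_trans; apply.
    by rewrite lerBlDr lerDl divr_ge0// exprn_ge0.
  have /andP[+ _] := K m (n - m)%N; rewrite subnKC ?(ltnW mn)// => /le_trans; apply.
  by rewrite lerDl divr_ge0// exprn_ge0.
exists (sup (range u)) => n; apply/andP; split.
  by apply: ub_le_sup; [exists (u 0%N + w / 2 ^+ 0)|exists n].
by apply: ge_sup => //; exists (u 0%N); exists 0%N.
Qed.

Lemma continuous_pt_modulus F z : continuous_pt F z -> forall e : R, 0 < e ->
  exists2 d : R, 0 < d & forall w, modulus (w - z) < d ->
    `|modulus (F w) - modulus (F z)| < e.
Proof.
move=> HF e /HF [d d0 Hd]; exists d => // w /Hd H.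
rewrite ltr_norml; have := modulus_lb (F w) (F z).
have := modulus_lb (F z) (F w); rewrite [modulus (F z - _)]modulusC; lra.
Qed.

Lemma pt_dist (x y x' y' : R) :
  modulus ((x +i* y) - (x' +i* y')) <= `|x - x'| + `|y - y'|.
Proof. exact: modulus_le_ReIm. Qed.

Lemma continuousC_h F a b y : (forall x, a <= x <= b -> continuous_pt F (x +i* y)) ->
  continuousC a b (fun x => F (x +i* y)).
Proof.
move=> H t tab e e0; have [d d0 Hd] := H t tab e e0.
exists d => // s _ st; apply: Hd; apply: le_lt_trans (pt_dist _ _ _ _) _.
by rewrite subrr normr0 addr0.
Qed.

Lemma continuousC_v F a b x : (forall y, a <= y <= b -> continuous_pt F (x +i* y)) ->
  continuousC a b (fun y => F (x +i* y)).
Proof.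
move=> H t tab e e0; have [d d0 Hd] := H t tab e e0.
exists d => // s _ st; apply: Hd; apply: le_lt_trans (pt_dist _ _ _ _) _.
by rewrite subrr normr0 add0r.
Qed.

(** The counterclockwise contour integral with opposite edges paired, [dz] being ['i] times [dy] on
    the vertical ones. *)
Definition rect_integral F (x1 x2 y1 y2 : R) : C :=
  Cint x1 x2 (fun x => F (x +i* y1) - F (x +i* y2)) +
  'i * Cint y1 y2 (fun y => F (x2 +i* y) - F (x1 +i* y)).

Definition on_boundary (P : C -> Prop) (x1 x2 y1 y2 : R) :=
  (forall x, x1 <= x <= x2 -> P (x +i* y1) /\ P (x +i* y2)) /\
  (forall y, y1 <= y <= y2 -> P (x1 +i* y) /\ P (x2 +i* y)).

Lemma bmeas_bottom F x1 x2 y1 y2 : on_boundary (continuous_pt F) x1 x2 y1 y2 ->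
  bmeasC x1 x2 (fun x => F (x +i* y1)).
Proof. by move=> [H _]; apply/bmeasC_continuous/continuousC_h => x /H []. Qed.

Lemma bmeas_top F x1 x2 y1 y2 : on_boundary (continuous_pt F) x1 x2 y1 y2 ->
  bmeasC x1 x2 (fun x => F (x +i* y2)).
Proof. by move=> [H _]; apply/bmeasC_continuous/continuousC_h => x /H []. Qed.

Lemma bmeas_left F x1 x2 y1 y2 : on_boundary (continuous_pt F) x1 x2 y1 y2 ->
  bmeasC y1 y2 (fun y => F (x1 +i* y)).
Proof. by move=> [_ H]; apply/bmeasC_continuous/continuousC_v => x /H []. Qed.

Lemma bmeas_right F x1 x2 y1 y2 : on_boundary (continuous_pt F) x1 x2 y1 y2 ->
  bmeasC y1 y2 (fun y => F (x2 +i* y)).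
Proof. by move=> [_ H]; apply/bmeasC_continuous/continuousC_v => x /H []. Qed.

Lemma rect_splitx F x1 x2 x3 y1 y2 : x1 <= x2 -> x2 <= x3 ->
  on_boundary (continuous_pt F) x1 x2 y1 y2 ->
  on_boundary (continuous_pt F) x2 x3 y1 y2 ->
  rect_integral F x1 x3 y1 y2 = rect_integral F x1 x2 y1 y2 + rect_integral F x2 x3 y1 y2.
Proof.
move=> x12 x23 H1 H2; rewrite /rect_integral (@Cint_split _ x1 x2 x3)//; last first.
  apply: bmeasCB; apply/bmeasC_continuous/continuousC_h => x /andP[xa xb];
  (have [xx|/ltW xx] := leP x x2;
    [have [+ _] := H1|have [+ _] := H2]);
  by move=> /(_ x); rewrite ?xa ?xb ?xx => /(_ isT) [].
have -> : Cint y1 y2 (fun y => F (x3 +i* y) - F (x1 +i* y)) =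
  Cint y1 y2 (fun y => F (x2 +i* y) - F (x1 +i* y)) +
  Cint y1 y2 (fun y => F (x3 +i* y) - F (x2 +i* y)).
  rewrite -CintD; last 2 first.
  - by apply: bmeasCB; [exact: bmeas_right H1|exact: bmeas_left H1].
  - by apply: bmeasCB; [exact: bmeas_right H2|exact: bmeas_left H2].
  by apply: eq_Cint => y _; ring.
ring.
Qed.

Lemma rect_splity F x1 x2 y1 y2 y3 : y1 <= y2 -> y2 <= y3 ->
  on_boundary (continuous_pt F) x1 x2 y1 y2 ->
  on_boundary (continuous_pt F) x1 x2 y2 y3 ->
  rect_integral F x1 x2 y1 y3 = rect_integral F x1 x2 y1 y2 + rect_integral F x1 x2 y2 y3.
Proof.
move=> y12 y23 H1 H2; rewrite /rect_integral (@Cint_split _ y1 y2 y3)//; last first.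
  apply: bmeasCB; apply/bmeasC_continuous/continuousC_v => x /andP[xa xb];
  (have [xx|/ltW xx] := leP x y2;
    [have [_ +] := H1|have [_ +] := H2]);
  by move=> /(_ x); rewrite ?xa ?xb ?xx => /(_ isT) [].
have -> : Cint x1 x2 (fun x => F (x +i* y1) - F (x +i* y3)) =
  Cint x1 x2 (fun x => F (x +i* y1) - F (x +i* y2)) +
  Cint x1 x2 (fun x => F (x +i* y2) - F (x +i* y3)).
  rewrite -CintD; last 2 first.
  - by apply: bmeasCB; [exact: bmeas_bottom H1|exact: bmeas_top H1].
  - by apply: bmeasCB; [exact: bmeas_bottom H2|exact: bmeas_top H2].
  by apply: eq_Cint => y _; ring.
ring.
Qed.

Lemma rect_le F x1 x2 y1 y2 (M : R) : x1 <= x2 -> y1 <= y2 ->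
  on_boundary (continuous_pt F) x1 x2 y1 y2 ->
  on_boundary (fun z => modulus (F z) <= M) x1 x2 y1 y2 ->
  modulus (rect_integral F x1 x2 y1 y2) <= 2 * M * ((x2 - x1) + (y2 - y1)).
Proof.
move=> x12 y12 H [B1 B2]; rewrite /rect_integral.
apply: le_trans (modulusD _ _) _; rewrite modulusM modulus_i mul1r mulrDr lerD//.
- apply: modulus_Cint_le => //.
    by apply: bmeasCB; [exact: bmeas_bottom H|exact: bmeas_top H].
  by move=> x /B1 [? ?]; apply: le_trans (modulusB _ _) _; lra.
- apply: modulus_Cint_le => //.
    by apply: bmeasCB; [exact: bmeas_right H|exact: bmeas_left H].
  by move=> x /B2 [? ?]; apply: le_trans (modulusB _ _) _; lra.
Qed.

(** An affine function differs by a constant between opposite edges, and the contributions of the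
    two pairs are opposite. No primitive is involved. *)
Lemma rect_affine F x1 x2 y1 y2 (c d z0 : C) : x1 <= x2 -> y1 <= y2 ->
  on_boundary (continuous_pt F) x1 x2 y1 y2 ->
  rect_integral (fun z => F z - (c + d * (z - z0))) x1 x2 y1 y2 =
  rect_integral F x1 x2 y1 y2.
Proof.
move=> x12 y12 H; rewrite /rect_integral.
have E1 x : (x +i* y1) - (x +i* y2) = 'i * (y1 - y2)%:C by apply: complex_eqP => /=; ring.
have E2 y : (x2 +i* y) - (x1 +i* y) = (x2 - x1)%:C by apply: complex_eqP => /=; ring.
rewrite (@eq_Cint _ x1 x2 _ (fun x => (F (x +i* y1) - F (x +i* y2)) - d * ('i * (y1 - y2)%:C))); last first.
  by move=> x _; rewrite -(E1 x); ring.
rewrite (@eq_Cint _ y1 y2 _ (fun y => (F (x2 +i* y) - F (x1 +i* y)) - d * (x2 - x1)%:C)); last first.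
  by move=> y _; rewrite -(E2 y); ring.
have hb := bmeas_bottom H; have ht := bmeas_top H.
have hl := bmeas_left H; have hr := bmeas_right H.
have hbt := bmeasCB hb ht; have hlr := bmeasCB hr hl.
rewrite (CintB hbt) ?(CintB hlr) ?Cint_cst//; try exact: bmeasC_cst.
rewrite !rmorphB /=.
have -> : (y1%:C - y2%:C : C) = - (y2%:C - y1%:C) by ring.
have := @sqr_i R; rewrite expr2 => I2; ring.
Qed.

Lemma le_in_itv (a b x1 x2 t : R) : x1 <= a -> b <= x2 -> a <= t <= b -> x1 <= t <= x2.
Proof. by move=> xa bx /andP[/(le_trans xa) -> /le_trans]; apply. Qed.

Lemma sub_boundary (P : C -> Prop) (a b c d x1 x2 y1 y2 : R) :
  (forall x y : R, x1 <= x <= x2 -> y1 <= y <= y2 -> P (x +i* y)) ->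
  x1 <= a -> b <= x2 -> y1 <= c -> d <= y2 -> a <= b -> c <= d ->
  on_boundary P a b c d.
Proof.
move=> H xa bx yc dy ab cd.
have [aa bb cc dd] : [/\ a <= a <= b, a <= b <= b, c <= c <= d & c <= d <= d].
  by rewrite !lexx ab cd.
by split=> t tab; split; apply: H; first [exact: (le_in_itv xa bx)|exact: (le_in_itv yc dy)].
Qed.

Lemma rect_quarter F px py w h : 0 <= w -> 0 <= h ->
  (forall x y : R, px <= x <= px + w + w -> py <= y <= py + h + h -> continuous_pt F (x +i* y)) ->
  rect_integral F px (px + w + w) py (py + h + h) =
  rect_integral F px (px + w) py (py + h) +
  rect_integral F px (px + w) (py + h) (py + h + h) +
  (rect_integral F (px + w) (px + w + w) py (py + h) +
   rect_integral F (px + w) (px + w + w) (py + h) (py + h + h)).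
Proof.
move=> w0 h0 H; have S := sub_boundary H.
have [X1 X2] : px <= px + w /\ px + w <= px + w + w by rewrite !lerDl.
have [Y1 Y2] : py <= py + h /\ py + h <= py + h + h by rewrite !lerDl.
have X3 := le_trans X1 X2; have Y3 := le_trans Y1 Y2.
rewrite (rect_splitx X1 X2) ?(rect_splity Y1 Y2)//; exact: S.
Qed.

Lemma half_step (a b u v w : R) : 0 <= w -> a <= u -> u + w + w <= b ->
  v = u \/ v = u + w -> [/\ a <= v, v + w <= b & u <= v <= u + w].
Proof. by move=> w0 au ub [] ->; split; try (apply/andP; split); lra. Qed.

Lemma quarter_pigeonhole (K : R) (I1 I2 I3 I4 : C) :
  4 * K < modulus (I1 + I2 + (I3 + I4)) ->
  [\/ K < modulus I1, K < modulus I2, K < modulus I3 | K < modulus I4].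
Proof.
move=> H; have [|H1] := ltP K (modulus I1); first by constructor 1.
have [|H2] := ltP K (modulus I2); first by constructor 2.
have [|H3] := ltP K (modulus I3); first by constructor 3.
have [|H4] := ltP K (modulus I4); first by constructor 4.
have := modulusD (I1 + I2) (I3 + I4); have := modulusD I1 I2; have := modulusD I3 I4; lra.
Qed.

Lemma goursat_step F (K px py w h : R) : 0 <= w -> 0 <= h ->
  (forall x y : R, px <= x <= px + w + w -> py <= y <= py + h + h -> continuous_pt F (x +i* y)) ->
  4 * K < modulus (rect_integral F px (px + w + w) py (py + h + h)) ->
  exists q : R * R, [/\ q.1 = px \/ q.1 = px + w, q.2 = py \/ q.2 = py + h &
    K < modulus (rect_integral F q.1 (q.1 + w) q.2 (q.2 + h))].
Proof.
move=> w0 h0 H; rewrite (rect_quarter w0 h0 H) => /quarter_pigeonhole [] ?.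
- by exists (px, py); split => //; left.
- by exists (px, py + h); split => //; [left|right].
- by exists (px + w, py); split => //; [right|left].
- by exists (px + w, py + h); split => //; right.
Qed.

(** Once the affine part at the point of differentiability is removed, the integrand is at most
    [e * (w + h)] on a boundary of length [2 * (w + h)]. *)
Lemma goursat_local F (lx ly px py w h e : R) (d : C) : 0 <= w -> 0 <= h -> 0 < e ->
  (forall x y : R, px <= x <= px + w -> py <= y <= py + h -> diff_pt F (x +i* y)) ->
  px <= lx <= px + w -> py <= ly <= py + h ->
  (forall z, modulus (z - (lx +i* ly)) <= w + h ->
     modulus (F z - F (lx +i* ly) - d * (z - (lx +i* ly))) <=
     e * modulus (z - (lx +i* ly))) ->
  modulus (rect_integral F px (px + w) py (py + h)) <= 2 * e * (w + h) ^+ 2.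
Proof.
move=> w0 h0 e0 HF lxP lyP Hd.
have pw : px <= px + w by rewrite lerDl.
have ph : py <= py + h by rewrite lerDl.
have sub P H := @sub_boundary P px (px + w) py (py + h) _ _ _ _ H (lexx _) (lexx _) (lexx _) (lexx _) pw ph.
rewrite -(@rect_affine F px (px + w) py (py + h) (F (lx +i* ly)) d (lx +i* ly)) //; last first.
  by apply: sub => x y hx hy; exact/diff_pt_continuous/HF.
have -> : 2 * e * (w + h) ^+ 2 = 2 * (e * (w + h)) * (px + w - px + (py + h - py)) by ring.
apply: rect_le => //; apply: sub => x y hx hy.
- apply/diff_pt_continuous/diff_ptB; first exact: HF.
  apply: diff_ptD; first exact: diff_pt_cst.
  apply: diff_ptM; first exact: diff_pt_cst.
  by apply: diff_ptB; [exact: diff_pt_id|exact: diff_pt_cst].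
- have dl : modulus ((x +i* y) - (lx +i* ly)) <= w + h.
    apply: le_trans (pt_dist _ _ _ _) _.
    move: hx hy lxP lyP => /andP[? ?] /andP[? ?] /andP[? ?] /andP[? ?].
    by apply: lerD; rewrite ler_norml; apply/andP; split; lra.
  rewrite opprD addrA; apply: le_trans (Hd _ dl) _.
  by rewrite ler_wpM2l// ltW.
Qed.

Lemma goursat F x1 x2 y1 y2 : x1 <= x2 -> y1 <= y2 ->
  (forall x y : R, x1 <= x <= x2 -> y1 <= y <= y2 -> diff_pt F (x +i* y)) ->
  rect_integral F x1 x2 y1 y2 = 0.
Proof.
move=> x12 y12 HF.
apply/eqP/negPn/negP => I0.
have [w w0 wE] : exists2 w, 0 <= w & x2 = x1 + w.
  by exists (x2 - x1); rewrite ?subr_ge0// subrKC.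
have [h h0 hE] : exists2 h, 0 <= h & y2 = y1 + h.
  by exists (y2 - y1); rewrite ?subr_ge0// subrKC.
subst x2 y2.
(* The lower bound scales with the square of [w + h], so that quartering divides both of its sides
   by 4. The 1 added in [S1] covers a degenerate rectangle. *)
have [e e0 eS] : exists2 e, 0 < e & e * (w + h) ^+ 2 <
    modulus (rect_integral F x1 (x1 + w) y1 (y1 + h)).
  have m0 : 0 < modulus (rect_integral F x1 (x1 + w) y1 (y1 + h)) by rewrite modulus_gt0.
  have S1 : 0 < (w + h) ^+ 2 + 1 by rewrite ltr_wpDl// sqr_ge0.
  eexists; first exact: (divr_gt0 m0 S1).
  by rewrite mulrAC ltr_pdivrMr// ltr_pM2l// ltrDl.
pose bad n (p : R * R) := [/\ x1 <= p.1, p.1 + w / 2 ^+ n <= x1 + w, y1 <= p.2,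
  p.2 + h / 2 ^+ n <= y1 + h & e * ((w + h) / 2 ^+ n) ^+ 2 <
    modulus (rect_integral F p.1 (p.1 + w / 2 ^+ n) p.2 (p.2 + h / 2 ^+ n))].
have half (v : R) n : v / 2 ^+ n = v / 2 ^+ n.+1 + v / 2 ^+ n.+1.
  by rewrite exprS; field; rewrite expf_neq0.
have pos (v : R) n : 0 <= v -> 0 <= v / 2 ^+ n by move=> v0; rewrite divr_ge0// exprn_ge0.
(* The badness of [p] sits inside the existential so that [cid] gives a total choice function; a [p]
   that is not bad is returned as a dummy value. *)
have step n p : exists q, bad n p -> bad n.+1 q /\
   (p.1 <= q.1 <= p.1 + w / 2 ^+ n.+1 /\ p.2 <= q.2 <= p.2 + h / 2 ^+ n.+1).
  have [[p1 p2 p3 p4 p5]|] := pselect (bad n p); last by exists p.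
  have w'0 := pos w n.+1 w0; have h'0 := pos h n.+1 h0.
  have E : e * ((w + h) / 2 ^+ n) ^+ 2 = 4 * (e * ((w + h) / 2 ^+ n.+1) ^+ 2).
    by rewrite (half (w + h)); ring.
  rewrite {}E (half w) (half h) !addrA in p2 p4 p5.
  have [|q [q1 q2 q3]] := goursat_step w'0 h'0 _ p5.
    by move=> x y hx hy; apply/diff_pt_continuous/HF;
      [exact: le_in_itv p1 p2 hx|exact: le_in_itv p3 p4 hy].
  have [? ? ?] := half_step w'0 p1 p2 q1; have [? ? ?] := half_step h'0 p3 p4 q2.
  by exists q.
pose f n p := projT1 (cid (step n p)).
have fP n p : bad n p -> bad n.+1 (f n p) /\
   (p.1 <= (f n p).1 <= p.1 + w / 2 ^+ n.+1 /\ p.2 <= (f n p).2 <= p.2 + h / 2 ^+ n.+1).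
  by rewrite /f; case: cid.
pose s := fix s n := if n is n'.+1 then f n' (s n') else (x1, y1).
have sb n : bad n (s n).
  elim: n => [|n IH]; last by have [] := fP n _ IH.
  by rewrite /bad /= expr0 !divr1; split.
have sP n := (fP n (s n) (sb n)).2.
have [lx Hlx] := @nested_intervals (fun n => (s n).1) w w0 (fun n => (sP n).1).
have [ly Hly] := @nested_intervals (fun n => (s n).2) h h0 (fun n => (sP n).2).
have [d Hd] : diff_pt F (lx +i* ly).
  by have := Hlx 0%N; have := Hly 0%N; rewrite /= expr0 !divr1 => *; exact: HF.
(* With tolerance [e / 2] the local estimate becomes [e * ((w + h) / 2 ^+ n) ^+ 2], exactly the
   quantity that [bad] says is exceeded. *)
have e4 : 0 < e / 2 by rewrite divr_gt0.
have [r r0 Hr] := Hd _ e4.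
have [n Hn] := halving (w + h) r0.
have [b1 b2 b3 b4] := sb n.
have := @goursat_local F lx ly _ _ _ _ _ d (pos w n w0) (pos h n h0) e4 _ (Hlx n) (Hly n).
move=> /(_ _ _) K; rewrite ltNge => /negP; apply; rewrite mulrDl.
have -> : e = 2 * (e / 2) by field.
apply: K => [x y hx hy|z zs].
  by apply: HF; [exact: le_in_itv hx|exact: le_in_itv hy].
by apply: Hr; apply: le_lt_trans zs _; rewrite -mulrDl.
Qed.

(** The frame between the two squares is cut into two full-height strips and two rectangles below
    and above the inner square; Goursat's theorem kills all four. *)
Lemma rect_shrink F (d rho : R) : 0 < d -> d < rho ->
  (forall x y : R, - rho <= x <= rho -> - rho <= y <= rho -> x +i* y != 0 ->
     diff_pt F (x +i* y)) ->
  rect_integral F (- rho) rho (- rho) rho = rect_integral F (- d) d (- d) d.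
Proof.
move=> d0 drho HF.
have far x y : d <= `|x| \/ d <= `|y| -> x +i* y != 0.
  by move=> xy; apply/negP => /eqP[x0 y0]; move: xy; rewrite x0 y0 normr0 leNgt d0; case.
have [d1 d2 d3 d4] : [/\ - rho <= - d, - d <= d, d <= rho & - d <= rho].
  by split; lra.
have l1 x : - rho <= x <= - d -> d <= `|x|.
  by move=> /andP[_ xd]; rewrite lerNr in xd; rewrite -normrN (le_trans xd)// ler_norm.
have l2 x : d <= x <= rho -> d <= `|x|.
  by move=> /andP[xd _]; rewrite (le_trans xd)// ler_norm.
have r1 x : - rho <= x <= - d -> - rho <= x <= rho by apply: le_in_itv.
have r2 x : d <= x <= rho -> - rho <= x <= rho by apply: le_in_itv => //; lra.
have r3 x : - d <= x <= d -> - rho <= x <= rho by apply: le_in_itv.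
have dN : d <= `|- d| by rewrite normrN ler_norm.
have dP : d <= `|d| by rewrite ler_norm.
have itvN : - rho <= - d <= rho by rewrite d1 d4.
have itvP : - rho <= d <= rho by rewrite d3 (le_trans d1 d2).
have [e1 e2] : d <= `|- rho| /\ d <= `|rho|.
  by split; [rewrite normrN|]; rewrite (le_trans (ltW drho))// ler_norm.
have [eN eP] : - rho <= - rho <= rho /\ - rho <= rho <= rho by rewrite !lexx (le_trans d1 d4).
have cF x y : - rho <= x <= rho -> - rho <= y <= rho -> d <= `|x| \/ d <= `|y| ->
    continuous_pt F (x +i* y).
  by move=> hx hy /far; move/(HF x y hx hy); exact: diff_pt_continuous.
have B a b c d' : (forall t, a <= t <= b -> - rho <= t <= rho) ->
  (forall t, c <= t <= d' -> - rho <= t <= rho) ->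
  - rho <= a <= rho -> - rho <= b <= rho -> - rho <= c <= rho -> - rho <= d' <= rho ->
  d <= `|a| -> d <= `|b| -> d <= `|c| -> d <= `|d'| ->
  on_boundary (continuous_pt F) a b c d'.
  by move=> *; split=> t tt; split; apply: cF => //; auto.
have r4 x : - d <= x <= rho -> - rho <= x <= rho by apply: le_in_itv => //; lra.
have full t : - rho <= t <= rho -> - rho <= t <= rho by [].
rewrite (@rect_splitx F _ (- d))//; [|exact: B|exact: B].
rewrite (@rect_splitx F (- d) d)//; [|exact: B|exact: B].
rewrite (@rect_splity F (- d) d _ (- d))//; [|exact: B|exact: B].
rewrite (@rect_splity F (- d) d (- d) d)//; [|exact: B|exact: B].
rewrite (@goursat F (- rho) (- d)) ?(@goursat F d rho) ?(@goursat F (- d) d (- rho))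
  ?(@goursat F (- d) d d rho) ?add0r ?addr0 //; try lra; move=> x y hx hy;
 (apply: HF; [by auto|by auto|apply: far; by auto]).
Qed.

(** The integral can be moved to a square of half-side [d], where it is at most [8 * B * d]. *)
Lemma rect_punctured F (rho B r : R) : 0 < rho -> 0 < r ->
  (forall x y : R, - rho <= x <= rho -> - rho <= y <= rho -> x +i* y != 0 ->
     diff_pt F (x +i* y)) ->
  (forall z : C, z != 0 -> modulus z < r -> modulus (F z) <= B) ->
  rect_integral F (- rho) rho (- rho) rho = 0.
Proof.
move=> rho0 r0 HF HB; apply/eqP; rewrite -modulus_eq0 eq_le modulus_ge0 andbT.
have B0 : 0 <= B.
  have r2 : 0 < r / 2 by lra.
  apply: le_trans (HB (r / 2)%:C _ _); first exact: modulus_ge0.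
    by rewrite -modulus_gt0 ger0_modulus ?(ltW r2).
  by rewrite ger0_modulus; lra.
apply/ler_addgt0Pl => e e0; rewrite addr0.
have B1 : 0 < 8 * (B + 1) by lra.
(* On the small square [modulus z <= 2 * d], so [d <= r / 4] keeps it within reach of the bound [B];
   [B + 1] avoids a zero denominator. *)
have [d d0 [drho [de dr]]] : exists2 d, 0 < d & d < rho /\ (d * (8 * (B + 1)) <= e /\ d <= r / 4).
  exists (Num.min (rho / 2) (Num.min (e / (8 * (B + 1))) (r / 4))).
    by rewrite !lt_min !divr_gt0.
  split; first by rewrite gt_min; apply/orP; left; lra.
  by split; [rewrite -ler_pdivlMr// !ge_min lexx !orbT|rewrite !ge_min lexx !orbT].
rewrite (rect_shrink d0 drho HF).
have dd : - d <= d by lra.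
have nz x y : `|x| = d \/ `|y| = d -> x +i* y != 0.
  by move=> xy; apply/negP => /eqP[x0 y0]; move: xy; rewrite x0 y0 normr0; case; lra.
have [dN dP] : `|- d| = d /\ `|d| = d by rewrite normrN ger0_norm// ltW.
have i1 t : - d <= t <= d -> - rho <= t <= rho by apply: le_in_itv; lra.
have [i2 i3] : - rho <= - d <= rho /\ - rho <= d <= rho by split; apply/andP; split; lra.
have c0 : on_boundary (continuous_pt F) (- d) d (- d) d.
  by split=> t tt; split; apply/diff_pt_continuous/HF; auto.
have b0 : on_boundary (fun z => modulus (F z) <= B) (- d) d (- d) d.
  have K x y : `|x| <= d -> `|y| <= d -> modulus (x +i* y) < r.
    by move=> ? ?; apply: le_lt_trans (modulus_le_ReIm _) _ => /=; lra.
  have K' t : - d <= t <= d -> `|t| <= d by rewrite ler_norml.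
  have [dN' dP'] : `|- d| <= d /\ `|d| <= d by rewrite dN dP.
  by split=> t /K' tt; split; apply: HB; auto.
by have := rect_le dd dd c0 b0; clear -de d0; lra.
Qed.

(** The integral is [2 * pi * 'i], but a crude bound is enough, as powers remove constants later. In
    the imaginary part each pair of edges has integrand [2 * rho / (t ^+ 2 + rho ^+ 2)], at least
    [rho^-1], over a length [2 * rho]. *)
Lemma rect_inv (rho : R) : 0 < rho ->
  4 <= modulus (rect_integral (fun z => z^-1) (- rho) rho (- rho) rho).
Proof.
move=> r0; apply: le_trans (Im_modulus _); apply: le_trans (ler_norm _).
have r2 : - rho <= rho by lra.
have cV z : z != 0 -> continuous_pt (fun z : C => z^-1) z.
  by move=> z0; apply/diff_pt_continuous/diff_ptV => //; exact: diff_pt_id.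
have c0 : on_boundary (continuous_pt (fun z : C => z^-1)) (- rho) rho (- rho) rho.
  by split=> t _; split; apply: cV; rewrite eq_complex /= ?oppr_eq0 ?(gt_eqF r0) ?andbF.
have hb := bmeas_bottom c0; have ht := bmeas_top c0.
have hl := bmeas_left c0; have hr := bmeas_right c0.
have [hbt1 hbt2] := bmeasCB hb ht; have [hlr1 hlr2] := bmeasCB hr hl.
have -> : (4 : R) = rho^-1 * (rho - - rho) + rho^-1 * (rho - - rho) by field; rewrite gt_eqF.
have key t : - rho <= t <= rho -> rho^-1 <= 2 * rho / (t ^+ 2 + rho ^+ 2).
  move=> /andP[? ?]; have t0 := sqr_ge0 t.
  have p0 : 0 < t ^+ 2 + rho ^+ 2 by rewrite ltr_wpDl// exprn_gt0.
  by rewrite ler_pdivlMr// mulrC ler_pdivrMr//; nra.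
rewrite ImD ImMc /= mul0r mul1r add0r; apply: lerD; rewrite -Rint_cst//.
- apply: le_Rint => //; first exact: bmeas_cst.
  move=> t trho; apply: le_trans (key t trho) _.
  have t0 := sqr_ge0 t; have p0 : 0 < t ^+ 2 + rho ^+ 2 by rewrite ltr_wpDl// exprn_gt0.
  by rewrite /= !sqrrN -subr_ge0 le_eqVlt; apply/orP; left; apply/eqP; field; rewrite gt_eqF.
- apply: le_Rint => //; first exact: bmeas_cst.
  move=> t trho; apply: le_trans (key t trho) _.
  have t0 := sqr_ge0 t; have p0 : 0 < t ^+ 2 + rho ^+ 2 by rewrite ltr_wpDl// exprn_gt0.
  by rewrite /= !sqrrN [rho ^+ 2 + _]addrC -subr_ge0 le_eqVlt; apply/orP; left; apply/eqP; field; rewrite gt_eqF.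
Qed.

Lemma rect_lin F G (a : C) (x1 x2 y1 y2 : R) :
  on_boundary (continuous_pt F) x1 x2 y1 y2 ->
  on_boundary (continuous_pt G) x1 x2 y1 y2 ->
  rect_integral (fun z => a * F z - G z) x1 x2 y1 y2 =
  a * rect_integral F x1 x2 y1 y2 - rect_integral G x1 x2 y1 y2.
Proof.
move=> HF HG; rewrite /rect_integral.
have Fh := bmeasCB (bmeas_bottom HF) (bmeas_top HF).
have Fv := bmeasCB (bmeas_right HF) (bmeas_left HF).
have Gh := bmeasCB (bmeas_bottom HG) (bmeas_top HG).
have Gv := bmeasCB (bmeas_right HG) (bmeas_left HG).
have aFh := bmeasCM (bmeasC_cst x1 x2 a) Fh.
have aFv := bmeasCM (bmeasC_cst y1 y2 a) Fv.
rewrite (@eq_Cint _ x1 x2 _ (fun x => a * (F (x +i* y1) - F (x +i* y2)) - (G (x +i* y1) - G (x +i* y2)))); last first.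
  by move=> x _; ring.
rewrite (@eq_Cint _ y1 y2 _ (fun y => a * (F (x2 +i* y) - F (x1 +i* y)) - (G (x2 +i* y) - G (x1 +i* y)))); last first.
  by move=> x _; ring.
rewrite (CintB aFh Gh) (CintB aFv Gv) (CintZ _ Fh) (CintZ _ Fv); ring.
Qed.

(* Integrating [(F 0 - F z) / z] gives the bound [2 m]; the constant is removed
   by applying it to the powers of [F]. *)
Lemma square_center_le F (rho m : R) : 0 < rho ->
  (forall x y : R, - rho <= x <= rho -> - rho <= y <= rho -> diff_pt F (x +i* y)) ->
  on_boundary (fun z => modulus (F z) <= m) (- rho) rho (- rho) rho ->
  modulus (F 0) <= m.
Proof.
move=> r0 HF Hm; have r2 : - rho <= rho by lra.
have m0 : 0 <= m.
  by apply: le_trans (proj1 (Hm.1 0 _)); rewrite ?modulus_ge0//; lra.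
suff weak G M : (forall x y : R, - rho <= x <= rho -> - rho <= y <= rho -> diff_pt G (x +i* y)) ->
  on_boundary (fun z => modulus (G z) <= M) (- rho) rho (- rho) rho ->
  modulus (G 0) * 4 <= M * 8.
  apply: (@le_of_pow_le _ _ 4 8) => // n; rewrite -modulusX.
  apply: (weak (fun z => F z ^+ n)) => [x y hx hy|]; first by apply/diff_ptX/HF.
  by case: Hm => h1 h2; split=> t; [move/h1|move/h2] => -[? ?];
    split; rewrite modulusX; apply: lerXn2r; rewrite ?nnegrE ?modulus_ge0.
move=> {HF Hm m m0} HG HM.
have nz0 : on_boundary (fun z => z != 0) (- rho) rho (- rho) rho.
  by split=> t _; split; rewrite eq_complex /= ?oppr_eq0 ?(gt_eqF r0) ?andbF.
have nzm : on_boundary (fun z => rho <= modulus z) (- rho) rho (- rho) rho.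
  split=> t _; split.
  - by apply: le_trans (Im_modulus _); rewrite /= normrN ger0_norm// ltW.
  - by apply: le_trans (Im_modulus _); rewrite /= ger0_norm// ltW.
  - by apply: le_trans (Re_modulus _); rewrite /= normrN ger0_norm// ltW.
  - by apply: le_trans (Re_modulus _); rewrite /= ger0_norm// ltW.
have cV z : z != 0 -> diff_pt (fun z : C => z^-1) z.
  by move=> z0; apply: diff_ptV => //; exact: diff_pt_id.
have zN z : rho <= modulus z -> z != 0.
  by move=> rz; rewrite -modulus_gt0 (lt_le_trans r0).
have cI : on_boundary (continuous_pt (fun z : C => z^-1)) (- rho) rho (- rho) rho.
  by case: nzm => h1 h2; split=> t; [move/h1|move/h2] => -[/zN ? /zN ?]; split;
    apply/diff_pt_continuous/cV.
have cG : on_boundary (continuous_pt (fun z : C => G z * z^-1)) (- rho) rho (- rho) rho.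
  have Ne : - rho <= - rho <= rho by rewrite lexx.
  have Pe : - rho <= rho <= rho by rewrite lexx r2.
  case: nzm => h1 h2; split=> t tt; [have [/zN ? /zN ?] := h1 t tt|have [/zN ? /zN ?] := h2 t tt];
    by split; apply/diff_pt_continuous/diff_ptM; [exact: HG|exact: cV|exact: HG|exact: cV].
have bG : on_boundary (fun z => modulus (G z * z^-1) <= M / rho) (- rho) rho (- rho) rho.
  case: nzm HM => h1 h2 [k1 k2].
  have K z : rho <= modulus z -> modulus (G z) <= M -> modulus (G z * z^-1) <= M / rho.
    move=> rz Gz; rewrite modulusM modulusV; apply: ler_pM => //; rewrite ?invr_ge0 ?modulus_ge0//.
    by rewrite lef_pV2 // posrE (lt_le_trans r0).
  by split=> t tt; [have [? ?] := h1 t tt; have [? ?] := k1 t tt|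
    have [? ?] := h2 t tt; have [? ?] := k2 t tt]; split; exact: K.
have [d Hd] : diff_pt G 0 by apply: (HG 0 0); rewrite oppr_le0 (ltW r0).
have [r rr0 Hr] := Hd 1 ltr01.
(* Differentiability of [G] at 0 bounds the quotient near 0 by [1 + modulus d], so the puncture does
   not contribute. *)
have Z : rect_integral (fun z => G 0 * z^-1 - G z * z^-1) (- rho) rho (- rho) rho = 0.
  apply: (@rect_punctured _ rho (1 + modulus d) r) => // [x y hx hy z0|z z0 zr].
    apply: diff_ptB; first by apply: diff_ptM; [exact: diff_pt_cst|exact: cV].
    by apply: diff_ptM; [exact: HG|exact: cV].
  have mz : 0 < modulus z by rewrite modulus_gt0.
  have := Hr z; rewrite subr0 mul1r => /(_ zr) K.
  rewrite -mulrBl modulusM modulusV ler_pdivrMr// modulusC.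
  rewrite (_ : G z - G 0 = (G z - G 0 - d * z) + d * z); last by ring.
  by apply: le_trans (modulusD _ _) _; rewrite modulusM; lra.
rewrite rect_lin// in Z.
have r22 : - rho <= rho by lra.
have := rect_le r22 r22 cG bG; have := rect_inv r0.
have -> : 2 * (M / rho) * (rho - - rho + (rho - - rho)) = M * 8 by field; rewrite gt_eqF.
move/eqP: Z; rewrite subr_eq0 => /eqP <-; rewrite modulusM => H1 H2.
by apply: le_trans H2; rewrite ler_wpM2l ?modulus_ge0.
Qed.

End Goursat.

(** * Maximum principle *)

Section MaximumPrinciple.
Context {R : realType}.
Local Notation C := (R[i]).
Implicit Types (F G : C -> C) (K : C -> Prop).

(** Closedness in terms of [modulus], so that plane sets can be transported to [R * R], where
    compactness is established. *)
Definition closed_plane K := forall z : C, ~ K z ->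
  exists2 r : R, 0 < r & forall w, modulus (w - z) < r -> ~ K w.

Lemma compact_plane K (B : R) : (forall z, K z -> modulus z <= B) -> closed_plane K ->
  compact [set p : R * R | K (p.1 +i* p.2)].
Proof.
move=> KB Kc.
apply: (@subclosed_compact _ _ (`[- B, B] `*` `[- B, B])%classic).
- move=> p clp /=; apply: contrapT => /Kc [r r0 Hr].
  have r2 : 0 < r / 2 by rewrite divr_gt0.
  have [q [Kq /= [q1 q2]]] := clp (ball p (r / 2)) (nbhsx_ballx p _ r2).
  apply: (Hr (q.1 +i* q.2)) => //.
  rewrite modulusC; apply: le_lt_trans (pt_dist _ _ _ _) _.
  by move: q1 q2; rewrite /ball /=; lra.
- by apply: compact_setX; exact: segment_compact.
- move=> [x y] /= /KB zB; split; rewrite /= in_itv /= -ler_norml.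
    exact: le_trans (Re_modulus (x +i* y)) zB.
  exact: le_trans (Im_modulus (x +i* y)) zB.
Qed.

Lemma argmax_plane K (u : C -> R) (B : R) : (exists z, K z) ->
  (forall z, K z -> modulus z <= B) -> closed_plane K ->
  (forall z, K z -> forall e : R, 0 < e -> exists2 d : R, 0 < d &
     forall w, K w -> modulus (w - z) < d -> `|u w - u z| < e) ->
  exists2 z, K z & forall w, K w -> u w <= u z.
Proof.
move=> [z0 Kz0] KB Kc Hu.
have [||[x y] + Hmax] := @compact_EVT_max _ R (fun p : R * R => u (p.1 +i* p.2)) _ _ (compact_plane KB Kc).
- by exists (complex.Re z0, complex.Im z0) => /=; case: z0 Kz0.
- rewrite continuous_subspace_in => -[x y]; rewrite inE /= => Kxy.
  apply/cvgrPdist_lt => e e0; have [d d0 Hd] := Hu _ Kxy e e0.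
  have := @nbhs_subspace_in _ [set p : R * R | K (p.1 +i* p.2)] (x, y) Kxy.
  rewrite /prop_near1 => <-.
  have d2 : 0 < d / 2 by rewrite divr_gt0.
  rewrite /within /=; apply/nbhs_ballP; exists (d / 2) => // -[x' y'] /= [].
  rewrite /ball /= => xx' yy' Kq; rewrite distrC; apply: Hd => //.
  rewrite modulusC; apply: le_lt_trans (pt_dist _ _ _ _) _; lra.
- rewrite inE /= => Kxy; exists (x +i* y) => // -[a b] Kab.
  by have := Hmax (a, b); rewrite inE /=; apply.
Qed.

Lemma closed_planeI K1 K2 : closed_plane K1 -> closed_plane K2 ->
  closed_plane (fun z => K1 z /\ K2 z).
Proof.
move=> H1 H2 z /not_andP[/H1|/H2] [r r0 Hr]; exists r => // w /Hr N [];
 by [].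
Qed.

Lemma closed_plane_disc (a : C) (rho : R) : closed_plane (fun z => modulus (z - a) <= rho).
Proof.
move=> z /negP; rewrite -ltNge => H; exists (modulus (z - a) - rho); first by rewrite subr_gt0.
move=> w; rewrite [modulus (w - z)]modulusC => wz /= wr; have := modulus_triangle w z a; lra.
Qed.

Lemma closed_plane_disc0 (rho : R) : closed_plane (fun z : C => modulus z <= rho).
Proof.
move=> z; have := @closed_plane_disc 0 rho z; rewrite subr0 => H /H [r r0 Hr].
by exists r => // w /Hr; rewrite subr0.
Qed.

Lemma closed_plane_codisc (a : C) (rho : R) : closed_plane (fun z => rho <= modulus (z - a)).
Proof.
move=> z /negP; rewrite -ltNge => H; exists (rho - modulus (z - a)); first by rewrite subr_gt0.
move=> w wz /= wr; have := modulus_triangle z w a; lra.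
Qed.

Lemma bounded_plane K F (B : R) :
  (forall z, K z -> modulus z <= B) -> closed_plane K ->
  (forall z, K z -> continuous_pt F z) -> exists2 M : R, 0 <= M &
  forall z, K z -> modulus (F z) <= M.
Proof.
move=> KB Kc Fc.
have [Kz|N] := pselect (exists z, K z); last first.
  by exists 0 => // z Kz; case: N; exists z.
have [|z Kz' Hz] := argmax_plane (u := fun z => modulus (F z)) Kz KB Kc.
  move=> z /Fc/continuous_pt_modulus H e /H [d d0 Hd]; exists d => // w _; exact: Hd.
by exists (modulus (F z)).
Qed.

Lemma lower_plane K F (B : R) :
  (forall z, K z -> modulus z <= B) -> closed_plane K ->
  (forall z, K z -> continuous_pt F z) -> (forall z, K z -> F z != 0) ->
  exists2 m : R, 0 < m & forall z, K z -> m <= modulus (F z).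
Proof.
move=> KB Kc Fc F0.
have [Kz|N] := pselect (exists z, K z); last first.
  by exists 1 => // z Kz; case: N; exists z.
have [|z Kz' Hz] := argmax_plane (u := fun z => - modulus (F z)) Kz KB Kc.
  move=> z /Fc/continuous_pt_modulus H e /H [d d0 Hd]; exists d => // w _ /Hd.
  by rewrite -opprD normrN.
exists (modulus (F z)) => [|w /Hz]; first by rewrite modulus_gt0 F0.
by rewrite lerN2.
Qed.

(** Compactness of the edge turns strict bounds at its points into one uniform bound below [N]. *)
Lemma square_edge_lt F (a : C) (s N : R) : 0 < s ->
  (forall z, modulus z <= 2 * s -> continuous_pt F (a + z)) ->
  (forall y : R, - s <= y <= s -> modulus (F (a + (s +i* y))) < N) ->
  exists2 m, m < N & forall y : R, - s <= y <= s -> modulus (F (a + (s +i* y))) <= m.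
Proof.
move=> s0 Fc HN.
have [||||z [z1 z2] Hz] := @argmax_plane (fun z => complex.Re z = s /\ - s <= complex.Im z <= s)
   (fun z => modulus (F (a + z))) (2 * s) _ _ _ _.
- by exists (s +i* 0) => /=; split => //; apply/andP; split; lra.
- move=> z [z1]; rewrite -ler_norml => z2; apply: le_trans (modulus_le_ReIm z) _.
  by rewrite z1 gtr0_norm//; lra.
- move=> z /not_andP[/eqP z1|/negP].
    exists (`|complex.Re z - s|); first by rewrite normr_gt0 subr_eq0.
    move=> w /= wz [w1 _]; have := Re_modulus (w - z); rewrite ReB w1 distrC; lra.
  rewrite -ler_norml -ltNge => z2; exists (`|complex.Im z| - s); first by rewrite subr_gt0.
  move=> w /= wz [_]; rewrite -ler_norml => w2.
  have := Im_modulus (w - z); rewrite ImB.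
  have := lerB_dist (complex.Im z) (complex.Im w); rewrite distrC; lra.
- move=> z [z1]; rewrite -ler_norml => z2 e e0.
  have zb : modulus z <= 2 * s.
    by apply: le_trans (modulus_le_ReIm z) _; rewrite z1 gtr0_norm//; lra.
  have [d d0 Hd] := continuous_pt_modulus (Fc z zb) e0.
  by exists d => // w _ wz; apply: Hd; rewrite opprD addrACA subrr add0r.
exists (modulus (F (a + z))).
  by case: z z1 z2 {Hz} => x y /= -> /HN.
by move=> y ys; apply: (Hz (s +i* y)).
Qed.

(* At a point of maximum modulus whose real part is largest, the product of the
   four quarter-turn rotates of [F] has a strict maximum on small squares. *)
Lemma maximum_principle F (rho M : R) : 0 < rho ->
  (forall z, modulus z <= rho -> diff_pt F z) ->
  (forall z, modulus z = rho -> modulus (F z) <= M) ->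
  forall z, modulus z <= rho -> modulus (F z) <= M.
Proof.
move=> r0 HF HM z0 z0r; rewrite leNgt; apply/negP => Mz0.
have M0 : 0 <= M.
  by apply: le_trans (HM rho%:C _); rewrite ?modulus_ge0// ger0_modulus// ltW.
have discc : closed_plane (fun z : C => modulus z <= rho).
  exact: closed_plane_disc0.
have [||||z1 z1r Hz1] := @argmax_plane (fun z => modulus z <= rho) (fun z => modulus (F z)) rho _ _ _ _ => //.
- by exists z0.
- move=> z /HF/diff_pt_continuous/continuous_pt_modulus H e /H [d d0 Hd]; exists d => // w _; exact: Hd.
set N := modulus (F z1) in Hz1.
have MN : M < N by apply: lt_le_trans Mz0 _; exact: Hz1.
(* Among the points where the maximum [N] is attained, [a] lies furthest to the right; strictly to
   the right of [a] the modulus is below [N]. *)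
have [||||a [ar aN] Ha] := @argmax_plane (fun z => modulus z <= rho /\ N <= modulus (F z))
   (fun z => complex.Re z) rho _ _ _ _.
- by exists z1.
- by move=> z [].
- move=> z zK; have [zr|/discc [r rr0 Hr]] := pselect (modulus z <= rho); last first.
    by exists r => // w /Hr ? [].
  have zN : modulus (F z) < N.
    by rewrite ltNge; apply/negP => K; apply: zK.
  have e0 : 0 < N - modulus (F z) by rewrite subr_gt0.
  have [d d0 Hd] := continuous_pt_modulus (diff_pt_continuous (HF z zr)) e0.
  by exists d => // w /Hd + [_]; rewrite ltr_norml; lra.
- by move=> z _ e e0; exists e => // w _ wz; rewrite -ReB; exact: le_lt_trans (Re_modulus _) wz.
have aE : modulus (F a) = N by apply/eqP; rewrite eq_le aN Hz1.
have ar' : modulus a < rho.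
  by rewrite lt_def ar andbT; apply/eqP => H; move: (HM a (esym H)); rewrite aE; lra.
pose s := (rho - modulus a) / 2.
(* Points of the square of half-side [s] have modulus at most [2 * s], which is the distance from
   [a] to the circle. *)
have s0 : 0 < s by rewrite divr_gt0// subr_gt0.
have ins z : modulus z <= 2 * s -> modulus (a + z) <= rho.
  by move=> zs; apply: le_trans (modulusD _ _) _; move: zs; rewrite /s; lra.
have box (x y : R) : `|x| <= s -> `|y| <= s -> modulus (x +i* y) <= 2 * s.
  by move=> ? ?; apply: le_trans (modulus_le_ReIm _) _ => /=; lra.
have ss : `|s| <= s by rewrite gtr0_norm.
have [m mN Hm] : exists2 m, m < N & forall y : R, - s <= y <= s -> modulus (F (a + (s +i* y))) <= m.
  apply: square_edge_lt => // [z zs|y ys]; first by apply/diff_pt_continuous/HF/ins.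
  rewrite ltNge; apply/negP => H.
  have yr : modulus (a + (s +i* y)) <= rho by apply/ins/box => //; rewrite ler_norml.
  have := Ha (a + (s +i* y)) (conj yr H); rewrite ReD /=; lra.
pose G z := F (a + z) * F (a + 'i * z) * (F (a - z) * F (a - 'i * z)).
have N0 : 0 < N by lra.
have := @square_center_le R G s (N ^+ 3 * m) s0.
have G0 : modulus (G 0) = N ^+ 4.
  by rewrite /G !mulr0 !subr0 !addr0 !modulusM aE; ring.
rewrite G0 => /(_ _ _) H; suff : N ^+ 4 <= N ^+ 3 * m.
  by rewrite (exprSr N 3) ler_pM2l ?exprn_gt0// leNgt mN.
have dF (c : C) z : modulus c = 1 -> modulus z <= 2 * s -> diff_pt (fun z => F (a + c * z)) z.
  move=> c1 zs; under eq_fun do rewrite addrC; apply: diff_pt_affine; apply: HF.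
  by rewrite addrC; apply: ins; rewrite modulusM c1 mul1r.
have GE : G = fun z => F (a + 1 * z) * F (a + 'i * z) * (F (a + (-1) * z) * F (a + (- 'i) * z)).
  by apply/funext => z; rewrite /G mul1r mulN1r mulNr.
have m1 := @modulus1 R; have mi := @modulus_i R.
apply: H => [x y hx hy|].
  have zb : modulus (x +i* y) <= 2 * s by apply: box; rewrite ler_norml.
  by rewrite GE; apply: diff_ptM; apply: diff_ptM; apply: dF; rewrite ?modulusN ?m1 ?mi.
have FN z : modulus z <= 2 * s -> modulus (F (a + z)) <= N by move=> /ins; exact: Hz1.
have FNc (c : C) z : modulus c = 1 -> modulus z <= 2 * s -> modulus (F (a + c * z)) <= N.
  by move=> c1 zs; apply: FN; rewrite modulusM c1 mul1r.
have prod4 (p q r t u1 u2 u3 u4 : R) : 0 <= p -> 0 <= q -> 0 <= r -> 0 <= t ->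
   p <= u1 -> q <= u2 -> r <= u3 -> t <= u4 -> p * q * (r * t) <= u1 * u2 * (u3 * u4).
  by move=> p0 q0 rr0 t0 *; rewrite ler_pM ?ler_pM ?mulr_ge0.
have m0 : 0 <= m.
  by apply: le_trans (Hm 0 _); rewrite ?modulus_ge0// oppr_le0 ltW// ltW.
(* Each edge of the square is carried to the right edge by one of [1], ['i], [-1], [- 'i]. The
   corresponding factor of [G] is at most [m], the three others at most [N], against
   [modulus (G 0) = N ^+ 4]. *)
have GN (x y : R) : - s <= x <= s -> - s <= y <= s ->
    (exists (c : C) (v : R), [\/ c = 1, c = 'i, c = -1 | c = - 'i] /\
       (- s <= v <= s /\ c * (x +i* y) = s +i* v)) ->
    modulus (G (x +i* y)) <= N ^+ 3 * m.
  move=> hx hy [c [v [c4 [vs cE]]]].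
  have zb : modulus (x +i* y) <= 2 * s by apply: box; rewrite ler_norml.
  have sm : modulus (F (a + c * (x +i* y))) <= m by rewrite cE; exact: Hm.
  rewrite GE !modulusM.
  have b1 := FNc 1 _ m1 zb; have b2 := FNc 'i _ mi zb.
  have b3 := FNc (-1) _ (etrans (modulusN _) m1) zb.
  have b4 := FNc (- 'i) _ (etrans (modulusN _) mi) zb.
  case: c4 sm => -> sm.
  - by apply: le_trans (prod4 _ _ _ _ m N N N _ _ _ _ _ _ _ _) _; rewrite ?modulus_ge0//; rewrite le_eqVlt; apply/orP; left; apply/eqP; ring.
  - by apply: le_trans (prod4 _ _ _ _ N m N N _ _ _ _ _ _ _ _) _; rewrite ?modulus_ge0//; rewrite le_eqVlt; apply/orP; left; apply/eqP; ring.
  - by apply: le_trans (prod4 _ _ _ _ N N m N _ _ _ _ _ _ _ _) _; rewrite ?modulus_ge0//; rewrite le_eqVlt; apply/orP; left; apply/eqP; ring.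
  - by apply: le_trans (prod4 _ _ _ _ N N N m _ _ _ _ _ _ _ _) _; rewrite ?modulus_ge0//; rewrite le_eqVlt; apply/orP; left; apply/eqP; ring.
have [sl sr] : - s <= - s <= s /\ - s <= s <= s by rewrite !lexx; split; lra.
have opp (t : R) : - s <= t <= s -> - s <= - t <= s by rewrite -!ler_norml normrN.
split=> t tt; split; apply: GN => //.
- exists 'i, t; split; first by constructor 2.
  by split => //; apply: complex_eqP => /=; ring.
- exists (- 'i), (- t); split; first by constructor 4.
  by split; [exact: opp|apply: complex_eqP => /=; ring].
- exists (-1), (- t); split; first by constructor 3.
  by split; [exact: opp|apply: complex_eqP => /=; ring].
- exists 1, t; split; first by constructor 1.
  by split => //; rewrite mul1r.
Qed.

End MaximumPrinciple.

(** * Holomorphic functions on the disc *)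

Section Holomorphic.
Context {R : realType}.
Local Notation C := (R[i]).
Implicit Types (F G p : C -> C).

(** A bounded function times [(z - e) ^+ 2] is differentiable at [e] with derivative 0, which
    disposes of one exceptional point. Doing this for [F z ^+ n] lets the extra factor disappear as
    [n] grows. *)
Lemma mp_exceptional (E : seq C) F (rho M B : R) : 0 < rho ->
  (forall e, e \in E -> modulus e < rho) ->
  (forall z, modulus z <= rho -> z \notin E -> diff_pt F z) ->
  (forall z, modulus z <= rho -> modulus (F z) <= B) ->
  (forall z, modulus z = rho -> modulus (F z) <= M) ->
  forall z, modulus z <= rho -> z \notin E -> modulus (F z) <= M.
Proof.
move=> r0; elim: E F M B => [|e E IH] F M B HE HF HB HM z zr zE.
  by apply: (maximum_principle r0 _ HM) => // w wr; exact: HF.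
have M0 : 0 <= M.
  by apply: le_trans (HM rho%:C _); rewrite ?modulus_ge0// ger0_modulus// ltW.
have B0 : 0 <= B by apply: le_trans (HB z zr); exact: modulus_ge0.
have er : modulus e < rho by apply: HE; rewrite inE eqxx.
move: zE; rewrite inE negb_or => /andP[ze zE].
apply: (@le_of_pow_le _ _ _ (modulus (z - e) ^+ 2) ((2 * rho) ^+ 2)) => //.
  by rewrite exprn_gt0// modulus_gt0 subr_eq0.
move=> n; rewrite -!modulusX -modulusM.
apply: (IH (fun z => F z ^+ n * (z - e) ^+ 2) _ (B ^+ n * (2 * rho) ^+ 2)) => //.
- by move=> w wE; apply: HE; rewrite inE wE orbT.
- move=> w wr wE; have [->|we] := eqVneq w e; last first.
    apply: diff_ptM; first by apply/diff_ptX/HF => //; rewrite inE negb_or we.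
    by apply/diff_ptX/diff_ptB; [exact: diff_pt_id|exact: diff_pt_cst].
  exists 0 => eps eps0.
  have B1 : 0 < B ^+ n + 1 by rewrite ltr_wpDl// exprn_ge0.
  exists (Num.min (rho - modulus e) (eps / (B ^+ n + 1))).
    by rewrite lt_min subr_gt0 er divr_gt0.
  move=> v; rewrite lt_min => /andP[v1 v2].
  rewrite subrr expr0n mulr0 subr0 mul0r subr0 modulusM !modulusX.
  have vr : modulus v <= rho.
    by have := modulusD (v - e) e; rewrite subrK => /le_trans; apply; lra.
  have Fv : modulus (F v) ^+ n <= B ^+ n.
    by apply: lerXn2r; rewrite ?nnegrE ?modulus_ge0// HB.
  rewrite expr2 mulrA ler_wpM2r ?modulus_ge0//.
  rewrite ltr_pdivlMr// in v2; apply: le_trans (ltW v2).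
  by rewrite mulrC ler_wpM2l ?modulus_ge0//; lra.
- move=> w wr; rewrite modulusM !modulusX.
  have we : modulus (w - e) <= 2 * rho by apply: le_trans (modulusB _ _) _; lra.
  by rewrite ler_pM ?exprn_ge0 ?modulus_ge0//; apply: lerXn2r; rewrite ?nnegrE ?modulus_ge0// ?HB// mulr_ge0// ltW.
- move=> w wr; rewrite modulusM !modulusX.
  have we : modulus (w - e) <= 2 * rho by apply: le_trans (modulusB _ _) _; lra.
  by rewrite ler_pM ?exprn_ge0 ?modulus_ge0//; apply: lerXn2r; rewrite ?nnegrE ?modulus_ge0// ?HM// mulr_ge0// ltW.
Qed.

Lemma diff_quotient_bound F b : diff_pt F b -> exists s K : R, [/\ 0 < s, 0 <= K &
  forall z, modulus (z - b) < s -> modulus (F z - F b) <= K * modulus (z - b)].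
Proof.
move=> [d Hd]; have [s s0 Hs] := Hd 1 ltr01.
exists s, (1 + modulus d); split => // [|z /Hs H].
  by have := modulus_ge0 d; lra.
rewrite (_ : F z - F b = (F z - F b - d * (z - b)) + d * (z - b)); last by ring.
by apply: le_trans (modulusD _ _) _; rewrite modulusM mulrDl lerD2r.
Qed.

Lemma bounded_lipschitz p a (rho r B : R) : r < rho -> modulus a < rho ->
  (forall z, modulus z <= rho -> z != a -> diff_pt p z) ->
  (forall z, modulus z <= rho -> modulus (p z) <= B) ->
  forall z b, modulus z <= rho -> modulus b <= r -> z != a -> b != a ->
    modulus (p z - p b) <= 2 * B / (rho - r) * modulus (z - b).
Proof.
move=> rr ar Hp HB z b zr br za ba.
have [->|zb] := eqVneq z b; first by rewrite !subrr modulus0 mulr0.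
have rho0 : 0 < rho by apply: le_lt_trans ar; exact: modulus_ge0.
have bn : modulus b < rho by apply: le_lt_trans rr.
have B0 : 0 <= B by apply: le_trans (HB z zr); exact: modulus_ge0.
have [s [K [s0 K0 HK]]] := diff_quotient_bound (Hp b (ltW bn) ba).
have pB w v : modulus w <= rho -> modulus v <= rho -> modulus (p w - p v) <= 2 * B.
  move=> /HB ? /HB ?; apply: le_trans (modulusB _ _) _; lra.
have mzb : 0 < modulus (z - b) by rewrite modulus_gt0 subr_eq0.
rewrite -ler_pdivrMr// -modulusV -modulusM.
apply: (@mp_exceptional [:: a; b] (fun z => (p z - p b) * (z - b)^-1) rho _ (K + 2 * B / s)) => //.
- by move=> e; rewrite !inE => /orP[] /eqP ->.
- move=> w wr; rewrite !inE negb_or => /andP[wa wb].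
  apply: diff_ptM; first by apply: diff_ptB; [exact: Hp|exact: diff_pt_cst].
  apply: diff_ptV; first by rewrite subr_eq0.
  by apply: diff_ptB; [exact: diff_pt_id|exact: diff_pt_cst].
(* The quotient takes the value 0 at [b], the inverse of 0 being 0; elsewhere it is bounded by [K]
   near [b] and by [2 * B / s] away from it. *)
- move=> w wr; have [->|wb] := eqVneq w b.
    by rewrite !subrr mul0r modulus0 addr_ge0// divr_ge0 ?mulr_ge0// ltW.
  have mwb : 0 < modulus (w - b) by rewrite modulus_gt0 subr_eq0.
  rewrite modulusM modulusV ler_pdivrMr//.
  have sB : 0 <= 2 * B / s by rewrite divr_ge0 ?mulr_ge0// ltW.
  have [ws|sw] := ltP (modulus (w - b)) s.
    by apply: le_trans (HK _ ws) _; rewrite ler_wpM2r ?modulus_ge0// lerDl.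
  apply: le_trans (pB w b wr (ltW bn)) _.
  apply: (@le_trans _ _ (2 * B / s * modulus (w - b))).
    by rewrite mulrAC ler_pdivlMr// ler_wpM2l// mulr_ge0.
  by rewrite ler_wpM2r ?modulus_ge0// lerDr.
- move=> w wr; have wb : rho - r <= modulus (w - b).
    by have := modulus_lb w b; lra.
  have mwb : 0 < modulus (w - b) by lra.
  rewrite modulusM modulusV; apply: ler_pM; rewrite ?modulus_ge0 ?invr_ge0 ?modulus_ge0//.
    by apply: pB; rewrite ?wr// ltW.
  by rewrite lef_pV2// posrE; lra.
- by rewrite !inE negb_or za zb.
Qed.

Lemma cauchy_seqC (u : nat -> C) :
  (forall e : R, 0 < e -> exists N, forall m n, (N <= m)%N -> (N <= n)%N ->
     modulus (u m - u n) < e) ->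
  exists l, forall e : R, 0 < e -> exists N, forall n, (N <= n)%N -> modulus (u n - l) < e.
Proof.
move=> H.
have real (v : nat -> R) :
  (forall e : R, 0 < e -> exists N, forall m n, (N <= m)%N -> (N <= n)%N -> `|v m - v n| < e) ->
  exists l, forall e : R, 0 < e -> exists N, forall n, (N <= n)%N -> `|v n - l| < e.
  move=> Hv; have /cvg_ex[l Hl] : cvg (v @ \oo).
    apply: cauchy_cvg; apply: cauchy_exP => e e0; have [N HN] := Hv e e0.
    by exists (v N); exists N => // n /= Nn; exact: HN.
  exists l => e e0; move/cvgrPdist_lt : Hl => /(_ e e0) [N _ HN].
  by exists N => n /HN; rewrite distrC.
have [x Hx] : exists l, forall e : R, 0 < e -> exists N, forall n, (N <= n)%N ->
    `|complex.Re (u n) - l| < e.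
  apply: real => e /H [N HN]; exists N => m n mN nN.
  by rewrite -ReB; apply: le_lt_trans (Re_modulus _) _; exact: HN.
have [y Hy] : exists l, forall e : R, 0 < e -> exists N, forall n, (N <= n)%N ->
    `|complex.Im (u n) - l| < e.
  apply: real => e /H [N HN]; exists N => m n mN nN.
  by rewrite -ImB; apply: le_lt_trans (Im_modulus _) _; exact: HN.
exists (x +i* y) => e e0; have e2 : 0 < e / 2 by rewrite divr_gt0.
have [N1 H1] := Hx _ e2; have [N2 H2] := Hy _ e2.
exists (maxn N1 N2) => n; rewrite geq_max => /andP[/H1 + /H2].
by have := modulus_le_ReIm (u n - (x +i* y)); rewrite ReB ImB /=; lra.
Qed.

Lemma invS_small (K e : R) : 0 < e -> exists N, forall n, (N <= n)%N -> K / n.+1%:R < e.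
Proof.
move=> e0; exists (Num.bound (`|K| / e)) => n Nn.
have H : `|K| / e < n.+1%:R.
  by apply: lt_le_trans (archi_boundP _) _; [rewrite divr_ge0// ltW|rewrite ler_nat ltnW].
rewrite ltr_pdivrMr// in H; rewrite ltr_pdivrMr ?ltr0n// mulrC.
exact: le_lt_trans (ler_norm _) H.
Qed.

(** Being Lipschitz off [a], [p] converges along the sequence [v] tending to [a], and the Lipschitz
    estimate persists in the limit. *)
Lemma bounded_limit p a (rho B : R) : modulus a < rho ->
  (forall z, modulus z <= rho -> z != a -> diff_pt p z) ->
  (forall z, modulus z <= rho -> modulus (p z) <= B) ->
  exists (L : C) (K : R), 0 <= K /\ forall z, modulus z <= rho -> z != a ->
    modulus (p z - L) <= K * modulus (z - a).
Proof.
move=> ar Hp HB; pose r := (rho + modulus a) / 2.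
have rr : r < rho by rewrite /r; lra.
have B0 : 0 <= B by apply: le_trans (HB a (ltW ar)); exact: modulus_ge0.
have lip := bounded_lipschitz rr ar Hp HB.
set K := 2 * B / (rho - r) in lip.
have K0 : 0 <= K by rewrite divr_ge0 ?mulr_ge0// subr_ge0 ltW.
pose s := r - modulus a; have s0 : 0 < s by rewrite /s /r; lra.
pose v n : C := a + (s / n.+1%:R)%:C.
have sn n : 0 < s / n.+1%:R by rewrite divr_gt0.
have vE n : modulus (v n - a) = s / n.+1%:R.
  by rewrite /v [a + _]addrC addrK ger0_modulus// ltW.
have va n : v n != a by rewrite -subr_eq0 -modulus_gt0 vE.
have vr n : modulus (v n) <= r.
  have := modulusD (v n - a) a; rewrite subrK vE => /le_trans; apply.
  by rewrite -lerBrDr -/s ler_pdivrMr// ler_peMr ?ler1n// ltW.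
have vrho n : modulus (v n) <= rho by apply: le_trans (vr n) (ltW rr).
have [|L HL] := @cauchy_seqC (p \o v).
  move=> e e0; have e2 : 0 < e / 2 by rewrite divr_gt0.
  have [N HN] := @invS_small (K * s) _ e2; exists N => m n /HN m1 /HN n1 /=.
  apply: le_lt_trans (lip _ _ (vrho m) (vr n) (va m) (va n)) _.
  apply: le_lt_trans (_ : _ <= K * (s / m.+1%:R + s / n.+1%:R)) _; last first.
    by rewrite mulrDr !mulrA (splitr e) ltrD.
  apply: ler_wpM2l => //; rewrite -!vE.
  by rewrite [modulus (v n - a)]modulusC; exact: modulus_triangle.
exists L, K; split => // z zr za.
apply/ler_addgt0Pl => e e0; have e2 : 0 < e / 2 by rewrite divr_gt0.
have [N1 H1] := HL _ e2; have [N2 H2] := @invS_small (K * s) _ e2.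
set n := maxn N1 N2; have := H1 n (leq_maxl _ _); have := H2 n (leq_maxr _ _).
rewrite /= => h2 h1.
apply: le_trans (modulus_triangle (p (v n)) _ _) _.
have := lip _ _ zr (vr n) za (va n).
have := modulus_triangle a z (v n); rewrite [modulus (a - _)]modulusC vE.
have : K * (s / n.+1%:R) < e / 2 by rewrite mulrA.
move: K0 h1; move: (modulus (p z - p (v n))) (modulus (z - v n)) (modulus (z - a)) => x1 x2 x3.
move: (modulus (p (v n) - L)) (s / n.+1%:R) => x4 x5; clear; move=> *; nra.
Qed.

(** * Holomorphy on the unit disc and removable singularities *)

Definition hol F := forall z, modulus z < 1 -> diff_pt F z.

Lemma hol_cst (c : C) : hol (fun=> c).
Proof. by move=> z _; exact: diff_pt_cst. Qed.

Lemma hol_id : hol (fun z => z).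
Proof. by move=> z _; exact: diff_pt_id. Qed.

Lemma holD F G : hol F -> hol G -> hol (fun z => F z + G z).
Proof. by move=> HF HG z z1; apply: diff_ptD; [exact: HF|exact: HG]. Qed.

Lemma holB F G : hol F -> hol G -> hol (fun z => F z - G z).
Proof. by move=> HF HG z z1; apply: diff_ptB; [exact: HF|exact: HG]. Qed.

Lemma holM F G : hol F -> hol G -> hol (fun z => F z * G z).
Proof. by move=> HF HG z z1; apply: diff_ptM; [exact: HF|exact: HG]. Qed.

Lemma hol_near F G : (forall z, modulus z < 1 -> F z = G z) -> hol F -> hol G.
Proof.
move=> FG HF z z1; have r0 : 0 < 1 - modulus z by rewrite subr_gt0.
apply: (diff_pt_near r0 _ (HF z z1)) => w wz; apply: FG.
by have := modulusD (w - z) z; rewrite subrK; lra.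
Qed.

Lemma hol_continuous F z : hol F -> modulus z < 1 -> continuous_pt F z.
Proof. by move=> HF z1; exact/diff_pt_continuous/HF. Qed.

Lemma hol_bounded F (rho : R) : hol F -> rho < 1 -> exists2 M : R, 0 <= M &
  forall z, modulus z <= rho -> modulus (F z) <= M.
Proof.
move=> HF r1; apply: (@bounded_plane _ _ _ rho) => //; first exact: closed_plane_disc0.
by move=> z zr; apply: hol_continuous => //; exact: le_lt_trans zr r1.
Qed.

Lemma hol_mp F (rho M : R) : hol F -> 0 < rho < 1 ->
  (forall z, modulus z = rho -> modulus (F z) <= M) ->
  forall z, modulus z <= rho -> modulus (F z) <= M.
Proof.
move=> HF /andP[r0 r1] HM; apply: maximum_principle => // z zr.
by apply: HF; exact: le_lt_trans zr r1.
Qed.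

(** [bounded_limit] is used twice. It gives a value [L] with [p z - L] of order [z - a], so the
    quotient [p2] is bounded, and its own limit [L2] is the derivative at [a]. *)
Lemma removable p a (r B : R) : modulus a < 1 -> 0 < r ->
  (forall z, modulus z < 1 -> z != a -> diff_pt p z) ->
  (forall z, z != a -> modulus (z - a) < r -> modulus (p z) <= B) ->
  exists L, hol (fun z => if z == a then L else p z).
Proof.
move=> a1 r0 Hp HB; pose rho := (1 + modulus a) / 2.
have [ar r1] : modulus a < rho /\ rho < 1 by rewrite /rho; split; lra.
have [M M0 HM] : exists2 M : R, 0 <= M & forall z, modulus z <= rho /\ r <= modulus (z - a) ->
    modulus (p z) <= M.
  apply: (@bounded_plane _ _ _ rho) => [z []//||z [zr rz]].
    by apply: closed_planeI; [exact: closed_plane_disc0|exact: closed_plane_codisc].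
  apply/diff_pt_continuous/Hp; first exact: le_lt_trans zr r1.
  by rewrite -subr_eq0 -modulus_gt0 (lt_le_trans r0).
(* The bound must hold at [a] too, where nothing is known of [p]. *)
pose p0 z := if z == a then 0 else p z.
have diff_off q : (forall z, z != a -> q z = p z) ->
    forall z, modulus z < 1 -> z != a -> diff_pt q z.
  move=> qp z z1 za.
  have m0 : 0 < modulus (z - a) by rewrite modulus_gt0 subr_eq0.
  apply: (diff_pt_near m0 _ (Hp z z1 za)) => w wz; rewrite qp//.
  by apply/eqP => wa; rewrite wa modulusC ltxx in wz.
have dp0 z : modulus z <= rho -> z != a -> diff_pt p0 z.
  move=> zr za; apply: diff_off => // [w /negbTE wa|]; first by rewrite /p0 wa.
  exact: le_lt_trans zr r1.
have bp0 z : modulus z <= rho -> modulus (p0 z) <= Num.max M B.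
  move=> zr; rewrite /p0; have [_|za] := eqVneq z a; first by rewrite modulus0 le_max M0.
  rewrite le_max; have [zz|zz] := ltP (modulus (z - a)) r; first by rewrite HB// orbT.
  by rewrite HM.
have [L [K [K0 HL]]] := bounded_limit ar dp0 bp0.
exists L => z z1; have [->|za] := eqVneq z a; last first.
  by apply: diff_off => // w /negbTE ->.
pose p2 z := if z == a then 0 else (p0 z - L) * (z - a)^-1.
have dp2 z' : modulus z' <= rho -> z' != a -> diff_pt p2 z'.
  move=> zr za; have m0 : 0 < modulus (z' - a) by rewrite modulus_gt0 subr_eq0.
  apply: (diff_pt_near (F := fun z => (p0 z - L) * (z - a)^-1) m0) => [w wz|].
    by rewrite /p2; case: eqP => // wa; rewrite wa modulusC ltxx in wz.
  apply: diff_ptM; first by apply: diff_ptB; [exact: dp0|exact: diff_pt_cst].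
  apply: diff_ptV; first by rewrite subr_eq0.
  by apply: diff_ptB; [exact: diff_pt_id|exact: diff_pt_cst].
have bp2 z' : modulus z' <= rho -> modulus (p2 z') <= K.
  rewrite /p2; have [_ _|za zr] := eqVneq z' a; first by rewrite modulus0.
  rewrite modulusM modulusV ler_pdivrMr ?modulus_gt0 ?subr_eq0//; exact: HL.
have [L2 [K2 [K20 HL2]]] := bounded_limit ar dp2 bp2.
exists L2 => e e0; have K21 : 0 < K2 + 1 by lra.
exists (Num.min (rho - modulus a) (e / (K2 + 1))).
  by rewrite lt_min subr_gt0 ar divr_gt0.
move=> w; rewrite lt_min eqxx => /andP[w1 w2].
have [->|wa] := eqVneq w a; first by rewrite !subrr mulr0 subr0 modulus0 mulr0.
have wr : modulus w <= rho by have := modulusD (w - a) a; rewrite subrK; lra.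
have wa0 : w - a != 0 by rewrite subr_eq0.
have := HL2 w wr wa; rewrite /p2 /p0 (negbTE wa) => H.
rewrite (_ : p w - L - L2 * (w - a) = ((p w - L) / (w - a) - L2) * (w - a)); last by field.
rewrite modulusM ler_wpM2r ?modulus_ge0//; apply: le_trans H _.
rewrite ltr_pdivlMr// in w2; have := modulus_ge0 (w - a); nra.
Qed.

End Holomorphic.

(** * Difference quotients, Cauchy estimates and the identity theorem *)

Section Cauchy.
Context {R : realType}.
Local Notation C := (R[i]).
Implicit Types (F G p : C -> C).

Lemma eq_leC (x y : R) : x = y -> x <= y.
Proof. by move=> ->. Qed.

(* Sealed, as [ring] would otherwise try to unfold the limit. *)
Fact cder_spec : {d : (C -> C) -> C -> C | forall F z, d F z = derive1 (F : C^o -> C^o) z}.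
Proof. by exists (fun F z => derive1 (F : C^o -> C^o) z). Qed.

Definition cder : (C -> C) -> C -> C := projT1 cder_spec.

Lemma cderE F z d : has_deriv F z d -> cder F z = d.
Proof. by move=> Hd; rewrite /cder (projT2 cder_spec) (has_deriv_derive1 Hd). Qed.

Lemma cderP F z : diff_pt F z -> has_deriv F z (cder F z).
Proof. by move=> [d Hd]; rewrite (cderE Hd). Qed.

Definition dq F a z := if z == a then cder F a else (F z - F a) / (z - a).

Lemma dqE F a z : F z = F a + (z - a) * dq F a z.
Proof.
rewrite /dq; have [->|za] := eqVneq z a; first by rewrite subrr mul0r addr0.
by have : z - a != 0 by [rewrite subr_eq0]; move=> ?; field.
Qed.

(** The quotient is bounded near [a] and extends holomorphically by some [L]; continuity of the
    extension identifies [L] with the derivative. *)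
Lemma hol_dq F a : hol F -> modulus a < 1 -> hol (dq F a).
Proof.
move=> HF a1; pose p z := (F z - F a) * (z - a)^-1.
have [s [K [s0 K0 HK]]] := diff_quotient_bound (HF a a1).
have dp z : modulus z < 1 -> z != a -> diff_pt p z.
  move=> z1 za; apply: diff_ptM; first by apply: diff_ptB; [exact: HF|exact: diff_pt_cst].
  apply: diff_ptV; first by rewrite subr_eq0.
  by apply: diff_ptB; [exact: diff_pt_id|exact: diff_pt_cst].
have bp z : z != a -> modulus (z - a) < s -> modulus (p z) <= K.
  by move=> za zs; rewrite modulusM modulusV ler_pdivrMr ?modulus_gt0 ?subr_eq0// HK.
have [L HL] := removable a1 s0 dp bp.
suff -> : dq F a = fun z => if z == a then L else p z by [].
suff LE : cder F a = L by apply/funext => z; rewrite /dq LE.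
apply: cderE => e e0; have [d d0 Hd] := hol_continuous HL a1 e0.
exists d => // w /Hd; rewrite eqxx; have [->|wa] := eqVneq w a.
  by rewrite !subrr mulr0 subr0 modulus0 mulr0.
move=> /ltW H; have wa0 : w - a != 0 by rewrite subr_eq0.
rewrite (_ : F w - F a - L * (w - a) = (p w - L) * (w - a)).
  by rewrite modulusM ler_wpM2r ?modulus_ge0.
by rewrite /p; field.
Qed.

Lemma dq_circle_le F (rho r M : R) b z : r < rho ->
  (forall z, modulus z <= rho -> modulus (F z) <= M) ->
  modulus b <= r -> modulus z = rho -> modulus (dq F b z) <= 2 * M / (rho - r).
Proof.
move=> rr HM br zr; have zb : rho - r <= modulus (z - b) by have := modulus_lb z b; lra.
have zb0 : 0 < modulus (z - b) by lra.
have zb1 : z != b by rewrite -subr_eq0 -modulus_gt0.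
rewrite /dq (negbTE zb1) modulusM modulusV; apply: ler_pM; rewrite ?modulus_ge0 ?invr_ge0 ?modulus_ge0//.
  have := HM z; have := HM b; rewrite zr => /(_ _) H1 /(_ (lexx _)) H2.
  by apply: le_trans (modulusB _ _) _; have := H1 ltac:(lra); lra.
by rewrite lef_pV2// posrE; lra.
Qed.

(** No integral formula: the maximum principle bounds the difference quotient by its values on the
    circle, and at [b] it equals the derivative. The quotient of the quotient controls the Taylor
    remainder likewise. Each costs a factor [2 / (rho - r)], the circle being centred at 0 and not
    at [b]. *)
Lemma cauchy_estimates F (rho r M : R) : hol F -> 0 < rho < 1 -> r < rho ->
  (forall z, modulus z = rho -> modulus (F z) <= M) ->
  forall b, modulus b <= r -> modulus (cder F b) <= 2 * M / (rho - r) /\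
  forall z, modulus z <= rho ->
    modulus (F z - F b - cder F b * (z - b)) <=
    2 * (2 * M / (rho - r)) / (rho - r) * modulus (z - b) ^+ 2.
Proof.
move=> HF r01 rr HM b br; have /andP[r0 r1] := r01.
have b1 : modulus b < 1 by lra.
have HM' := hol_mp HF r01 HM.
have H1 := hol_dq HF b1; have H2 := hol_dq H1 b1.
have B1 := hol_mp H1 r01 (fun z zr => dq_circle_le rr HM' br zr).
have B2 := hol_mp H2 r01 (fun z zr => dq_circle_le rr B1 br zr).
split; first by have := B1 b ltac:(lra); rewrite /dq eqxx.
move=> z zr; rewrite (dqE F b z) (dqE (dq F b) b z) {1}/dq eqxx.
rewrite (_ : _ - F b - _ = (z - b) ^+ 2 * dq (dq F b) b z); last by ring.
by rewrite modulusM modulusX mulrC ler_wpM2r ?exprn_ge0 ?modulus_ge0// B2.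
Qed.

Lemma quadratic_bound F (r : R) : hol F -> r < 1 -> exists (rho K : R),
  [/\ r < rho, 0 <= K & forall b z, modulus b <= r -> modulus z <= rho ->
    modulus (F z - F b - cder F b * (z - b)) <= K * modulus (z - b) ^+ 2].
Proof.
(* [r] may be negative, whereas the estimates take place on a circle of positive radius. *)
move=> HF r1; pose r' := Num.max r 0; pose rho := (1 + r') / 2.
have [rr' r'0 r'1] : [/\ r <= r', 0 <= r' & r' < 1].
  by split; rewrite /r' ?le_max ?gt_max ?lexx ?orbT ?r1 ?ltr01.
have [rrho rho0 rho1] : [/\ r' < rho, 0 < rho & rho < 1] by rewrite /rho; split; lra.
have [M M0 HM] := hol_bounded HF rho1.
exists rho, (2 * (2 * M / (rho - r')) / (rho - r')); split.
- exact: le_lt_trans rrho.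
- have D0 : 0 <= rho - r' by rewrite subr_ge0 ltW.
  have h : 0 <= 2 * M / (rho - r') by rewrite divr_ge0// mulr_ge0.
  by rewrite divr_ge0// mulr_ge0.
- move=> b z br zr; have [] := @cauchy_estimates F rho r' M HF _ rrho _ b.
  + by rewrite rho0.
  + by move=> w wr; apply: HM; rewrite wr.
  + exact: le_trans br rr'.
  + by move=> _; apply.
Qed.

(** In the sum of the expansions at [a] and at [b] the values of [F] cancel, leaving the difference
    of the derivatives times [b - a]. *)
Lemma cder_lipschitz F (r : R) : hol F -> r < 1 -> exists2 K : R, 0 <= K &
  forall a b, modulus a <= r -> modulus b <= r ->
    modulus (cder F b - cder F a) <= K * modulus (b - a).
Proof.
move=> HF r1; have [rho [K [rr K0 HK]]] := quadratic_bound HF r1.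
exists (2 * K) => [|a b ar br]; first by rewrite mulr_ge0.
have [->|ab] := eqVneq b a; first by rewrite !subrr modulus0 mulr0.
have m0 : 0 < modulus (b - a) by rewrite modulus_gt0 subr_eq0.
rewrite -(ler_pM2r m0) -modulusM.
have := HK a b ar ltac:(lra); have := HK b a br ltac:(lra).
rewrite [modulus (a - b)]modulusC => h1 h2.
have -> : (cder F b - cder F a) * (b - a) =
  (F b - F a - cder F a * (b - a)) + (F a - F b - cder F b * (a - b)) by ring.
have -> : 2 * K * modulus (b - a) * modulus (b - a) =
  K * modulus (b - a) ^+ 2 + K * modulus (b - a) ^+ 2 by ring.
by apply: le_trans (modulusD _ _) _; exact: (lerD h2 h1).
Qed.

Lemma cder_continuous F a : hol F -> modulus a < 1 -> continuous_pt (cder F) a.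
Proof.
move=> HF a1 e e0; pose r := (1 + modulus a) / 2.
have [ar r1] : modulus a < r /\ r < 1 by rewrite /r; split; lra.
have [K K0 HK] := cder_lipschitz HF r1; have K1 : 0 < K + 1 by lra.
exists (Num.min (r - modulus a) (e / (K + 1))); first by rewrite lt_min subr_gt0 ar divr_gt0.
move=> w; rewrite lt_min => /andP[w1]; rewrite ltr_pdivlMr// => w2.
have wr : modulus w <= r by have := modulusD (w - a) a; rewrite subrK; lra.
by apply: le_lt_trans (HK a w (ltW ar) wr) _; have := modulus_ge0 (w - a); nra.
Qed.

(** With [q] the quotient at [a], the derivative of [F] is [q z + (z - a) * cder q z]. Continuity of
    [cder q] is enough to differentiate this at [a], with result twice [cder q a]. *)
Lemma hol_cder F : hol F -> hol (cder F).
Proof.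
move=> HF a a1; have Hq := hol_dq HF a1; set q := dq F a in Hq.
have cE z : modulus z < 1 -> cder F z = q z + (z - a) * cder q z.
  move=> z1; apply: cderE.
  have h1 := has_derivB (has_deriv_id z) (has_deriv_cst a z).
  have h2 := has_derivD (has_deriv_cst (F a) z) (has_derivM h1 (cderP (Hq z z1))).
  have E : 0 + ((z - a) * cder q z + (1 - 0) * q z) = q z + (z - a) * cder q z by ring.
  rewrite E in h2; apply: (has_deriv_near ltr01 _ h2) => w _.
  by rewrite [RHS](dqE F a w).
exists (cder q a + cder q a) => e e0; have e2 : 0 < e / 2 by rewrite divr_gt0.
have [d1 d10 H1] := cderP (Hq a a1) e2.
have [d2 d20 H2] := cder_continuous Hq a1 e2.
exists (Num.min (1 - modulus a) (Num.min d1 d2)); first by rewrite !lt_min subr_gt0 a1 d10.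
move=> w; rewrite !lt_min => /andP[w0 /andP[/H1 w1 /H2 w2]].
have wl : modulus w < 1 by have := modulusD (w - a) a; rewrite subrK; lra.
rewrite !cE// subrr mul0r addr0.
rewrite (_ : _ - q a - _ = (q w - q a - cder q a * (w - a)) + (w - a) * (cder q w - cder q a)); last by ring.
apply: le_trans (modulusD _ _) _; rewrite modulusM (splitr e) mulrDl lerD//.
by rewrite mulrC ler_wpM2r ?modulus_ge0// ltW.
Qed.

Lemma cderB F G z : hol F -> hol G -> modulus z < 1 ->
  cder (fun w => F w - G w) z = cder F z - cder G z.
Proof. by move=> HF HG z1; apply/cderE/has_derivB; apply: cderP; [exact: HF|exact: HG]. Qed.

(** Cauchy estimates for [f m - f n] make the derivatives at [b] a Cauchy sequence. The quadratic
    Taylor bounds, with a constant independent of [n], pass to the limit and show that its limit is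
    the derivative of [F]. *)
Lemma weierstrass (f : nat -> C -> C) F : (forall n, hol (f n)) ->
  (forall rho : R, rho < 1 -> forall e : R, 0 < e -> exists N, forall n, (N <= n)%N ->
     forall z, modulus z <= rho -> modulus (f n z - F z) <= e) ->
  hol F.
Proof.
move=> Hf Hu b b1; pose rho := (1 + modulus b) / 2.
have b0 := modulus_ge0 b.
have [br r0 r1] : [/\ modulus b < rho, 0 < rho & rho < 1] by rewrite /rho; split; lra.
have r01 : 0 < rho < 1 by rewrite r0.
have D0 : 0 < rho - modulus b by rewrite subr_gt0.
have fB m n (e : R) : (forall z, modulus z <= rho -> modulus (f m z - F z) <= e) ->
  (forall z, modulus z <= rho -> modulus (f n z - F z) <= e) ->
  forall z, modulus z <= rho -> modulus (f m z - f n z) <= 2 * e.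
  move=> h1 h2 z zr; apply: le_trans (modulus_triangle (F z) _ _) _.
  by have := h1 z zr; have := h2 z zr; rewrite [modulus (f n z - _)]modulusC; lra.
have [|d Hd] := @cauchy_seqC R (fun n => cder (f n) b).
  move=> e e0.
  (* The differences are at most twice this on the circle, so those of the derivatives are at most
     [4 * e / 5]. *)
  have e4 : 0 < e * (rho - modulus b) / 5 by rewrite divr_gt0// mulr_gt0.
  have [N HN] := Hu rho r1 _ e4; exists N => m n /HN Hm /HN Hn.
  rewrite -cderB//.
  have [+ _] := cauchy_estimates (holB (Hf m) (Hf n)) r01 br
    (fun z (zr : modulus z = rho) => fB _ _ _ Hm Hn z (eq_leC zr)) (lexx _).
  move=> /le_lt_trans; apply.
  by rewrite ltr_pdivrMr// mulrA; have : 0 < e * (rho - modulus b) by [rewrite mulr_gt0]; lra.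
have [N1 HN1] := Hu rho r1 1 ltr01.
have [M M0 HM] := hol_bounded (Hf N1) r1.
have fM n : (N1 <= n)%N -> forall z, modulus z = rho -> modulus (f n z) <= M + 2.
  move=> /HN1 Hn z zr; have := fB n N1 1 Hn (HN1 N1 (leqnn _)) z (eq_leC zr).
  have := HM z (eq_leC zr); have := modulusD (f n z - f N1 z) (f N1 z).
  by rewrite subrK; lra.
pose K := 2 * (2 * (M + 2) / (rho - modulus b)) / (rho - modulus b).
have K0 : 0 <= K by rewrite !(divr_ge0, mulr_ge0)//; lra.
have key z : modulus z <= rho -> modulus (F z - F b - d * (z - b)) <= K * modulus (z - b) ^+ 2.
  (* The tolerance [e / 4] is spent once at [z], once at [b] and twice on the slope, since
     [modulus (z - b) <= 2]. *)
  move=> zr; apply/ler_addgt0Pl => e e0; have e4 : 0 < e / 4 by rewrite divr_gt0.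
  have [N2 HN2] := Hu rho r1 _ e4; have [N3 HN3] := Hd _ e4.
  pose n := maxn N1 (maxn N2 N3).
  have n1 : (N1 <= n)%N by rewrite leq_maxl.
  have n2 : (N2 <= n)%N by rewrite /n !leq_max leqnn orbT.
  have n3 : (N3 <= n)%N by rewrite /n !leq_max leqnn !orbT.
  have [_ /(_ z zr)] := cauchy_estimates (Hf n) r01 br (fM n n1) (lexx _).
  rewrite -/K => h1; have h2 := HN2 n n2 z zr; have h3 := HN2 n n2 b (ltW br).
  have h4 := HN3 n n3.
  have zb : modulus (z - b) <= 2 by apply: le_trans (modulusB _ _) _; lra.
  rewrite (_ : F z - F b - d * (z - b) = (f n z - f n b - cder (f n) b * (z - b)) +
    ((f n b - F b) - (f n z - F z) + (cder (f n) b - d) * (z - b))); last by ring.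
  apply: le_trans (modulusD _ _) _.
  have := modulusD ((f n b - F b) - (f n z - F z)) ((cder (f n) b - d) * (z - b)).
  have := modulusB (f n b - F b) (f n z - F z); rewrite modulusM.
  have : modulus (cder (f n) b - d) * modulus (z - b) <= e / 4 * 2.
    by apply: ler_pM; rewrite ?modulus_ge0// ltW.
  by move: h1 h2 h3; clear; lra.
exists d => e e0; have K1 : 0 < K + 1 by lra.
exists (Num.min (rho - modulus b) (e / (K + 1))); first by rewrite lt_min D0 divr_gt0.
move=> w; rewrite lt_min => /andP[w1]; rewrite ltr_pdivlMr// => w2.
have wr : modulus w <= rho by have := modulusD (w - b) b; rewrite subrK; lra.
apply: le_trans (key w wr) _; rewrite expr2 mulrA ler_wpM2r ?modulus_ge0//.
by have := modulus_ge0 (w - b); nra.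
Qed.

(** * Accumulating zeros and the identity theorem *)

Definition zeros_cluster F a := forall d : R, 0 < d -> exists z,
  [/\ z != a, modulus (z - a) < d, modulus z < 1 & F z = 0].

Lemma zeros_cluster0 F a : hol F -> modulus a < 1 -> zeros_cluster F a -> F a = 0.
Proof.
move=> HF a1 Ha; apply/eqP; rewrite -modulus_eq0 eq_le modulus_ge0 andbT.
apply/ler_addgt0Pl => e e0; rewrite addr0.
have [d d0 Hd] := hol_continuous HF a1 e0; have [z [_ zd _ Fz]] := Ha d d0.
by have := Hd z zd; rewrite Fz sub0r modulusN => /ltW.
Qed.

Lemma zeros_cluster_dq F a : hol F -> modulus a < 1 -> zeros_cluster F a ->
  zeros_cluster (dq F a) a.
Proof.
move=> HF a1 Ha d /Ha [z [za zd z1 Fz]]; exists z; split => //.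
by rewrite /dq (negbTE za) Fz (zeros_cluster0 HF a1 Ha) subrr mul0r.
Qed.

(* [F] is divisible by all powers of [z - a]. *)
Lemma zeros_cluster_ball F a : hol F -> modulus a < 1 -> zeros_cluster F a ->
  forall z, modulus (z - a) < 1 - modulus a -> F z = 0.
Proof.
move=> HF a1 Ha z za; have a0 := modulus_ge0 a.
have za0 := modulus_ge0 (z - a).
have div n : exists G, [/\ hol G, zeros_cluster G a & forall w, F w = (w - a) ^+ n * G w].
  elim: n => [|n [G [HG aG FG]]]; first by exists F; split => // w; rewrite expr0 mul1r.
  exists (dq G a); split; [exact: hol_dq|exact: zeros_cluster_dq|].
  by move=> w; rewrite FG (dqE G a w) (zeros_cluster0 HG a1 aG) add0r exprSr mulrA.
have [rho [ar rr1 zr]] : exists rho : R, [/\ modulus (z - a) < rho - modulus a, rho < 1 & 0 < rho].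
  by exists ((1 + modulus (z - a) + modulus a) / 2); split; lra.
have r01 : 0 < rho < 1 by rewrite zr.
have [M M0 HM] := hol_bounded HF rr1.
have zrho : modulus z <= rho by have := modulusD (z - a) a; rewrite subrK; lra.
pose D := rho - modulus a; have D0 : 0 < D by rewrite /D; lra.
(* On the circle of radius [rho] the distance to [a] is at least [D], so the cofactor [G] is at most
   [M / D ^+ n] there and, by the maximum principle, at [z]. Since [modulus (z - a) < D], all [n]
   together force [F z = 0]. *)
have bnd n : modulus (F z) * D ^+ n <= modulus (z - a) ^+ n * M.
  have [G [HG _ FG]] := div n.
  have Gb : modulus (G z) <= M / D ^+ n.
    apply: (hol_mp HG r01) => // w wr.
    have wa : D <= modulus (w - a) by have := modulus_lb w a; rewrite /D; lra.
    rewrite ler_pdivlMr ?exprn_gt0//; apply: le_trans (HM w (eq_leC wr)).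
    rewrite FG modulusM modulusX mulrC ler_wpM2r ?modulus_ge0//.
    by apply: lerXn2r; rewrite ?nnegrE ?modulus_ge0// ltW.
  rewrite FG modulusM modulusX -mulrA ler_wpM2l ?exprn_ge0 ?modulus_ge0//.
  by rewrite -ler_pdivlMr ?exprn_gt0.
apply/eqP; rewrite -modulus_eq0 eq_le modulus_ge0 andbT leNgt; apply/negP => F0.
have := @le_of_pow_le R D (modulus (z - a)) (modulus (F z)) M (ltW D0) za0 F0.
by move=> /(_ _) H; have := H (fun n => ltac:(rewrite mulrC; exact: bnd)); rewrite /D; lra.
Qed.

(** Zeros clustering at [b] fill the disc about [b] of radius [1 - modulus b]. A chain of [N.+1]
    equal steps, each shorter than [1 - modulus a], leads from [a] to 0, whose disc is the whole
    unit disc. *)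
Lemma identity_theorem F a : hol F -> modulus a < 1 -> zeros_cluster F a ->
  forall z, modulus z < 1 -> F z = 0.
Proof.
move=> HF a1 Ha; have a0 := modulus_ge0 a.
have step b c : modulus b < 1 -> modulus c < 1 -> modulus (c - b) < 1 - modulus b ->
    zeros_cluster F b -> zeros_cluster F c.
  move=> b1 c1 cb Hb d d0.
  pose t := Num.min d (1 - modulus b - modulus (c - b)) / 2.
  have m0 : 0 < Num.min d (1 - modulus b - modulus (c - b)) by rewrite lt_min d0; lra.
  have [td tb] : t < d /\ t < 1 - modulus b - modulus (c - b).
    have h1 : Num.min d (1 - modulus b - modulus (c - b)) <= d by rewrite ge_min lexx.
    have h2 : Num.min d (1 - modulus b - modulus (c - b)) <= 1 - modulus b - modulus (c - b).
      by rewrite ge_min lexx orbT.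
    by rewrite /t; split; lra.
  have t0 : 0 < t by rewrite /t divr_gt0.
  have tE : modulus (c + t%:C - c) = t by rewrite addrC addKr ger0_modulus// ltW.
  have wb : modulus (c + t%:C - b) < 1 - modulus b.
    by apply: le_lt_trans (modulus_triangle c _ _) _; rewrite tE; lra.
  exists (c + t%:C); split; first by rewrite -subr_eq0 -modulus_gt0 tE.
  - by rewrite tE.
  - by have := modulusD (c + t%:C - b) b; rewrite subrK; lra.
  - exact: (zeros_cluster_ball HF b1 Hb).
have [N HN] := @invS_small R (modulus a) (1 - modulus a) ltac:(lra).
have {}HN := HN N (leqnn _).
pose v k : C := a * (1 - k%:R / N.+1%:R)%:C.
have vE k : (k <= N.+1)%N -> modulus (v k) <= modulus a.
  move=> kN; rewrite /v modulusM ger0_modulus.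
    by rewrite ler_piMr// gerBl divr_ge0.
  by rewrite subr_ge0 ler_pdivrMr// mul1r ler_nat.
have chain k : (k <= N.+1)%N -> zeros_cluster F (v k).
  elim: k => [_|k IH kN]; first by rewrite /v mul0r subr0 mulr1.
  have kN' := ltnW kN; have h1 := vE _ kN; have h2 := vE _ kN'.
  apply: step (IH kN'); [lra|lra|].
  apply: (@lt_le_trans _ _ (1 - modulus a)); last by rewrite lerB.
  rewrite /v -mulrBr -rmorphB /= modulusM.
  rewrite (_ : _ - _ - _ = - (1 / N.+1%:R)); last by rewrite -natr1; field.
  by rewrite modulus_real normrN ger0_norm ?divr_ge0// mulrA mulr1.
move=> z z1; have /(_ (leqnn _)) := chain N.+1.
rewrite /v divff// subrr mulr0 => H0.
by apply: (zeros_cluster_ball HF _ H0); rewrite ?subr0 modulus0 ?subr0.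
Qed.

End Cauchy.

(** * Primitives and parametric integrals *)

Section Primitive.
Context {R : realType}.
Local Notation C := (R[i]).
Local Notation mu := (@lebesgue_measure R).
Implicit Types (F G h : C -> C).

Lemma bolzano_weierstrass (z : nat -> C) (B : R) : (forall k, modulus (z k) <= B) ->
  exists p, forall N (d : R), 0 < d -> exists2 k, (N <= k)%N & modulus (z k - p) < d.
Proof.
move=> zB.
have cA := @compact_plane R (fun z => modulus z <= B) B (fun _ => id) (@closed_plane_disc0 R B).
pose f k : R * R := (complex.Re (z k), complex.Im (z k)).
have [|[x y] [_ clxy]] := cA (f @ \oo) _.
  by exists 0%N => // k _ /=; have := zB k; case: (z k).
exists (x +i* y) => N d d0; have d2 : 0 < d / 2 by rewrite divr_gt0.
have Ev : (f @ \oo) [set p | exists2 k, (N <= k)%N & p = f k].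
  by exists N => // k /= Nk; exists k.
have [_ [[k Nk ->] [/= h1 h2]]] := clxy _ _ Ev (nbhsx_ballx (x, y) _ d2).
exists k => //; have := modulus_le_ReIm (z k - (x +i* y)); rewrite ReB ImB /=.
by move: h1 h2; rewrite /ball /= distrC => h1; rewrite distrC; lra.
Qed.

(** Otherwise circles with radii decreasing to [r] all carry zeros. These accumulate at a point of
    modulus at most [r], different from each of them, against the identity theorem. *)
Lemma zero_free_circle F (r : R) : hol F -> (exists2 z, modulus z < 1 & F z != 0) ->
  0 <= r < 1 -> exists2 s : R, r < s < 1 & forall z, modulus z = s -> F z != 0.
Proof.
move=> HF [z0 z01 Fz0] /andP[r0 r1]; apply: contrapT => N.
(* [k.+2] keeps [s k] below 1 already at [k = 0]. *)
pose s k : R := r + (1 - r) / k.+2%:R.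
have sr k : r < s k by rewrite ltrDl divr_gt0// subr_gt0.
have s1 k : s k < 1.
  rewrite -ltrBrDl ltr_pdivrMr// ltr_pMr ?subr_gt0//.
  by rewrite ltr1n.
have zex k : exists z, modulus z = s k /\ F z = 0.
  apply: contrapT => /forallNP H; apply: N; exists (s k); first by rewrite sr s1.
  by move=> z zs; apply/eqP => Fz; apply: (H z).
pose z k := projT1 (cid (zex k)).
have zP k : modulus (z k) = s k /\ F (z k) = 0 by rewrite /z; case: cid.
have [p Hp] := @bolzano_weierstrass z 1 (fun k => ltac:(rewrite (zP k).1 ltW//)).
have pr : modulus p <= r.
  apply/ler_addgt0Pl => e e0; have e2 : 0 < e / 2 by rewrite divr_gt0.
  have [N1 HN1] := @invS_small R (1 - r) _ e2.
  have [k Nk kp] := Hp N1 _ e2; have := HN1 k.+1 (leqW Nk).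
  have := modulusD (p - z k) (z k); rewrite subrK (zP k).1 /s [modulus (p - _)]modulusC.
  by move: ((1 - r) / _) kp => q; clear; lra.
have := @identity_theorem R F p HF (le_lt_trans pr r1) _ z0 z01 => H.
move/eqP: Fz0; apply; apply: H => d /(Hp 0%N) [k _ kp]; exists (z k); split => //.
- by apply/eqP => zp; have := sr k; rewrite -(zP k).1 zp ltNge pr.
- by rewrite (zP k).1.
- exact: (zP k).2.
Qed.

Lemma continuousC_comp F (g : R -> C) a b : continuousC a b g ->
  (forall t, a <= t <= b -> continuous_pt F (g t)) -> continuousC a b (fun t => F (g t)).
Proof.
move=> Hg HF t tab e e0; have [d d0 Hd] := HF t tab e e0.
have [r r0 Hr] := Hg t tab d d0; exists r => // s sab st.
by apply: Hd; exact: Hr.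
Qed.

Lemma continuousC_real a b : continuousC a b (fun t : R => t%:C).
Proof.
by move=> t _ e e0; exists e => // s _; rewrite -rmorphB /= modulus_real.
Qed.

Lemma continuousC_mulr (g : R -> C) (z : C) a b : continuousC a b g ->
  continuousC a b (fun t => g t * z).
Proof.
move=> Hg; apply: (@continuousC_comp (fun w => w * z)) => // t _.
by apply/diff_pt_continuous/diff_ptM; [exact: diff_pt_id|exact: diff_pt_cst].
Qed.

Lemma bmeasC_bounded (c : R -> C) a b : bmeasC a b c ->
  exists2 M : R, 0 <= M & forall t, a <= t <= b -> modulus (c t) <= M.
Proof.
move=> /bmeas_modulus [_ [M HM]]; exists `|M| => // t /HM.
by rewrite ger0_norm ?modulus_ge0// => /le_trans; apply; exact: ler_norm.
Qed.

(** Common form of averages along rays ([g t = t]) and over circles ([g = cis]). The weight [c] will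
    be only bounded and measurable when it is [dual]. *)
Definition param_integral a b (c g : R -> C) F (z : C) : C :=
  Cint a b (fun t => c t * F (g t * z)).

Lemma bmeasC_path F (g : R -> C) (a b : R) (z : C) : hol F -> modulus z < 1 ->
  continuousC a b g -> (forall t, a <= t <= b -> modulus (g t) <= 1) ->
  bmeasC a b (fun t => F (g t * z)).
Proof.
move=> HF z1 Hg g1; apply/bmeasC_continuous/continuousC_comp.
  exact: continuousC_mulr.
move=> t /g1 gt; apply: hol_continuous => //; rewrite modulusM.
by apply: le_lt_trans z1; rewrite ler_piMl ?modulus_ge0.
Qed.

(** [quadratic_bound] is uniform over base points of modulus at most [modulus z], hence over all
    [g t * z], and integrates to a quadratic error. *)
Lemma param_integral_deriv (a b : R) (c g : R -> C) F z : a <= b -> bmeasC a b c ->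
  continuousC a b g -> (forall t, a <= t <= b -> modulus (g t) <= 1) -> hol F ->
  modulus z < 1 ->
  has_deriv (param_integral a b c g F) z
    (param_integral a b (fun t => c t * g t) g (cder F) z).
Proof.
move=> ab Hc Hg g1 HF z1 e e0.
have [rho [K [zr K0 HK]]] := quadratic_bound HF z1.
have [M M0 HM] := bmeasC_bounded Hc.
have HcF := hol_cder HF.
pose S := M * K * (b - a) + 1.
have S0 : 0 < S by rewrite /S ltr_wpDl// !mulr_ge0// subr_ge0.
have m0 : 0 < Num.min (1 - modulus z) (rho - modulus z) by rewrite lt_min !subr_gt0 z1.
exists (Num.min (Num.min (1 - modulus z) (rho - modulus z)) (e / S)).
  by rewrite lt_min m0 divr_gt0.
move=> w; rewrite !lt_min ltr_pdivlMr// => /andP[/andP[w1 wr] we].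
have wz := modulusD (w - z) z; rewrite subrK in wz.
have w1' : modulus w < 1 by lra.
have wr' : modulus w <= rho by lra.
have mz := bmeasCM Hc (bmeasC_path HF z1 Hg g1).
have mw := bmeasCM Hc (bmeasC_path HF w1' Hg g1).
have md := bmeasCM (bmeasCM Hc (bmeasC_continuous Hg)) (bmeasC_path HcF z1 Hg g1).
have md' := bmeasCM (bmeasC_cst a b (w - z)) md.
rewrite /param_integral mulrC -(CintZ _ md) -(CintB mw mz) -(CintB (bmeasCB mw mz) md').
apply: (@le_trans _ _ (M * (K * modulus (w - z) ^+ 2) * (b - a))); last first.
  rewrite (_ : _ * (b - a) = M * K * (b - a) * modulus (w - z) * modulus (w - z)); last by ring.
  rewrite ler_wpM2r ?modulus_ge0//; apply: le_trans (ltW we); rewrite mulrC.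
  by rewrite ler_wpM2l ?modulus_ge0// /S lerDl.
apply: modulus_Cint_le => // [|t tab]; first exact: bmeasCB (bmeasCB mw mz) md'.
rewrite (_ : _ - _ = c t * (F (g t * w) - F (g t * z) - cder F (g t * z) * (g t * w - g t * z))); last by ring.
rewrite modulusM; apply: ler_pM; rewrite ?modulus_ge0//; first exact: HM.
have gt := g1 t tab; have gg (v : C) : modulus (g t * v) <= modulus v.
  by rewrite modulusM ler_piMl ?modulus_ge0.
apply: le_trans (HK _ _ (gg z) (le_trans (gg w) wr')) _.
rewrite ler_wpM2l// -mulrBr; apply: lerXn2r; rewrite ?nnegrE ?modulus_ge0//.
Qed.

Lemma hol_param_integral (a b : R) (c g : R -> C) F : a <= b -> bmeasC a b c ->
  continuousC a b g -> (forall t, a <= t <= b -> modulus (g t) <= 1) -> hol F ->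
  hol (param_integral a b c g F).
Proof.
move=> ab Hc Hg g1 HF z z1; eexists; exact: (param_integral_deriv ab Hc Hg g1 HF z1).
Qed.

Lemma real_derivP (u : R -> R) (t d : R) :
  (forall e : R, 0 < e -> exists2 r : R, 0 < r & forall s, `|s - t| < r ->
    `|u s - u t - d * (s - t)| <= e * `|s - t|) -> is_derive t 1 u d.
Proof.
move=> H.
have K : (fun h : R => h^-1 *: ((u \o shift t) (h *: (1 : R)) - u t)) @ (0 : R)^' --> d.
  apply/cvgrPdist_lt => e e0; have e2 : 0 < e / 2 by rewrite divr_gt0.
  have [r r0 Hr] := H _ e2; apply/nbhs_ballP; exists r => //= h.
  rewrite /ball /= sub0r normrN => hr h0.
  have := Hr (h + t); rewrite addrK => /(_ hr) K.
  rewrite /GRing.scale /= mulr1.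
  have -> : d - h^-1 * (u (h + t) - u t) = - (u (h + t) - u t - d * h) / h by field.
  rewrite normrM normrN normfV ltr_pdivrMr ?normr_gt0//.
  apply: le_lt_trans K _; rewrite ltr_pM2r ?normr_gt0//; lra.
split; first by apply/cvg_ex; exists d.
by apply: cvg_lim.
Qed.

Lemma real_ftc (u v : R -> R) (a b : R) : a < b ->
  (forall t : R, a <= t <= b -> is_derive t 1 u (v t)) ->
  {within `[a, b], continuous v} -> \int[mu]_(t in `[a, b]) v t = u b - u a.
Proof.
move=> ab Hu cv.
have uc t : a <= t <= b -> {for t, continuous u}.
  by move=> /Hu [du _]; apply: differentiable_continuous; exact/derivable1_diffP.
rewrite /Rintegral (@continuous_FTC2 R v u a b) //.
- split.
  + by move=> t; rewrite in_itv /= => /andP[t0 t1]; have [] := Hu t; rewrite ?ltW.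
  + by apply: cvg_at_right_filter; apply: uc; rewrite lexx ltW.
  + by apply: cvg_at_left_filter; apply: uc; rewrite lexx ltW.
- move=> t; rewrite in_itv /= => /andP[t0 t1].
  by rewrite derive1E; have [_ ->] := Hu t ltac:(by rewrite !ltW).
Qed.

Lemma hol_ftc F z : hol F -> modulus z < 1 ->
  Cint 0 1 (fun t => cder F (t%:C * z) * z) = F z - F 0.
Proof.
move=> HF z1; have HcF := hol_cder HF.
have tz (t : R) : 0 <= t <= 1 -> modulus (t%:C * z) < 1.
  move=> /andP[t0 t1]; rewrite modulusM ger0_modulus//.
  by apply: le_lt_trans z1; rewrite ler_piMl ?modulus_ge0.
have cc : continuousC 0 1 (fun t => cder F (t%:C * z) * z).
  apply/continuousC_mulr/continuousC_comp; first exact/continuousC_mulr/continuousC_real.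
  by move=> t /tz; exact: hol_continuous.
have der (t : R) : 0 <= t <= 1 -> forall e : R, 0 < e -> exists2 r : R, 0 < r & forall s : R, `|s - t| < r ->
    modulus (F (s%:C * z) - F (t%:C * z) - cder F (t%:C * z) * z * (s - t)%:C) <= e * `|s - t|.
  move=> /tz tz1 e e0; have [r r0 Hr] := cderP (HF _ tz1) e0.
  exists r => // s sr.
  have E : s%:C * z - t%:C * z = (s - t)%:C * z by rewrite rmorphB mulrBl.
  have zs : modulus ((s - t)%:C * z) <= `|s - t|.
    by rewrite modulusM modulus_real ler_piMr// ltW.
  have := Hr (s%:C * z); rewrite E => /(_ (le_lt_trans zs sr)).
  rewrite [_ * z * (s - t)%:C](_ : _ = cder F (t%:C * z) * ((s - t)%:C * z)); last by ring.
  move=> /le_trans; apply.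
  by rewrite ler_wpM2l ?(ltW e0).
have F1 : F z - F 0 = F (1%:C * z) - F (0%:C * z) by rewrite mul1r mul0r.
rewrite F1; apply: complex_eqP => /=; rewrite ?ReB ?ImB.
- apply: (@real_ftc (fun t => complex.Re (F (t%:C * z)))) => //.
    move=> t /der H; apply: real_derivP => e /H [r r0 Hr]; exists r => // s /Hr.
    apply: le_trans; apply: le_trans (Re_modulus _).
    by rewrite !ReB [complex.Re (_ * (s - t)%:C)]ReMc /= mulr0 subr0.
  apply: within_continuousP => t tab e e0; have [d d0 Hd] := cc t tab e e0.
  exists d => // s sab st; rewrite -ReB; apply: le_lt_trans (Re_modulus _) _; exact: Hd.
- apply: (@real_ftc (fun t => complex.Im (F (t%:C * z)))) => //.
    move=> t /der H; apply: real_derivP => e /H [r r0 Hr]; exists r => // s /Hr.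
    apply: le_trans; apply: le_trans (Im_modulus _).
    by rewrite !ImB [complex.Im (_ * (s - t)%:C)]ImMc /= mulr0 add0r.
  apply: within_continuousP => t tab e e0; have [d d0 Hd] := cc t tab e e0.
  exists d => // s sab st; rewrite -ImB; apply: le_lt_trans (Im_modulus _) _; exact: Hd.
Qed.

Lemma cder0_constant F : hol F -> (forall z, modulus z < 1 -> cder F z = 0) ->
  forall z, modulus z < 1 -> F z = F 0.
Proof.
move=> HF H z z1; apply/eqP; rewrite -subr_eq0 -hol_ftc//.
rewrite (@eq_Cint _ _ _ _ (fun=> 0)) ?Cint_cst ?mul0r// => t /andP[t0 t1].
rewrite H ?mul0r// modulusM ger0_modulus//.
by apply: le_lt_trans z1; rewrite ler_piMl ?modulus_ge0.
Qed.

(** * Averages along rays and primitives *)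

Definition ray_mean h (z : C) : C := param_integral 0 1 (fun=> 1) (fun t => t%:C) h z.

Lemma unit_ray (t : R) : 0 <= t <= 1 -> modulus (t%:C : C) <= 1.
Proof. by move=> /andP[t0 t1]; rewrite ger0_modulus. Qed.

Lemma hol_ray_mean h : hol h -> hol (ray_mean h).
Proof.
move=> Hh; apply: hol_param_integral => //; first exact: bmeasC_cst.
  exact: continuousC_real.
exact: unit_ray.
Qed.

Lemma ray_mean0 h : ray_mean h 0 = h 0.
Proof.
rewrite /ray_mean /param_integral (@eq_Cint _ _ _ _ (fun=> h 0)).
  by rewrite Cint_cst// subr0 mulr1.
by move=> t _; rewrite mulr0 mul1r.
Qed.

Lemma segment_integralE h z : hol h -> modulus z < 1 ->
  segment_integral h z = z * ray_mean h z.
Proof.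
move=> Hh z1; rewrite /ray_mean /param_integral -CintZ.
  by apply: eq_Cint => t _; rewrite mul1r mulrC.
apply: bmeasCM; first exact: bmeasC_cst.
by apply: bmeasC_path => //; [exact: continuousC_real|exact: unit_ray].
Qed.

(* [z U'(z) + U(z)] is the integral of [d/dt (t h(t z))]. *)
Lemma ray_mean_primitive h z : hol h -> modulus z < 1 ->
  has_deriv (fun w => w * ray_mean h w) z (h z).
Proof.
move=> Hh z1.
have c1 := bmeasC_cst 0 1 (1 : C).
have cr := @continuousC_real 0 1.
have H1 := param_integral_deriv ler01 c1 cr unit_ray Hh z1.
have := has_derivM (has_deriv_id z) H1; rewrite -/(ray_mean h) mul1r.
set D := param_integral _ _ _ _ _ _.
suff -> : z * D + ray_mean h z = h z by [].
have [z0|z0] := eqVneq z 0; first by rewrite z0 mul0r add0r ray_mean0.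
pose W w := w * h w; have HW : hol W by apply: holM => //; exact: hol_id.
have W' w : modulus w < 1 -> cder W w = w * cder h w + h w.
  move=> w1; have := cderE (has_derivM (has_deriv_id w) (cderP (Hh w w1))).
  by rewrite mul1r.
have := hol_ftc HW z1; have -> : W 0 = 0 by rewrite /W mul0r.
rewrite subr0.
have bh := bmeasC_path Hh z1 cr unit_ray.
have bd := bmeasC_path (hol_cder Hh) z1 cr unit_ray.
have b1 := bmeasCM (bmeasCM c1 (bmeasC_continuous cr)) bd.
have b2 := bmeasCM c1 bh.
have b3 := bmeasCM (bmeasC_cst 0 1 z) b1.
rewrite (@eq_Cint _ _ _ _ (fun t => z * (z * (1 * t%:C * cder h (t%:C * z)) + 1 * h (t%:C * z)))).
  rewrite (CintZ _ (bmeasCD b3 b2)) (CintD b3 b2) (CintZ _ b1) /W => H.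
  exact: (mulfI z0 H).
move=> t tab; rewrite W'; first by ring.
rewrite modulusM; apply: le_lt_trans z1; rewrite ler_piMl ?modulus_ge0//; exact: unit_ray.
Qed.

End Primitive.

(** * Integral means over circles *)

Section Circle.
Context {R : realType}.
Local Notation C := (R[i]).
Local Notation mu := (@lebesgue_measure R).
Implicit Types (F G : C -> C) (p : R).

Definition continuousR (h : R -> R) := forall t e : R, 0 < e -> exists2 d : R, 0 < d &
  forall s, `|s - t| < d -> `|h s - h t| < e.

Lemma continuousR_bmeas h a b : continuousR h -> bmeas a b h.
Proof.
by move=> H; apply: bmeas_continuous => t _ e /(H t) [d d0 Hd]; exists d => // s _; exact: Hd.
Qed.

Lemma Rint_approx h a b (k e : R) : a <= b -> bmeas a b h ->
  (forall t, a <= t <= b -> `|h t - k| <= e) ->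
  `|\int[mu]_(t in `[a, b]) h t - k * (b - a)| <= e * (b - a).
Proof.
move=> ab hh H; rewrite ler_distl.
rewrite (_ : k * (b - a) - e * (b - a) = (k - e) * (b - a)); last by ring.
rewrite -mulrDl -!Rint_cst//; apply/andP; split; apply: le_Rint => //;
  try exact: bmeas_cst; move=> t /H; rewrite ler_distl => /andP[].
  by move=> ? _; lra.
by move=> _ ?; lra.
Qed.

Lemma primitive_deriv h (a t : R) : continuousR h -> a < t -> forall e : R, 0 < e ->
  exists2 r : R, 0 < r & forall s, `|s - t| < r ->
  `|\int[mu]_(x in `[a, s]) h x - \int[mu]_(x in `[a, t]) h x - h t * (s - t)|
     <= e * `|s - t|.
Proof.
move=> Hh at_ e e0; have [d d0 Hd] := Hh t e e0.
exists (Num.min d (t - a)); first by rewrite lt_min d0 subr_gt0.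
move=> s; rewrite lt_min => /andP[sd sa].
have as_ : a <= s by move: sa; rewrite ltr_distl => /andP[? _]; lra.
have [ts|/ltW st] := leP t s.
  have cancel (A B : R) : A + B - A = B by ring.
  rewrite (Rint_split (ltW at_) ts) ?cancel; last exact: continuousR_bmeas.
  have E : `|s - t| = s - t by rewrite ger0_norm// subr_ge0.
  rewrite E in sd *; apply: Rint_approx => //; first exact: continuousR_bmeas.
  move=> x /andP[tx xs]; apply/ltW/Hd; rewrite ger0_norm ?subr_ge0//.
  by apply: le_lt_trans sd; rewrite lerD2r.
have cancel (A B : R) : A - (A + B) = - B by ring.
rewrite (Rint_split as_ st) ?cancel; last exact: continuousR_bmeas.
have E : `|s - t| = t - s by rewrite distrC ger0_norm// subr_ge0.
rewrite E in sd *; rewrite -[s - t]opprB mulrN -opprD normrN.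
apply: Rint_approx => //; first exact: continuousR_bmeas.
move=> x /andP[sx xt]; apply/ltW/Hd; rewrite distrC ger0_norm ?subr_ge0//.
by apply: le_lt_trans sd; rewrite lerD2l lerN2.
Qed.

(** As a function of the shift, the integral is [P (T + b) - P b], whose derivative
    [h (b + T) - h b] vanishes. *)
Lemma periodic_shift (h : R -> R) (T b : R) : 0 < T -> 0 <= b -> continuousR h ->
  (forall t, h (t + T) = h t) ->
  \int[mu]_(t in `[0, T]) h (t + b) = \int[mu]_(t in `[0, T]) h t.
Proof.
(* Starting at -1 makes [P] differentiable from both sides at every [t >= 0]. *)
move=> T0 b0 Hh hT; pose P x := \int[mu]_(t in `[-1, x]) h t.
have Pd t : 0 <= t -> forall e : R, 0 < e -> exists2 r : R, 0 < r & forall s, `|s - t| < r ->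
  `|P s - P t - h t * (s - t)| <= e * `|s - t|.
  by move=> t0; apply: primitive_deriv => //; lra.
have sh (t c : R) : 0 <= t + c -> is_derive t 1 (fun x => P (x + c)) (h (t + c)).
  move=> tc; apply: real_derivP => e /(Pd _ tc) [r r0 Hr]; exists r => // s st.
  have E : s + c - (t + c) = s - t by ring.
  by have := Hr (s + c); rewrite E; apply.
have hc c : continuousR (fun t => h (t + c)).
  move=> t e /(Hh (t + c)) [d d0 Hd]; exists d => // s st; apply: Hd.
  by rewrite (_ : s + c - (t + c) = s - t)//; ring.
have within k a' b' : continuousR k -> {within `[a', b'], continuous k}.
  move=> Hk; apply: within_continuousP => t _ e /(Hk t) [d d0 Hd]; exists d => // s _; exact: Hd.
have key (c : R) : 0 <= c -> \int[mu]_(t in `[0, T]) h (t + c) = P (T + c) - P c.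
  move=> c0; have := @real_ftc _ (fun x => P (x + c)) (fun t => h (t + c)) 0 T T0.
  rewrite add0r; apply.
  - by move=> t /andP[t0 _]; apply: sh; lra.
  - by apply: within; exact: hc.
have -> : \int[mu]_(t in `[0, T]) h t = \int[mu]_(t in `[0, T]) h (t + 0).
  by under eq_Rintegral do rewrite -[X in h X]addr0.
rewrite !key// addr0; move: b0; rewrite le_eqVlt => /predU1P[<-|b0]; first by rewrite addr0.
have sh2 (t : R) : 0 <= t <= b -> is_derive t 1 (fun x => P (x + T) - P x) (0 : R).
  move=> /andP[t0 _]; apply: real_derivP => e e0; have e2 : 0 < e / 2 by rewrite divr_gt0.
  have tT : 0 <= t + T by rewrite addr_ge0// ltW.
  have [r1 r10 H1] := Pd _ tT _ e2; have [r2 r20 H2] := Pd _ t0 _ e2.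
  exists (Num.min r1 r2); first by rewrite lt_min r10.
  move=> s; rewrite lt_min => /andP[s1 /H2 h2].
  have E : s + T - (t + T) = s - t by ring.
  have := H1 (s + T); rewrite E hT => /(_ s1) h1.
  have -> : P (s + T) - P s - (P (t + T) - P t) - 0 * (s - t) =
    (P (s + T) - P (t + T) - h t * (s - t)) - (P s - P t - h t * (s - t)) by ring.
  by apply: le_trans (ler_normB _ _) _; rewrite (splitr e) mulrDl lerD.
have c0 : continuousR (fun=> 0) by move=> t e e0; exists 1 => // s _; rewrite subrr normr0.
have D := real_ftc b0 sh2 (within _ _ _ c0).
move: D; rewrite Rint_cst ?(ltW b0)// mul0r add0r [b + T]addrC.
by move=> /esym/eqP; rewrite subr_eq0 => /eqP.
Qed.

Definition cis (t : R) : C := cos t +i* sin t.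

Lemma modulus_cis t : modulus (cis t) = 1.
Proof. by rewrite modulusE /= cos2Dsin2 sqrtr1. Qed.

Lemma cisD s t : cis (s + t) = cis s * cis t.
Proof. by apply: complex_eqP; rewrite ?ReMc ?ImMc /= ?cosD// sinD addrC. Qed.

Lemma cis2pi t : cis (t + 2 * pi) = cis t.
Proof. by rewrite /cis mulr_natl cosD2pi sinD2pi. Qed.

Lemma circle_pointE (r t : R) : circle_point r t = cis t * r%:C.
Proof. by apply: complex_eqP; rewrite ?ReMc ?ImMc /=; ring. Qed.

Lemma cis_continuous t (e : R) : 0 < e -> exists2 d : R, 0 < d &
  forall s, `|s - t| < d -> modulus (cis s - cis t) < e.
Proof.
move=> e0; have e2 : 0 < e / 2 by rewrite divr_gt0.
have /cvgrPdist_lt /(_ _ e2) := @continuous_cos R t.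
have /cvgrPdist_lt /(_ _ e2) := @continuous_sin R t.
move=> /nbhs_ballP[d1 /= d10 H1] /nbhs_ballP[d2 /= d20 H2].
exists (Num.min d1 d2); first by rewrite lt_min d10.
move=> s; rewrite lt_min distrC => /andP[/H1 h1 ].
rewrite distrC => s2; have := H2 s; rewrite /ball /= distrC => /(_ s2) h2.
apply: le_lt_trans (modulus_le_ReIm _) _; rewrite ReB ImB /= [`|cos s - _|]distrC [`|sin s - _|]distrC.
by move: h1 h2; rewrite /ball_ /= => h1 h2; lra.
Qed.

Lemma continuousC_cis a b : continuousC a b cis.
Proof. by move=> t _ e /(cis_continuous t) [d d0 Hd]; exists d => // s _; exact: Hd. Qed.

(** The angle is non-negative to match the shifts of [periodic_shift]; below the real axis it is
    [2 * pi - acos x]. *)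
Lemma polar (z : C) (rho : R) : 0 < rho -> modulus z = rho ->
  exists2 b : R, 0 <= b & z = cis b * rho%:C.
Proof.
move=> r0 zr; pose x := complex.Re z / rho; pose y := complex.Im z / rho.
have xy : x ^+ 2 + y ^+ 2 = 1.
  by rewrite /x /y !expr_div_n -mulrDl -sqr_modulus zr divff// expf_neq0// gt_eqF.
have x1 : -1 <= x <= 1.
  by rewrite -ler_norml -(@ler_pXn2r _ 2)// ?nnegrE// expr1n real_normK ?num_real//; have := sqr_ge0 y; lra.
have zE : z = (x * rho) +i* (y * rho).
  by apply: complex_eqP; rewrite /= divfK// gt_eqF.
have yE : 1 - x ^+ 2 = y ^+ 2 by rewrite -xy; ring.
have [y0|y0] := leP 0 y.
  exists (acos x); first exact: acos_ge0.
  rewrite zE; apply: complex_eqP; rewrite ?ReMc ?ImMc /= ?acosK ?in_itv//; first by ring.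
  by rewrite sin_acos// yE sqrtr_sqr ger0_norm//; ring.
exists (2 * pi - acos x).
  by have := acos_lepi x1; have := @pi_ge0 R; lra.
have -> : cis (2 * pi - acos x) = cos (acos x) -i* sin (acos x).
  by rewrite addrC cis2pi /cis cosN sinN.
rewrite zE; apply: complex_eqP; rewrite ?ReMc ?ImMc /= ?acosK ?in_itv//; first by ring.
by rewrite sin_acos// yE sqrtr_sqr ltr0_norm//; ring.
Qed.

(** Young's inequality with exponents [p / (p - 1)] and [p]; the first is infinite at [p = 1], hence
    the separate case. *)
Lemma young p x y : 1 <= p -> 0 <= x -> 0 <= y ->
  x `^ (p - 1) * y <= (1 - p^-1) * x `^ p + p^-1 * y `^ p.
Proof.
move=> p1 x0 y0; move: (p1); rewrite le_eqVlt => /predU1P[<-|p1'].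
  by rewrite subrr powRr0 invr1 subrr mul0r add0r !mul1r powRr1.
have p0 : 0 < p by lra.
have pm : 0 < p - 1 by rewrite subr_gt0.
have := @conjugate_powR R y (x `^ (p - 1)) p (p / (p - 1)) y0 (powR_ge0 _ _) p0.
rewrite divr_gt0// -powRrM => /(_ isT).
have -> : (p - 1) * (p / (p - 1)) = p by field; rewrite gt_eqF.
have -> : p^-1 + (p / (p - 1))^-1 = 1 by field; rewrite !gt_eqF.
move=> /(_ erefl); rewrite mulrC => /le_trans; apply.
rewrite addrC [X in _ <= X](_ : _ = x `^ p / (p / (p - 1)) + y `^ p / p)//.
by field; rewrite !gt_eqF.
Qed.

(** The tangent inequality for the convex power function, read off from Young's inequality without
    differentiating powers. *)
Lemma powR_lip p x y : 1 <= p -> 0 <= y -> y <= x ->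
  x `^ p - y `^ p <= p * x `^ (p - 1) * (x - y).
Proof.
move=> p1 y0 yx; have p0 : 0 < p by lra.
have x0 := le_trans y0 yx; have := young p1 x0 y0.
have := mulr_powRB1 x0 p0; set u := x `^ (p - 1) => <- H.
have : p * (u * y) <= p * ((1 - p^-1) * (x * u) + p^-1 * y `^ p) by rewrite ler_pM2l.
have -> : p * ((1 - p^-1) * (x * u) + p^-1 * y `^ p) = (p - 1) * (x * u) + y `^ p.
  by field; rewrite gt_eqF.
by move=> K; lra.
Qed.

Lemma powR_continuous p (h : R -> R) : 1 <= p -> (forall t, 0 <= h t) -> continuousR h ->
  continuousR (fun t => h t `^ p).
Proof.
move=> p1 h0 Hh t e e0; have p0 : 0 < p by lra.
pose K := p * (h t + 1) `^ (p - 1) + 1.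
have K0 : 0 < K by rewrite /K ltr_wpDl// mulr_ge0 ?powR_ge0// ltW.
have m0 : 0 < Num.min 1 (e / K) by rewrite lt_min ltr01 divr_gt0.
have [d d0 Hd] := Hh t _ m0; exists d => // s /Hd; rewrite lt_min ltr_pdivlMr// => /andP[s1 s2].
have key x y : 0 <= y -> y <= x -> x <= h t + 1 -> `|x - y| * K < e ->
   `|x `^ p - y `^ p| < e.
  move=> y0 yx xh; rewrite (ger0_norm (_ : 0 <= x - y)) ?subr_ge0// => H.
  have x0 := le_trans y0 yx.
  rewrite ger0_norm; last by rewrite subr_ge0 ge0_ler_powR ?nnegrE// ltW.
  apply: le_lt_trans (powR_lip p1 y0 yx) _; apply: le_lt_trans H.
  rewrite mulrC ler_wpM2l ?subr_ge0// /K ler_wpDr// ler_wpM2l ?(ltW p0)//.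
  by rewrite ge0_ler_powR ?nnegrE ?subr_ge0 ?addr_ge0.
have [ts|/ltW st] := leP (h t) (h s).
  by apply: key => //; move: s1; rewrite ltr_distl => /andP[]; lra.
by rewrite distrC; apply: key; rewrite // ?lerDl// distrC.
Qed.

Lemma continuousR_circle F (z : C) : hol F -> modulus z < 1 ->
  (forall t (e : R), 0 < e -> exists2 d : R, 0 < d & forall s, `|s - t| < d ->
    modulus (F (cis s * z) - F (cis t * z)) < e).
Proof.
move=> HF z1 t e e0; have m1 s : modulus (cis s * z) < 1 by rewrite modulusM modulus_cis mul1r.
have [d d0 Hd] := hol_continuous HF (m1 t) e0.
have [r r0 Hr] := cis_continuous t d0; exists r => // s /Hr H; apply: Hd.
rewrite -mulrBl modulusM; apply: le_lt_trans H.
by rewrite ler_piMr ?modulus_ge0// ltW.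
Qed.

Lemma twopi_gt0 : 0 < 2 * pi :> R. Proof. by rewrite mulr_gt0 ?pi_gt0. Qed.

Lemma circle_bmeasC F (z : C) : hol F -> modulus z < 1 ->
  bmeasC 0 (2 * pi) (fun t => F (cis t * z)).
Proof.
move=> HF z1; apply: bmeasC_path => //; first exact: continuousC_cis.
by move=> t _; rewrite modulus_cis.
Qed.

Lemma Cint_rotate F (z : C) (b : R) : hol F -> modulus z < 1 -> 0 <= b ->
  Cint 0 (2 * pi) (fun t => F (cis t * (cis b * z))) = Cint 0 (2 * pi) (fun t => F (cis t * z)).
Proof.
move=> HF z1 b0; have cc := continuousR_circle HF z1.
apply: complex_eqP => /=.
- rewrite -(@periodic_shift (fun t => complex.Re (F (cis t * z))) _ b twopi_gt0)//.
  + by apply: eq_Rintegral => t _; rewrite cisD mulrA.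
  + move=> t e /(cc t) [d d0 Hd]; exists d => // s /Hd.
    by rewrite -ReB; exact: le_lt_trans (Re_modulus _).
  + by move=> t; rewrite cis2pi.
- rewrite -(@periodic_shift (fun t => complex.Im (F (cis t * z))) _ b twopi_gt0)//.
  + by apply: eq_Rintegral => t _; rewrite cisD mulrA.
  + move=> t e /(cc t) [d d0 Hd]; exists d => // s /Hd.
    by rewrite -ImB; exact: le_lt_trans (Im_modulus _).
  + by move=> t; rewrite cis2pi.
Qed.

(** Unnormalised, and based at a complex point so that it can be rotated along its circle. *)
Definition pow_integral p F (z : C) : R :=
  \int[mu]_(t in `[0, 2 * pi]) (modulus (F (cis t * z)) `^ p).

Lemma continuousR_pow p F (z : C) : 1 <= p -> hol F -> modulus z < 1 ->
  continuousR (fun t => modulus (F (cis t * z)) `^ p).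
Proof.
move=> p1 HF z1; apply: powR_continuous => // t e /(continuousR_circle HF z1 t) [d d0 Hd].
exists d => // s /Hd; apply: le_lt_trans; rewrite ler_norml.
have := modulus_lb (F (cis s * z)) (F (cis t * z)).
have := modulus_lb (F (cis t * z)) (F (cis s * z)).
rewrite [modulus (F (cis t * z) - _)]modulusC => *; apply/andP; split; lra.
Qed.

Lemma bmeas_pow p F (z : C) : 1 <= p -> hol F -> modulus z < 1 ->
  bmeas 0 (2 * pi) (fun t => modulus (F (cis t * z)) `^ p).
Proof. by move=> *; apply/continuousR_bmeas/continuousR_pow. Qed.

Lemma pow_integral_ge0 p F z : 0 <= pow_integral p F z.
Proof. by apply: Rintegral_ge0 => t _; exact: powR_ge0. Qed.

Lemma pow_integral_rotate p F (z : C) (b : R) : 1 <= p -> hol F -> modulus z < 1 -> 0 <= b ->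
  pow_integral p F (cis b * z) = pow_integral p F z.
Proof.
move=> p1 HF z1 b0; rewrite /pow_integral.
have per t : modulus (F (cis (t + 2 * pi) * z)) `^ p = modulus (F (cis t * z)) `^ p.
  by rewrite cis2pi.
apply: etrans (periodic_shift twopi_gt0 b0 (continuousR_pow p1 HF z1) per).
by apply: eq_Rintegral => t _; rewrite cisD mulrA.
Qed.

End Circle.

(** * Monotonicity of means, mean value property and point evaluation *)

Section Means.
Context {R : realType}.
Local Notation C := (R[i]).
Local Notation mu := (@lebesgue_measure R).
Implicit Types (F G : C -> C) (p : R).

Lemma real_lt1 (r : R) : 0 <= r < 1 -> modulus (r%:C : C) < 1.
Proof. by move=> /andP[r0 r1]; rewrite ger0_modulus. Qed.

(** The first relation is only an inequality because of [x = 0] and [p = 1], where the right side is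
    the zeroth power of 0, equal to 1. *)
Lemma mulr_powRB2 x p : 1 <= p -> 0 <= x ->
  x * x `^ (p - 2) <= x `^ (p - 1) /\ x * (x * x `^ (p - 2)) = x `^ p.
Proof.
move=> p1; have p0 : p != 0 by rewrite gt_eqF//; lra.
rewrite le_eqVlt => /predU1P[<-|x0]; first by rewrite !mul0r powR_ge0 (powR0 p0).
have E : x * x `^ (p - 2) = x `^ (p - 1).
  rewrite -{1}(powRr1 (ltW x0)) -powRD; first by congr powR; ring.
  by apply/implyP => _; rewrite gt_eqF.
by rewrite E lexx mulr_powRB1// ?ltW//; lra.
Qed.

(** The function that norms [w] in the duality between Lebesgue spaces of conjugate exponents. For
    [p < 2] the second factor has a negative exponent, but the first makes the product 0 at zeros of
    [w]. *)
Definition dual (p : R) (w : R -> C) (t : R) : C :=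
  (w t)^*%C * (modulus (w t) `^ (p - 2))%:C.

Lemma modulus_dual p w t : 1 <= p -> modulus (dual p w t) <= modulus (w t) `^ (p - 1).
Proof.
move=> p1; rewrite modulusM modulus_conj ger0_modulus ?powR_ge0//.
by have [] := mulr_powRB2 p1 (modulus_ge0 (w t)).
Qed.

Lemma dualM p w t : 1 <= p -> dual p w t * w t = (modulus (w t) `^ p)%:C.
Proof.
move=> p1; have [_ <-] := mulr_powRB2 p1 (modulus_ge0 (w t)).
by rewrite /dual mulrAC [_ * w t]mulrC mulc_conj -rmorphM /= expr2 mulrA.
Qed.

Lemma bmeasC_dual p w (a b : R) : 1 <= p -> bmeasC a b w -> bmeasC a b (dual p w).
Proof.
move=> p1 hw; have [B B0 HB] := bmeasC_bounded hw; have [[mr _] [mi _]] := hw.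
have [mm _] := bmeas_modulus hw.
have mp : measurable_fun `[a, b] (fun t => modulus (w t) `^ (p - 2)).
  exact: (measurableT_comp (@measurable_powR R (p - 2)) mm).
have db t : a <= t <= b -> modulus (dual p w t) <= B `^ (p - 1).
  move=> /HB wB; apply: le_trans (modulus_dual w t p1) _.
  by rewrite ge0_ler_powR ?nnegrE ?modulus_ge0 ?subr_ge0.
split; split.
- rewrite (_ : (fun t => _) = (fun t => complex.Re (w t) * modulus (w t) `^ (p - 2))).
    exact: measurable_funM.
  by apply/funext => t; rewrite ReMc /= mulr0 subr0; case: (w t).
- by exists (B `^ (p - 1)) => t /db; exact: le_trans (Re_modulus _).
- rewrite (_ : (fun t => _) = (fun t => - complex.Im (w t) * modulus (w t) `^ (p - 2))).
    by apply: measurable_funM => //; exact: measurableT_comp.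
  by apply/funext => t; rewrite ImMc /= mulr0 add0r; case: (w t).
- by exists (B `^ (p - 1)) => t /db; exact: le_trans (Im_modulus _).
Qed.

Lemma twopi_ge0 : 0 <= 2 * pi :> R. Proof. exact/ltW/twopi_gt0. Qed.

(* [c] is the dual function of [F] on the circle of radius [r]; the maximum
   principle for [z |-> \int c(t) F(e^(it) z)] compares the two circles. *)
Lemma pow_integral_mono p F (r rho : R) : 1 <= p -> hol F -> 0 <= r -> r <= rho -> rho < 1 ->
  pow_integral p F r%:C <= pow_integral p F rho%:C.
Proof.
move=> p1 HF r0 rr rho1; have p0 : 0 < p by lra.
have [r1 rho0] := (le_lt_trans rr rho1, le_trans r0 rr).
move: (rho0); rewrite le_eqVlt => /predU1P[rhoE|rho0'].
  by rewrite -rhoE in rr *; rewrite (_ : r = 0)//; apply/eqP; rewrite eq_le rr.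
have rz : modulus (r%:C : C) < 1 by apply: real_lt1; rewrite r0.
have rhoz : modulus (rho%:C : C) < 1 by apply: real_lt1; rewrite rho0.
pose w t := F (cis t * r%:C); pose c := dual p w.
have hw : bmeasC 0 (2 * pi) w by exact: circle_bmeasC.
have hc : bmeasC 0 (2 * pi) c by exact: bmeasC_dual.
have cis1 t : 0 <= t <= 2 * pi -> modulus (cis t : C) <= 1 by rewrite modulus_cis.
have ccis : continuousC 0 (2 * pi) (cis : R -> C) by exact: continuousC_cis.
have Hphi := hol_param_integral twopi_ge0 hc ccis cis1 HF.
set A := pow_integral p F r%:C; set B := pow_integral p F rho%:C.
have A1 : A <= modulus (param_integral 0 (2 * pi) c cis F r%:C).
  apply: le_trans (Re_le_modulus _); rewrite le_eqVlt; apply/orP; left; apply/eqP.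
  by apply: eq_Rintegral => t _; rewrite [c t * _]dualM.
(* With [A1] and the maximum principle this becomes [A <= (1 - p^-1) * A + p^-1 * B], that is
   [A <= B]. The right side is the same at all points of the circle, by rotation. *)
have bound z : modulus z = rho ->
    modulus (param_integral 0 (2 * pi) c cis F z) <= (1 - p^-1) * A + p^-1 * B.
  move=> zr; have z1 : modulus z < 1 by rewrite zr.
  have hz : bmeasC 0 (2 * pi) (fun t => F (cis t * z)) by exact: circle_bmeasC.
  have BE : B = pow_integral p F z.
    by have [b b0 ->] := polar rho0' zr; rewrite pow_integral_rotate.
  apply: le_trans (modulus_Cint (bmeasCM hc hz)) _.
  have bA := bmeas_pow p1 HF rz; have bB := bmeas_pow p1 HF z1.
  have b1 := bmeasM (bmeas_cst 0 (2 * pi) (1 - p^-1)) bA.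
  have b2 := bmeasM (bmeas_cst 0 (2 * pi) p^-1) bB.
  rewrite BE /A /pow_integral -(RintZ _ bA) -(RintZ _ bB) -(RintD b1 b2).
  apply: le_Rint; [exact: bmeas_modulus (bmeasCM hc hz)|exact: bmeasD b1 b2|].
  move=> t _; apply: le_trans (young p1 (modulus_ge0 _) (modulus_ge0 _)).
  by rewrite modulusM; exact: (ler_wpM2r (modulus_ge0 _) (modulus_dual w t p1)).
have rho01 : 0 < rho < 1 by rewrite rho0'.
have zr : modulus (r%:C : C) <= rho by rewrite ger0_modulus.
have H := le_trans A1 (hol_mp Hphi rho01 bound zr).
have pV : 0 < p^-1 by rewrite invr_gt0.
by rewrite -(ler_pM2l pV); lra.
Qed.

(** The circular average [phi] is holomorphic and, by rotation, constant on the circle of radius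
    [rho]; the maximum principle for [phi - phi rho%:C] extends this to 0. *)
Lemma mean_value G (rho : R) : hol G -> 0 < rho < 1 ->
  Cint 0 (2 * pi) (fun t => G (cis t * rho%:C)) = (2 * pi)%:C * G 0.
Proof.
move=> HG /andP[r0 r1]; have rz : modulus (rho%:C : C) < 1 by apply: real_lt1; rewrite ltW.
pose phi := param_integral 0 (2 * pi) (fun=> 1) cis G.
have phiE z : phi z = Cint 0 (2 * pi) (fun t => G (cis t * z)).
  by apply: eq_Cint => t _; rewrite mul1r.
have Hphi : hol phi.
  apply: hol_param_integral; [exact: twopi_ge0|exact: bmeasC_cst|exact: continuousC_cis| |by []].
  by move=> t _; rewrite modulus_cis.
have H : modulus (phi 0 - phi rho%:C) <= 0.
  apply: (hol_mp (holB Hphi (hol_cst (phi rho%:C))) (rho := rho)); rewrite ?r0 ?modulus0 ?ltW//.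
  move=> z zr; have [b b0 ->] := polar r0 zr.
  by rewrite !phiE Cint_rotate// subrr modulus0.
have /eqP : modulus (phi 0 - phi rho%:C) == 0 by rewrite eq_le H modulus_ge0.
move/eqP; rewrite modulus_eq0 subr_eq0 -phiE => /eqP <-.
rewrite phiE (@eq_Cint _ _ _ _ (fun=> G 0)); last by move=> t _; rewrite mulr0.
by rewrite Cint_cst ?twopi_ge0// subr0 mulrC.
Qed.

(** [k - 1 = a / (z - a)] is no longer than [k], so [k] is at least as close to 1 as to 0. *)
Lemma cauchy_kernel_Re (a z : C) : modulus a <= modulus z -> z != a ->
  2^-1 <= complex.Re (z / (z - a)).
Proof.
move=> az za; have za0 : z - a != 0 by rewrite subr_eq0.
set k := z / (z - a).
have k1 : k - 1 = a / (z - a) by rewrite /k; field.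
have : modulus (k - 1) ^+ 2 <= modulus k ^+ 2.
  apply: lerXn2r; rewrite ?nnegrE ?modulus_ge0// k1 !modulusM.
  by rewrite ler_wpM2r ?modulus_ge0.
rewrite !sqr_modulus ReB ImB /=; nra.
Qed.

(** The mean value property for [z * dq F a z], which vanishes at 0, shows that [F] and the constant
    [F a] have the same integral against [k z = z / (z - a)]. A lower bound [pi] on the real part of
    the integral of [k] then does the work of Cauchy's formula. *)
Lemma point_evaluation F (a : C) (rho : R) : hol F -> modulus a < rho -> rho < 1 ->
  modulus (F a) * pi <= rho / (rho - modulus a) * pow_integral 1 F rho%:C.
Proof.
move=> HF ar r1; have a0 := modulus_ge0 a.
have r0 : 0 < rho by exact: le_lt_trans ar.
have a1 : modulus a < 1 by exact: lt_trans ar r1.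
have rz : modulus (rho%:C : C) < 1 by apply: real_lt1; rewrite ltW.
have zr t : modulus (cis t * rho%:C) = rho by rewrite modulusM modulus_cis mul1r ger0_modulus// ltW.
have za t : cis t * rho%:C != a by apply/eqP => E; have := zr t; rewrite E; lra.
pose k z := z * (z - a)^-1.
have hk : bmeasC 0 (2 * pi) (fun t => k (cis t * rho%:C)).
  apply/bmeasC_continuous/continuousC_comp; first exact/continuousC_mulr/continuousC_cis.
  move=> t _; apply/diff_pt_continuous/diff_ptM; first exact: diff_pt_id.
  apply: diff_ptV; first by rewrite subr_eq0.
  by apply: diff_ptB; [exact: diff_pt_id|exact: diff_pt_cst].
have hF := circle_bmeasC HF rz.
have hFk := bmeasCM hF hk; have hak := bmeasCM (bmeasC_cst 0 (2 * pi) (F a)) hk.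
have HG : hol (fun z => z * dq F a z) by apply: holM; [exact: hol_id|exact: hol_dq].
have := mean_value HG (_ : 0 < rho < 1); rewrite r0 r1 mul0r mulr0 => /(_ isT).
rewrite (@eq_Cint _ _ _ _ (fun t => F (cis t * rho%:C) * k (cis t * rho%:C) - F a * k (cis t * rho%:C))); last first.
  by move=> t _; rewrite /dq (negbTE (za t)) /k; ring.
rewrite (CintB hFk hak) (CintZ _ hk) => /eqP; rewrite subr_eq0 => /eqP E.
have K1 : pi <= modulus (Cint 0 (2 * pi) (fun t => k (cis t * rho%:C))).
  apply: le_trans (Re_le_modulus _).
  have E2 : 2^-1 * (2 * pi - 0) = pi :> R by rewrite subr0; field.
  rewrite -[X in X <= _]E2 -Rint_cst ?twopi_ge0//; apply: le_Rint; [exact: bmeas_cst|by case: hk|].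
  by move=> t _; apply: cauchy_kernel_Re; rewrite // zr ltW.
apply: (@le_trans _ _ (modulus (F a * Cint 0 (2 * pi) (fun t => k (cis t * rho%:C))))).
  by rewrite modulusM ler_wpM2l ?modulus_ge0.
rewrite -E; apply: le_trans (modulus_Cint hFk) _.
have b1 := bmeas_pow (lexx 1) HF rz.
rewrite /pow_integral -RintegralZl//; last exact: bmeas_integrable.
apply: le_Rint; [exact: bmeas_modulus|exact: bmeasM (bmeas_cst _ _ _) b1|].
move=> t _; rewrite modulusM powRr1 ?modulus_ge0// mulrC ler_wpM2r ?modulus_ge0//.
rewrite /k modulusM modulusV zr ler_wpM2l ?(ltW r0)// lef_pV2 ?posrE ?subr_gt0//.
  by have := modulus_lb (cis t * rho%:C) a; rewrite zr.
by rewrite modulus_gt0 subr_eq0.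
Qed.

(** Young's inequality against the constant [s]. Both coefficients are rounded up to 1, whence
    [4 * pi] where the Hölder inequality would give [2 * pi]. *)
Lemma pow_integral1_le p F (z : C) (s : R) : 1 <= p -> hol F -> modulus z < 1 -> 0 < s ->
  pow_integral p F z <= 2 * pi * s `^ p -> pow_integral 1 F z <= 4 * pi * s.
Proof.
move=> p1 HF z1 s0 H; have p0 : 0 < p by lra.
have sp : 0 < s `^ (p - 1) by rewrite powR_gt0.
rewrite -(ler_pM2l sp).
have b1 := bmeas_pow (lexx 1) HF z1; have bp := bmeas_pow p1 HF z1.
have bs := bmeas_cst 0 (2 * pi) (s `^ p).
have -> : s `^ (p - 1) * (4 * pi * s) = s `^ p * (2 * pi - 0) + 2 * pi * s `^ p.
  by rewrite -(mulr_powRB1 (ltW s0) p0); ring.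
apply: (@le_trans _ _ (s `^ p * (2 * pi - 0) + pow_integral p F z)); last by rewrite lerD2l.
rewrite -Rint_cst ?twopi_ge0// /pow_integral -RintegralZl//; last exact: bmeas_integrable.
rewrite -RintegralD//; try exact: bmeas_integrable.
apply: le_Rint; [exact: bmeasM (bmeas_cst _ _ _) b1|exact: bmeasD|].
move=> t _; rewrite powRr1 ?modulus_ge0//.
apply: le_trans (young p1 (ltW s0) (modulus_ge0 _)) _.
have pV : 0 < p^-1 by rewrite invr_gt0.
have pV1 : p^-1 <= 1 by rewrite invf_le1.
by apply: lerD; rewrite ler_piMl ?powR_ge0//; lra.
Qed.

End Means.

(** * Hardy norms *)

Section HardyBound.
Context {R : realType}.
Local Notation C := (R[i]).
Local Notation mu := (@lebesgue_measure R).
Implicit Types (F G : C -> C) (p : \bar R) (q s t : R).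

(** The relation [hardy_norm p f <= s] for functions on the plane, with the root cleared and no
    supremum in the extended reals. *)
Definition hardy_le p F s : Prop :=
  match p with
  | q%:E => forall r : R, 0 <= r < 1 -> pow_integral q F r%:C <= 2 * pi * s `^ q
  | +oo%E => forall z, modulus z < 1 -> modulus (F z) <= s
  | -oo%E => True
  end.

Lemma eq_hardy_le p F G s : (forall z, modulus z < 1 -> F z = G z) ->
  hardy_le p F s -> hardy_le p G s.
Proof.
case: p => [q| |] //= FG H; last by move=> z z1; rewrite -FG// H.
move=> r r01; apply: le_trans (H r r01); rewrite le_eqVlt; apply/orP; left; apply/eqP.
apply: eq_Rintegral => t _; rewrite FG// modulusM modulus_cis mul1r; exact: real_lt1.
Qed.

(** Young's inequality for [m] against [x] and against [y], weighted by [l] and [1 - l]: the left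
    sides add up to the power [q] of [m]. *)
Lemma powR_convex q x y (l : R) : 1 <= q -> 0 <= x -> 0 <= y -> 0 <= l <= 1 ->
  (l * x + (1 - l) * y) `^ q <= l * x `^ q + (1 - l) * y `^ q.
Proof.
move=> q1 x0 y0 /andP[l0 l1]; set m := l * x + (1 - l) * y.
have l1' : 0 <= 1 - l by rewrite subr_ge0.
have m0 : 0 <= m by rewrite addr_ge0// mulr_ge0.
have q0 : 0 < q by lra.
have h1 := ler_wpM2l l0 (young q1 m0 x0); have h2 := ler_wpM2l l1' (young q1 m0 y0).
have qV : 0 < q^-1 by rewrite invr_gt0.
rewrite -(ler_pM2l qV).
have := mulr_powRB1 m0 q0; rewrite {1}/m; move: h1 h2.
set X := x `^ q; set Y := y `^ q; set M := m `^ q; set N := m `^ (q - 1).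
by move=> *; lra.
Qed.

Lemma powR_div q x y : 0 <= x -> 0 < y -> (x / y) `^ q = x `^ q / y `^ q.
Proof.
move=> x0 y0; rewrite powRM ?invr_ge0 ?(ltW y0)// -[y^-1]powR_inv1 ?(ltW y0)//.
by rewrite -powRrM mulN1r powRN.
Qed.

(** Convexity with weights [s / (s + t)] and [t / (s + t)], applied to the normalised values [x / s]
    and [y / t], gives a pointwise bound that integrates to the claim. *)
Lemma minkowski_circle q F G (z : C) s t : 1 <= q -> hol F -> hol G -> modulus z < 1 ->
  0 < s -> 0 < t -> pow_integral q F z <= 2 * pi * s `^ q ->
  pow_integral q G z <= 2 * pi * t `^ q ->
  pow_integral q (fun w => F w + G w) z <= 2 * pi * (s + t) `^ q.
Proof.
move=> q1 HF HG z1 s0 t0 HFs HGt.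
have st0 : 0 < s + t by rewrite addr_gt0.
have [sq tq stq] : [/\ 0 < s `^ q, 0 < t `^ q & 0 < (s + t) `^ q] by rewrite !powR_gt0.
pose l := s / (s + t).
have l01 : 0 <= l <= 1 by rewrite /l divr_ge0 ?(ltW s0) ?(ltW st0)//= ler_pdivrMr// mul1r lerDl ltW.
have lE : 1 - l = t / (s + t) by rewrite /l; field; rewrite gt_eqF.
pose a := (s + t) `^ q * l / s `^ q; pose b := (s + t) `^ q * (1 - l) / t `^ q.
have /andP[l0 l1] := l01.
have a0 : 0 <= a by exact: (divr_ge0 (mulr_ge0 (ltW stq) l0) (ltW sq)).
have l1' : 0 <= 1 - l by rewrite subr_ge0.
have b0 : 0 <= b by exact: (divr_ge0 (mulr_ge0 (ltW stq) l1') (ltW tq)).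
have pt (x y : R) : 0 <= x -> 0 <= y -> (x + y) `^ q <= a * x `^ q + b * y `^ q.
  move=> x0 y0.
  have -> : x + y = (s + t) * (l * (x / s) + (1 - l) * (y / t)).
    by rewrite lE /l; field; rewrite !gt_eqF.
  have xs : 0 <= x / s by rewrite divr_ge0// ltW.
  have yt : 0 <= y / t by rewrite divr_ge0// ltW.
  rewrite powRM ?(ltW st0)//; last exact: addr_ge0 (mulr_ge0 l0 xs) (mulr_ge0 l1' yt).
  apply: le_trans (ler_wpM2l (ltW stq) (powR_convex q1 xs yt l01)) _.
  by rewrite !powR_div// /a /b le_eqVlt; apply/orP; left; apply/eqP; ring.
have bF := bmeas_pow q1 HF z1; have bG := bmeas_pow q1 HG z1.
have baF := bmeasM (bmeas_cst 0 (2 * pi) a) bF.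
have bbG := bmeasM (bmeas_cst 0 (2 * pi) b) bG.
apply: (@le_trans _ _ (a * pow_integral q F z + b * pow_integral q G z)).
  rewrite /pow_integral -!RintegralZl//; try exact: bmeas_integrable.
  rewrite -RintegralD//; try exact: bmeas_integrable.
  apply: le_Rint; [exact: bmeas_pow (holD HF HG) z1|exact: bmeasD|].
  move=> x _; apply: le_trans (pt _ _ (modulus_ge0 _) (modulus_ge0 _)).
  by rewrite ge0_ler_powR ?nnegrE ?addr_ge0 ?modulus_ge0 ?modulusD//; lra.
apply: le_trans (lerD (ler_wpM2l a0 HFs) (ler_wpM2l b0 HGt)) _.
rewrite le_eqVlt; apply/orP; left; apply/eqP.
by rewrite /a /b; field; rewrite !gt_eqF.
Qed.

Lemma pow_integral_le_sup q F (z : C) (d : R) : 1 <= q -> hol F -> modulus z < 1 -> 0 <= d ->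
  (forall w, modulus w = modulus z -> modulus (F w) <= d) ->
  pow_integral q F z <= 2 * pi * d `^ q.
Proof.
move=> q1 HF z1 d0 H; have -> : 2 * pi * d `^ q = d `^ q * (2 * pi - 0) by ring.
rewrite -Rint_cst ?twopi_ge0//; apply: le_Rint; [exact: bmeas_pow|exact: bmeas_cst|].
move=> t _; rewrite ge0_ler_powR ?nnegrE ?modulus_ge0 ?H ?modulusM ?modulus_cis ?mul1r//; lra.
Qed.

Lemma hardy_leD p F G s t : (1 <= p)%E -> hol F -> hol G -> 0 < s -> 0 < t ->
  hardy_le p F s -> hardy_le p G t -> hardy_le p (fun z => F z + G z) (s + t).
Proof.
case: p => [q| |] //=.
- rewrite lee_fin => q1 HF HG s0 t0 H1 H2 r r01.
  by apply: minkowski_circle; rewrite ?real_lt1 ?H1 ?H2.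
- by move=> _ HF HG s0 t0 H1 H2 z z1; rewrite (le_trans (modulusD _ _))// lerD ?H1 ?H2.
Qed.

Lemma hardy_leZ p F s (a : C) : (1 <= p)%E -> hol F -> 0 <= s ->
  hardy_le p F s -> hardy_le p (fun z => a * F z) (modulus a * s).
Proof.
case: p => [q| |] //=.
- rewrite lee_fin => q1 HF s0 H r r01.
  have b := bmeas_pow q1 HF (real_lt1 r01).
  rewrite /pow_integral; under eq_Rintegral => x _ do rewrite modulusM powRM ?modulus_ge0//.
  rewrite RintegralZl//; last exact: bmeas_integrable.
  rewrite powRM ?modulus_ge0// mulrCA ler_wpM2l ?powR_ge0//; exact: H.
- by move=> _ HF s0 H z z1; rewrite modulusM ler_wpM2l ?modulus_ge0// H.
Qed.

Lemma hardy_le_mono p F s t : (1 <= p)%E -> 0 <= s -> s <= t -> hardy_le p F s -> hardy_le p F t.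
Proof.
case: p => [q| |] //=.
- rewrite lee_fin => q1 s0 st H r r01; apply: le_trans (H r r01) _.
  by rewrite ler_wpM2l ?twopi_ge0//; apply: ge0_ler_powR; rewrite ?nnegrE//; lra.
- by move=> _ s0 st H z z1; apply: le_trans (H z z1) st.
Qed.

Lemma hardy_le_mulz p F s : (1 <= p)%E -> hol F ->
  hardy_le p F s -> hardy_le p (fun z => z * F z) s.
Proof.
case: p => [q| |] //=.
- rewrite lee_fin => q1 HF H r r01; apply: le_trans (H r r01).
  apply: le_Rint; [exact: bmeas_pow (holM (@hol_id R) HF) (real_lt1 r01)|exact: bmeas_pow (real_lt1 r01)|].
  move=> t _; rewrite ge0_ler_powR ?nnegrE ?modulus_ge0//; first by lra.
  by rewrite modulusM ler_piMl ?modulus_ge0// modulusM modulus_cis mul1r ltW ?real_lt1.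
- by move=> _ HF H z z1; rewrite modulusM; apply: le_trans (H z z1); rewrite ler_piMl ?modulus_ge0// ltW.
Qed.

(** Means increase with the radius, so the division can be done on a circle of radius [rho] near 1,
    at the price of a factor [1 / rho] that the gap between [s] and [t] absorbs. *)
Lemma hardy_le_divz p F s t : (1 <= p)%E -> hol F -> 0 < s -> s < t ->
  hardy_le p (fun z => z * F z) s -> hardy_le p F t.
Proof.
move=> p1 HF s0 st; have t0 : 0 < t by lra.
have rho_ex (r : R) : r < 1 -> exists rho : R, [/\ 0 < rho, rho < 1, r <= rho & s / rho <= t].
  move=> r1; exists (Num.max r (s / t)).
  have st0 : 0 < s / t by rewrite divr_gt0.
  have m0 : 0 < Num.max r (s / t) by rewrite lt_max st0 orbT.
  split => //; rewrite ?le_max ?lexx//.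
    by rewrite gt_max r1 ltr_pdivrMr// mul1r.
  by rewrite ler_pdivrMr// mulrC -ler_pdivrMr// le_max lexx orbT.
case: p p1 => [q| |] //=.
- rewrite lee_fin => q1 H r /andP[r0 r1].
  have [rho [rho0 rho1 rr st']] := rho_ex r r1.
  apply: le_trans (pow_integral_mono q1 HF r0 rr rho1) _.
  have rho01 : 0 <= rho < 1 by rewrite ltW.
  have b := bmeas_pow q1 HF (real_lt1 rho01).
  have rq : 0 < rho `^ q by rewrite powR_gt0.
  have := H rho rho01.
  rewrite /pow_integral; under eq_Rintegral => x _ do
    rewrite modulusM modulusM modulus_cis mul1r ger0_modulus ?(ltW rho0)// powRM ?modulus_ge0 ?(ltW rho0)//.
  rewrite RintegralZl//; last exact: bmeas_integrable.
  rewrite mulrC -ler_pdivlMr// => /le_trans; apply.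
  have -> : 2 * pi * s `^ q / rho `^ q = 2 * pi * (s / rho) `^ q.
    by rewrite powR_div ?(ltW s0)// mulrA.
  by rewrite ler_wpM2l ?twopi_ge0// ge0_ler_powR ?nnegrE ?divr_ge0 ?(ltW t0) ?(ltW s0) ?(ltW rho0)//; lra.
- move=> _ H z z1; have [rho [rho0 rho1 rr st']] := rho_ex _ z1.
  apply: (hol_mp HF (_ : 0 < rho < 1)) rr; first by rewrite rho0.
  move=> w wr; apply: le_trans st'; rewrite ler_pdivlMr// mulrC -{1}wr -modulusM H// wr//.
Qed.

(** For finite [p], with [rho = (1 + r) / 2], the factor from [point_evaluation] is at most
    [2 / (1 - r)], and [pow_integral1_le] contributes 4. *)
Lemma hardy_le_point p F s (r : R) (a : C) : (1 <= p)%E -> hol F -> 0 < s -> hardy_le p F s ->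
  modulus a <= r -> r < 1 -> modulus (F a) <= 8 / (1 - r) * s.
Proof.
move=> p1 HF s0 H ar r1; have a0 := modulus_ge0 a.
have r0 : 0 < 1 - r by rewrite subr_gt0.
case: p p1 H => [q| |] //=.
- rewrite lee_fin => q1 H; pose rho := (1 + r) / 2.
  have [arho rho1 rho0] : [/\ modulus a < rho, rho < 1 & 0 <= rho] by rewrite /rho; split; lra.
  have rho01 : 0 <= rho < 1 by rewrite rho0.
  have := pow_integral1_le q1 HF (real_lt1 rho01) s0 (H rho rho01).
  have rd : 0 < rho - modulus a by rewrite subr_gt0.
  have K0 : 0 <= rho / (rho - modulus a) by rewrite divr_ge0// ltW.
  move=> /(ler_wpM2l K0) /(le_trans (point_evaluation HF arho rho1)) K.
  have pi0 : 0 < pi :> R := pi_gt0 R.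
  rewrite -(ler_pM2r pi0); apply: le_trans K _.
  have -> : rho / (rho - modulus a) * (4 * pi * s) = 4 * (rho / (rho - modulus a)) * s * pi by ring.
  rewrite ler_pM2r// ler_pM2r//.
  rewrite mulrA ler_pdivrMr// mulrAC ler_pdivlMr//.
  have h : 4 * (1 - r) <= 8 * (rho - modulus a) by rewrite /rho; lra.
  have : 4 * rho * (1 - r) <= 4 * (1 - r).
    by rewrite ler_wpM2r ?(ltW r0)//; lra.
  by lra.
- move=> _ H; apply: le_trans (H a _) _; first by exact: le_lt_trans ar r1.
  rewrite ler_peMl ?(ltW s0)// ler_pdivlMr//; lra.
Qed.

(** On each circle [F] is [f n] plus a remainder of size at most [t - s], and Minkowski's inequality
    adds the two. As [n] may depend on the circle, locally uniform convergence suffices. *)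
Lemma hardy_le_lim p (f : nat -> C -> C) F s t : (1 <= p)%E -> (forall n, hol (f n)) -> hol F ->
  0 < s -> s < t ->
  (forall rho : R, rho < 1 -> forall e : R, 0 < e -> exists N, forall n, (N <= n)%N ->
     forall z, modulus z <= rho -> modulus (f n z - F z) <= e) ->
  (exists N, forall n, (N <= n)%N -> hardy_le p (f n) s) -> hardy_le p F t.
Proof.
move=> p1 Hf HF s0 st Hu [N1 HN1]; have d0 : 0 < t - s by rewrite subr_gt0.
have tE : t = s + (t - s) by rewrite addrC subrK.
have main (r : R) : r < 1 -> exists n, hardy_le p (f n) s /\
   forall z, modulus z <= r -> modulus (F z - f n z) <= t - s.
  move=> r1; have [N2 HN2] := Hu r r1 _ d0; exists (maxn N1 N2).
  split; first by apply: HN1; rewrite leq_maxl.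
  by move=> z zr; rewrite modulusC; apply: HN2; rewrite ?leq_maxr.
case: p p1 {HN1} main => [q| |] //=.
- rewrite lee_fin => q1 main r r01; have /andP[r0 r1] := r01; have [n [h1 h2]] := main r r1.
  have := @minkowski_circle q (f n) (fun z => F z - f n z) r%:C s (t - s) q1 (Hf n) (holB HF (Hf n))
    (real_lt1 r01) s0 d0 (h1 r r01).
  rewrite -tE => K.
  have -> : pow_integral q F r%:C = pow_integral q (fun w => f n w + (F w - f n w)) r%:C.
    by apply: eq_Rintegral => x _; rewrite addrC subrK.
  apply: K; apply: pow_integral_le_sup => //; [exact: holB|exact: real_lt1|exact: ltW|].
  by move=> w; rewrite ger0_modulus// => wr; apply: h2; rewrite wr.
- move=> _ main z z1; have [n [h1 h2]] := main _ z1.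
  rewrite (_ : F z = f n z + (F z - f n z)); last by ring.
  by apply: le_trans (modulusD _ _) _; rewrite tE lerD// ?h1 ?h2.
Qed.

End HardyBound.

(** * Norm properties of the Hardy norms on the disc *)

Section Hardy.
Context {R : realType}.
Local Notation C := (R[i]).
Local Notation mu := (@lebesgue_measure R).
Implicit Types (f g : disk R -> C) (F G : C -> C) (p : \bar R).

Lemma disk_modulus (z : disk R) : modulus (val z) < 1.
Proof. by rewrite -normc_lt1; exact: valP z. Qed.

Lemma ext0_val f (z : disk R) : ext0 f (val z) = f z.
Proof. by rewrite /ext0 valK. Qed.

Definition to_disk F : disk R -> C := fun z => F (val z).

Lemma ext0_to_disk F z : modulus z < 1 -> ext0 (to_disk F) z = F z.
Proof.
by move=> z1; rewrite /ext0 /to_disk insubT ?normc_lt1//=.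
Qed.

Lemma ext0D f g z : ext0 (f + g) z = ext0 f z + ext0 g z.
Proof. by rewrite /ext0; case: insub => //=; rewrite addr0. Qed.

Lemma ext0B f g z : ext0 (f - g) z = ext0 f z - ext0 g z.
Proof. by rewrite /ext0; case: insub => //=; rewrite subr0. Qed.

Lemma HDP f : HD f <-> hol (ext0 f).
Proof.
split=> H.
  move=> z z1; have z1' : `|z| < 1 by rewrite normc_lt1.
  by have := H (Sub z z1'); move=> /diff_ptP.
by move=> z; apply/diff_ptP/H; exact: disk_modulus.
Qed.

Lemma HD_to_disk F : hol F -> HD (to_disk F).
Proof.
by move=> HF; apply/HDP; apply: hol_near HF => z z1; rewrite ext0_to_disk.
Qed.

Lemma integral_meanE (q : R) f (r : R) : 1 <= q -> HD f -> 0 <= r < 1 ->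
  integral_mean q f r =
  (((2 * pi)^-1 * pow_integral q (ext0 f) r%:C) `^ q^-1)%:E.
Proof.
move=> q1 /HDP Hf r01; rewrite /integral_mean.
have b := bmeas_pow q1 Hf (real_lt1 r01).
have -> : (\int[mu]_(t in `[0%R, (2 * pi)%R])
      ((modulus (ext0 f (circle_point r t)) `^ q)%R)%:E)%E =
   (pow_integral q (ext0 f) r%:C)%:E.
  rewrite /pow_integral /Rintegral fineK.
    by apply: eq_integral => t _; rewrite circle_pointE.
  by apply: integrable_fin_num => //; exact: bmeas_integrable.
by rewrite -EFinM poweR_EFin.
Qed.

Lemma hardy_normP p f (s : R) : (1 <= p)%E -> HD f -> 0 <= s ->
  (hardy_norm p f <= s%:E)%E <-> hardy_le p (ext0 f) s.
Proof.
case: p => [q| |] //=.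
- rewrite lee_fin => q1 Hf s0; have q0 : 0 < q by lra.
  have key (r : R) : 0 <= r < 1 ->
      (integral_mean q f r <= s%:E)%E = (pow_integral q (ext0 f) r%:C <= 2 * pi * s `^ q).
    move=> r01; rewrite integral_meanE// lee_fin.
    set x := (2 * pi)^-1 * _.
    have x0 : 0 <= x by rewrite mulr_ge0 ?invr_ge0 ?twopi_ge0 ?pow_integral_ge0.
    have -> : (pow_integral q (ext0 f) r%:C <= 2 * pi * s `^ q) = (x <= s `^ q).
      by rewrite /x ler_pdivrMl ?twopi_gt0.
    apply/idP/idP => H.
      have : (x `^ q^-1) `^ q <= s `^ q.
        by rewrite ge0_ler_powR ?nnegrE ?powR_ge0 ?(ltW q0).
      by rewrite -powRrM mulVf ?gt_eqF// powRr1.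
    have : x `^ q^-1 <= (s `^ q) `^ q^-1.
      by rewrite ge0_ler_powR ?nnegrE ?powR_ge0 ?invr_ge0 ?(ltW q0).
    by rewrite -powRrM mulfV ?gt_eqF// powRr1.
  split=> [H r r01|H].
    rewrite -key//; apply: le_trans H; apply: ereal_sup_ubound.
    by exists r => //=; rewrite in_itv.
  apply: ge_ereal_sup => _ [r rr <-]; move: rr; rewrite /= in_itv /= => r01.
  by rewrite key//; exact: H.
- move=> _ Hf s0; split=> [H z z1|H].
    have z1' : `|z| < 1 by rewrite normc_lt1.
    rewrite -lee_fin; apply: le_trans H; apply: ereal_sup_ubound.
    by exists (Sub z z1' : disk R) => //; rewrite -ext0_val SubK.
  apply: ge_ereal_sup => _ [z _ <-]; rewrite lee_fin -ext0_val; apply: H.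
  exact: disk_modulus.
Qed.

Lemma hardy_norm_ge0 p f : (1 <= p)%E -> (0 <= hardy_norm p f)%E.
Proof.
case: p => [q| |] //= _.
  apply: le_ereal_sup_tmp; exists (integral_mean q f 0); last exact: poweR_ge0.
  by exists 0 => //=; rewrite in_itv /= lexx ltr01.
have z0 : `|0 : C| < 1 by rewrite normr0.
apply: le_ereal_sup_tmp; exists ((modulus (f (Sub 0 z0)))%:E); last first.
  by rewrite lee_fin modulus_ge0.
by exists (Sub 0 z0).
Qed.

Lemma ereal_le_eps (N : \bar R) (x : R) :
  (forall e : R, 0 < e -> (N <= (x + e)%:E)%E) -> (N <= x%:E)%E.
Proof. by move=> H; apply/lee_addgt0Pr => e e0; rewrite -EFinD; exact: H. Qed.

Lemma ereal_scale_eq (k : R) (N M : \bar R) : 0 < k ->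
  (N <= k%:E * M)%E -> (M <= k^-1%:E * N)%E -> N = (k%:E * M)%E.
Proof.
move=> k0 h1 h2; apply/eqP; rewrite eq_le h1 /=.
have k0' : (0 <= k%:E)%E by rewrite lee_fin ltW.
have := lee_wpmul2l k0' h2; rewrite muleA -EFinM divff ?mul1e//; exact: lt0r_neq0.
Qed.

(** Turns estimates that lose an arbitrarily small amount, from [s] to [t], into sharp comparisons;
    [N = +oo] is trivial. *)
Lemma le_hardy_norm p f (N : \bar R) : (0 <= N)%E ->
  (forall s t : R, 0 < s -> s < t -> (N <= s%:E)%E -> (hardy_norm p f <= t%:E)%E) ->
  (hardy_norm p f <= N)%E.
Proof.
case: N => [x| |] // x0 H; last by rewrite leey.
rewrite lee_fin in x0; apply: ereal_le_eps => e e0.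
by apply: (H (x + e / 2)); rewrite ?lee_fin; lra.
Qed.

Lemma HDD f g : HD f -> HD g -> HD (f + g).
Proof.
by move=> /HDP Hf /HDP Hg; apply/HDP/(hol_near _ (holD Hf Hg)) => z _; rewrite ext0D.
Qed.

Lemma HDB f g : HD f -> HD g -> HD (f - g).
Proof.
by move=> /HDP Hf /HDP Hg; apply/HDP/(hol_near _ (holB Hf Hg)) => z _; rewrite ext0B.
Qed.

Lemma hardy_normD p f g : (1 <= p)%E -> HD f -> HD g ->
  (hardy_norm p (f + g)%R <= hardy_norm p f + hardy_norm p g)%E.
Proof.
move=> p1 Hf Hg; have Nf := hardy_norm_ge0 f p1; have Ng := hardy_norm_ge0 g p1.
have Hfg := HDD Hf Hg.
move Ef : (hardy_norm p f) Nf => a Nf; move Eg : (hardy_norm p g) Ng => b Ng.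
case: a Ef Nf => [x| |] Ef // x0; case: b Eg Ng => [y| |] Eg // y0; try exact: leey.
rewrite lee_fin in x0; rewrite lee_fin in y0.
rewrite -EFinD; apply: ereal_le_eps => e e0.
have xe : 0 < x + e / 2 by lra.
have ye : 0 < y + e / 2 by lra.
have xye : 0 <= x + y + e by lra.
have h1 : hardy_le p (ext0 f) (x + e / 2).
  by apply: (hardy_normP p1 Hf (ltW xe)).1; rewrite Ef lee_fin; lra.
have h2 : hardy_le p (ext0 g) (y + e / 2).
  by apply: (hardy_normP p1 Hg (ltW ye)).1; rewrite Eg lee_fin; lra.
apply: (hardy_normP p1 Hfg xye).2.
have -> : x + y + e = (x + e / 2) + (y + e / 2) by field.
have := hardy_leD p1 (proj1 (HDP f) Hf) (proj1 (HDP g) Hg) xe ye h1 h2.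
by apply: eq_hardy_le => z _; rewrite ext0D.
Qed.

(** Convertible to [a *: f] in [disk R -> R[i]^o], the module in which the Banach space is
    stated. *)
Definition scale (a : C) f : disk R -> C := fun z => a * f z.

Lemma ext0Z (a : C) f z : ext0 (scale a f) z = a * ext0 f z.
Proof. by rewrite /ext0; case: insub => //=; rewrite mulr0. Qed.

Lemma HDZ (a : C) f : HD f -> HD (scale a f).
Proof.
by move=> /HDP Hf; apply/HDP/(hol_near _ (holM (hol_cst a) Hf)) => z _; rewrite ext0Z.
Qed.

Lemma hardy_normZ_le p (a : C) f : (1 <= p)%E -> HD f -> a != 0 ->
  (hardy_norm p (scale a f) <= (modulus a)%:E * hardy_norm p f)%E.
Proof.
move=> p1 Hf a0; have ma : 0 < modulus a by rewrite modulus_gt0.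
have Nf := hardy_norm_ge0 f p1.
move Ef : (hardy_norm p f) Nf => b Nf; case: b Ef Nf => [x| |] Ef // x0; last first.
  by rewrite gt0_muley ?lte_fin// leey.
rewrite lee_fin in x0; rewrite -EFinM; apply: ereal_le_eps => e e0.
have ea : 0 < e / modulus a by rewrite divr_gt0.
have xe : 0 < x + e / modulus a by lra.
have h1 : hardy_le p (ext0 f) (x + e / modulus a).
  by apply: (hardy_normP p1 Hf (ltW xe)).1; rewrite Ef lee_fin lerDl ltW.
have -> : modulus a * x + e = modulus a * (x + e / modulus a).
  by field; rewrite gt_eqF.
have axe : 0 <= modulus a * (x + e / modulus a) by rewrite mulr_ge0 ?modulus_ge0 ?(ltW xe).
apply: (hardy_normP p1 (@HDZ a f Hf) axe).2.
have := hardy_leZ a p1 (proj1 (HDP f) Hf) (ltW xe) h1.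
by apply: eq_hardy_le => z _; rewrite ext0Z.
Qed.

Lemma hardy_norm0 p f : (1 <= p)%E -> HD f -> (forall z, f z = 0) -> hardy_norm p f = 0%E.
Proof.
move=> p1 Hf f0; apply/eqP; rewrite eq_le hardy_norm_ge0// andbT.
apply: ereal_le_eps => e e0; rewrite add0r; apply: (hardy_normP p1 Hf (ltW e0)).2.
have E z : ext0 f z = 0 by rewrite /ext0; case: insub.
case: (p) p1 => [q| |] //=; last by move=> _ z _; rewrite E modulus0 ltW.
rewrite lee_fin => q1 r r01.
apply: pow_integral_le_sup; rewrite ?real_lt1 ?(ltW e0)//; first exact/HDP.
by move=> w _; rewrite E modulus0 ltW.
Qed.

Lemma hardy_normZ p (a : C) f : (1 <= p)%E -> HD f ->
  hardy_norm p (scale a f) = ((modulus a)%:E * hardy_norm p f)%E.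
Proof.
move=> p1 Hf; have [->|a0] := eqVneq a 0.
  have E z : scale 0 f z = 0 by rewrite /scale mul0r.
  by rewrite (hardy_norm0 p1 (@HDZ 0 f Hf) E) modulus0 mul0e.
have ma : 0 < modulus a by rewrite modulus_gt0.
(* The opposite inequality is the first one for the scalar [a^-1] and the function [scale a f]. *)
apply: ereal_scale_eq => //; first exact: hardy_normZ_le.
rewrite -modulusV.
have := hardy_normZ_le p1 (@HDZ a f Hf) (invr_neq0 a0).
by rewrite (_ : scale a^-1 (scale a f) = f)//; apply/funext => z; rewrite /scale mulrA mulVf// mul1r.
Qed.

End Hardy.

(** * The Volterra and Cesaro operators *)

Section Operators.
Context {R : realType}.
Local Notation C := (R[i]).
Implicit Types (f g : disk R -> C) (F G h : C -> C) (p : \bar R).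

Lemma ray_mean_lin (a b : C) h h1 h2 z : hol h1 -> hol h2 -> modulus z < 1 ->
  (forall w, h w = a * h1 w + b * h2 w) ->
  ray_mean h z = a * ray_mean h1 z + b * ray_mean h2 z.
Proof.
move=> H1 H2 z1 E.
have ray k : hol k -> bmeasC 0 1 (fun t : R => 1 * k (t%:C * z)).
  move=> Hk; apply: bmeasCM; first exact: bmeasC_cst.
  by apply: bmeasC_path => //; [exact: continuousC_real|exact: unit_ray].
have ca := bmeasC_cst 0 1 a; have cb := bmeasC_cst 0 1 b.
rewrite /ray_mean /param_integral -(CintZ _ (ray _ H1)) -(CintZ _ (ray _ H2)).
rewrite -(CintD (bmeasCM ca (ray _ H1)) (bmeasCM cb (ray _ H2))).
by apply: eq_Cint => t _; rewrite E; ring.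
Qed.

Lemma ray_mean_le h z (rho M : R) : hol h -> modulus z <= rho -> rho < 1 ->
  (forall w, modulus w <= rho -> modulus (h w) <= M) -> modulus (ray_mean h z) <= M.
Proof.
move=> Hh zr r1 HM; have z1 := le_lt_trans zr r1.
have -> : M = M * (1 - 0) by rewrite subr0 mulr1.
apply: modulus_Cint_le => // [|t t01].
  apply: bmeasCM; first exact: bmeasC_cst.
  by apply: bmeasC_path => //; [exact: continuousC_real|exact: unit_ray].
rewrite mul1r; apply: HM; rewrite modulusM; apply: le_trans zr.
by rewrite ler_piMl ?modulus_ge0//; exact: unit_ray.
Qed.

Definition integrand g f (xi : C) : C := ext0 f xi * cderiv g xi.

Lemma cderivE g z : cderiv g z = cder (ext0 g) z.
Proof. by rewrite /cderiv /cder (projT2 cder_spec). Qed.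

Lemma hol_cderiv g : HD g -> hol (cderiv g).
Proof. by move=> /HDP/hol_cder; apply: hol_near => z _; rewrite cderivE. Qed.

Lemma hol_integrand g f : HD g -> HD f -> hol (integrand g f).
Proof. by move=> Hg /HDP Hf; apply: holM => //; exact: hol_cderiv. Qed.

Lemma VolterraE g f : HD g -> HD f ->
  Volterra g f = to_disk (fun z => z * ray_mean (integrand g f) z).
Proof.
move=> Hg Hf; apply/funext => z; rewrite /Volterra /to_disk -segment_integralE//.
  exact: hol_integrand.
exact: disk_modulus.
Qed.

(** At 0 the average along the ray is the value of the integrand, which is the one prescribed by
    [Cesaro]; the case distinction thus disappears. *)
Lemma CesaroE g f : HD g -> HD f -> Cesaro g f = to_disk (ray_mean (integrand g f)).
Proof.
move=> Hg Hf; apply/funext => z; rewrite /Cesaro /to_disk.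
have [z0|z0] := eqVneq (val z) 0.
  by rewrite -(ext0_val f z) z0 ray_mean0.
rewrite -/(integrand g f) segment_integralE ?mulKf//; first exact: hol_integrand.
exact: disk_modulus.
Qed.

Lemma HD_Cesaro g f : HD g -> HD f -> HD (Cesaro g f).
Proof.
move=> Hg Hf; rewrite (CesaroE Hg Hf).
exact: (HD_to_disk (hol_ray_mean (hol_integrand Hg Hf))).
Qed.

Lemma HD_Volterra g f : HD g -> HD f -> HD (Volterra g f).
Proof.
move=> Hg Hf; rewrite (VolterraE Hg Hf).
exact: (HD_to_disk (holM (@hol_id R) (hol_ray_mean (hol_integrand Hg Hf)))).
Qed.

Lemma hardy_norm_to_diskP p F (s : R) : (1 <= p)%E -> hol F -> 0 <= s ->
  (hardy_norm p (to_disk F) <= s%:E)%E <-> hardy_le p F s.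
Proof.
move=> p1 HF s0; rewrite hardy_normP//; last exact: HD_to_disk.
by split; apply: eq_hardy_le => z z1; rewrite ext0_to_disk.
Qed.

Lemma hardy_norm_mulz p F : (1 <= p)%E -> hol F ->
  hardy_norm p (to_disk (fun z => z * F z)) = hardy_norm p (to_disk F).
Proof.
move=> p1 HF; have HzF : hol (fun z => z * F z) by apply: holM => //; exact: hol_id.
apply/eqP; rewrite eq_le; apply/andP; split; apply: le_hardy_norm; try exact: hardy_norm_ge0.
- move=> s t s0 st H; have t0 := lt_trans s0 st.
  apply: (hardy_norm_to_diskP p1 HzF (ltW t0)).2.
  apply: (hardy_le_mono p1 (ltW s0) (ltW st)); apply: (hardy_le_mulz p1 HF).
  exact: (hardy_norm_to_diskP p1 HF (ltW s0)).1 H.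
- move=> s t s0 st H; have t0 := lt_trans s0 st.
  apply: (hardy_norm_to_diskP p1 HF (ltW t0)).2; apply: (hardy_le_divz p1 HF s0 st).
  exact: (hardy_norm_to_diskP p1 HzF (ltW s0)).1 H.
Qed.

Lemma Volterra_Cesaro_norm p g f : (1 <= p)%E -> HD g -> HD f ->
  hardy_norm p (Volterra g f) = hardy_norm p (Cesaro g f).
Proof.
move=> p1 Hg Hf; rewrite (VolterraE Hg Hf) (CesaroE Hg Hf).
exact: (hardy_norm_mulz p1 (hol_ray_mean (hol_integrand Hg Hf))).
Qed.

(** Phrased on the extensions by zero, so that sums, differences and multiples are all instances. *)
Lemma Cesaro_lin g f f1 f2 (a b : C) : HD g -> HD f -> HD f1 -> HD f2 ->
  (forall w, ext0 f w = a * ext0 f1 w + b * ext0 f2 w) ->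
  forall z, Cesaro g f z = a * Cesaro g f1 z + b * Cesaro g f2 z.
Proof.
move=> Hg Hf H1 H2 E z; rewrite (CesaroE Hg Hf) (CesaroE Hg H1) (CesaroE Hg H2).
apply: (ray_mean_lin (hol_integrand Hg H1) (hol_integrand Hg H2) (disk_modulus z)).
by move=> w; rewrite /integrand E; ring.
Qed.

Lemma CesaroD g f1 f2 : HD g -> HD f1 -> HD f2 ->
  Cesaro g (f1 + f2) = Cesaro g f1 + Cesaro g f2.
Proof.
move=> Hg H1 H2; apply/funext => z.
have E w : ext0 (f1 + f2) w = 1 * ext0 f1 w + 1 * ext0 f2 w by rewrite ext0D !mul1r.
exact: etrans (Cesaro_lin Hg (HDD H1 H2) H1 H2 E z) (congr2 _ (mul1r _) (mul1r _)).
Qed.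

Lemma CesaroB g f1 f2 : HD g -> HD f1 -> HD f2 ->
  Cesaro g (f1 - f2) = Cesaro g f1 - Cesaro g f2.
Proof.
move=> Hg H1 H2; apply/funext => z.
have E w : ext0 (f1 - f2) w = 1 * ext0 f1 w + -1 * ext0 f2 w.
  by rewrite ext0B mul1r mulN1r.
by rewrite (Cesaro_lin Hg (HDB H1 H2) H1 H2 E z) mul1r mulN1r.
Qed.

Lemma CesaroZ g f (a : C) : HD g -> HD f -> Cesaro g (scale a f) = scale a (Cesaro g f).
Proof.
move=> Hg Hf; apply/funext => z.
have E w : ext0 (scale a f) w = a * ext0 f w + 0 * ext0 f w.
  by rewrite ext0Z mul0r addr0.
by rewrite (Cesaro_lin Hg (@HDZ _ a f Hf) Hf Hf E z) mul0r addr0.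
Qed.

Lemma nonconstant_deriv g : HD g -> (exists z w, g z <> g w) ->
  exists2 z, modulus z < 1 & cderiv g z != 0.
Proof.
move=> /HDP Hg [z [w zw]]; apply: contrapT => N; apply: zw.
have H v : modulus v < 1 -> cder (ext0 g) v = 0.
  by move=> v1; apply/eqP/negPn/negP => nz; apply: N; exists v; rewrite // cderivE.
have K := cder0_constant Hg H.
by rewrite -(ext0_val g z) -(ext0_val g w) (K _ (disk_modulus z)) (K _ (disk_modulus w)).
Qed.

(* On a circle free of zeros of [g'], [f = (V_g f)' / g'] is controlled by the
   norm of [V_g f]; the maximum principle extends the bound to the disc. *)
Lemma optimal_point_evaluation p g (r : R) : (1 <= p)%E -> HD g ->
  (exists z w, g z <> g w) -> r < 1 ->
  exists2 K : R, 0 < K & forall f (s : R), HD f -> 0 < s ->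
    (hardy_norm p (Cesaro g f) <= s%:E)%E ->
    forall z, modulus z <= r -> modulus (ext0 f z) <= K * s.
Proof.
move=> p1 Hg gnc r1; have HG := hol_cderiv Hg.
have r01 : 0 <= Num.max r 0 < 1 by rewrite le_max lexx orbT gt_max r1 ltr01.
have [r0 /andP[rr0 r01'] G0] := zero_free_circle HG (nonconstant_deriv Hg gnc) r01.
have rr : r < r0 by apply: le_lt_trans rr0; rewrite le_max lexx.
have r00 : 0 < r0 by apply: le_lt_trans rr0; rewrite le_max lexx orbT.
(* Writing the circle as a closed disc met with the outside of an open one gives its compactness,
   hence a positive minimum for [g']. *)
have [m m0 Hm] : exists2 m : R, 0 < m & forall z, modulus (z - 0) <= r0 /\ r0 <= modulus (z - 0) ->
    m <= modulus (cderiv g z).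
  apply: (@lower_plane _ _ _ r0) => [z []|||]; first by rewrite subr0.
  - by apply: closed_planeI; [exact: closed_plane_disc|exact: closed_plane_codisc].
  - by move=> z []; rewrite subr0 => zr _; apply: hol_continuous => //; exact: le_lt_trans zr r01'.
  - by move=> z; rewrite subr0 => -[z1 z2]; apply: G0; apply/eqP; rewrite eq_le z1.
pose rho := (1 + r0) / 2.
have [rrho rho1 rho0] : [/\ r0 < rho, rho < 1 & 0 < rho] by rewrite /rho; split; lra.
have D1 : 0 < 1 - rho by rewrite subr_gt0.
have D2 : 0 < rho - r0 by rewrite subr_gt0.
(* Three losses: point evaluation at radius [rho], the Cauchy estimate from [rho] down to [r0], and
   division by the minimum [m] of [g']. *)
pose K := 2 * (8 / (1 - rho)) / (rho - r0) / m.
have K0 : 0 < K.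
  have h8 : 0 < 8 / (1 - rho) by rewrite divr_gt0.
  have h16 : 0 < 2 * (8 / (1 - rho)) by rewrite mulr_gt0.
  exact: (divr_gt0 (divr_gt0 h16 D2) m0).
exists K => //.
move=> f s Hf s0; have Hi := hol_integrand Hg Hf.
have HU := hol_ray_mean Hi.
rewrite (CesaroE Hg Hf) => H z zr.
have Hs := (hardy_norm_to_diskP p1 HU (ltW s0)).1 H.
set U := ray_mean (integrand g f) in HU Hs.
have HW : hol (fun w => w * U w) by apply: holM => //; exact: hol_id.
have Wb w : modulus w = rho -> modulus (w * U w) <= 8 / (1 - rho) * s.
  move=> wr; apply: le_trans (hardy_le_point p1 HU s0 Hs (eq_leC wr) rho1).
  by rewrite modulusM ler_piMl ?modulus_ge0// wr ltW.
have rho01 : 0 < rho < 1 by rewrite rho0.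
apply: (hol_mp (proj1 (HDP f) Hf) (_ : 0 < r0 < 1)) (ltW (le_lt_trans zr rr)); first by rewrite r00.
move=> w wr; have w1 : modulus w < 1 by rewrite wr.
have [+ _] := cauchy_estimates HW rho01 rrho Wb (eq_leC wr).
rewrite (cderE (ray_mean_primitive Hi w1)) /integrand modulusM => Hc.
have mw : m <= modulus (cderiv g w) by apply: Hm; rewrite subr0 wr.
have E : K * s = 2 * (8 / (1 - rho) * s) / (rho - r0) / m by rewrite /K; ring.
rewrite E ler_pdivlMr//; apply: le_trans Hc.
by rewrite ler_wpM2l ?modulus_ge0.
Qed.

Lemma uniform_cauchy_limit (f : nat -> C -> C) :
  (forall rho : R, rho < 1 -> forall e : R, 0 < e -> exists N, forall m n, (N <= m)%N -> (N <= n)%N ->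
     forall z, modulus z <= rho -> modulus (f m z - f n z) <= e) ->
  exists F, forall rho : R, rho < 1 -> forall e : R, 0 < e -> exists N, forall n, (N <= n)%N ->
     forall z, modulus z <= rho -> modulus (f n z - F z) <= e.
Proof.
move=> H.
have lim z : exists l, modulus z < 1 -> forall e : R, 0 < e -> exists N, forall n, (N <= n)%N ->
    modulus (f n z - l) < e.
  have [z1|] := pselect (modulus z < 1); last by exists 0.
  have [|l Hl] := @cauchy_seqC R (fun n => f n z); last by exists l.
  move=> e e0; have e2 : 0 < e / 2 by rewrite divr_gt0.
  have [N HN] := H _ z1 _ e2; exists N => m n mN nN.
  by apply: le_lt_trans (HN m n mN nN z (lexx _)) _; lra.
pose F z := projT1 (cid (lim z)).
have FP z : modulus z < 1 -> forall e : R, 0 < e -> exists N, forall n, (N <= n)%N ->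
    modulus (f n z - F z) < e by rewrite /F; case: cid.
exists F => rho r1 e e0; have [N HN] := H rho r1 e e0; exists N => n nN z zr.
apply/ler_addgt0Pl => d d0; have [N' HN'] := FP z (le_lt_trans zr r1) d d0.
have h1 := HN n (maxn N N') nN (leq_maxl _ _) z zr.
have h2 := HN' (maxn N N') (leq_maxr _ _).
by apply: le_trans (modulus_triangle (f (maxn N N') z) _ _) _; lra.
Qed.

Lemma ereal_cvg0 (x : nat -> \bar R) : (forall n, (0 <= x n)%E) ->
  (forall e : R, 0 < e -> exists N, forall n, (N <= n)%N -> (x n <= e%:E)%E) ->
  x n @[n --> \oo] --> 0%E.
Proof.
move=> x0 H; apply/fine_cvgP; split.
  have [N HN] := H 1 ltr01; exists N => // n /HN xn.
  by rewrite ge0_fin_numE// (le_lt_trans xn)// ltry.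
apply/cvgrPdist_le => e e0; have [N HN] := H e e0; exists N => // n /HN xn /=.
rewrite sub0r normrN ger0_norm ?fine_ge0// -lee_fin fineK//.
by rewrite ge0_fin_numE// (le_lt_trans xn)// ltry.
Qed.

Lemma optimal_complete p g (u : nat -> disk R -> C) : (1 <= p)%E -> HD g ->
  (exists z w, g z <> g w) -> (forall n, HD (u n)) ->
  (forall n, (hardy_norm p (Cesaro g (u n)) < +oo)%E) ->
  (forall e : R, 0 < e -> exists n0 : nat, forall m n : nat,
    (n0 <= m)%N -> (n0 <= n)%N -> (hardy_norm p (Cesaro g (u m - u n)%R) < e%:E)%E) ->
  exists2 l, HD l /\ (hardy_norm p (Cesaro g l) < +oo)%E &
    hardy_norm p (Cesaro g (u n - l)%R) @[n --> \oo] --> 0%E.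
Proof.
move=> p1 Hg gnc Hu Nu Cu.
have [|F HF] := @uniform_cauchy_limit (fun n => ext0 (u n)).
  move=> rho r1 e e0; have [K K0 HK] := optimal_point_evaluation p1 Hg gnc r1.
  have eK : 0 < e / K by rewrite divr_gt0.
  have [N HN] := Cu _ eK; exists N => m n mN nN z zr.
  have := HK _ _ (HDB (Hu m) (Hu n)) eK (ltW (HN m n mN nN)) z zr.
  by rewrite ext0B mulrC divfK// gt_eqF.
have hF : hol F by apply: weierstrass HF => n; exact: (proj1 (HDP _) (Hu n)).
pose l := to_disk F; have Hl : HD l by exact: HD_to_disk.
pose U f := ray_mean (integrand g f).
have HU f (Hf : HD f) : hol (U f) := hol_ray_mean (hol_integrand Hg Hf).
have UB f1 f2 z : HD f1 -> HD f2 -> modulus z < 1 -> U (f1 - f2) z = U f1 z - U f2 z.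
  move=> H1 H2 z1.
  have E w : integrand g (f1 - f2) w = 1 * integrand g f1 w + -1 * integrand g f2 w.
    by rewrite /integrand ext0B; ring.
  by rewrite /U (ray_mean_lin (hol_integrand Hg H1) (hol_integrand Hg H2) z1 E) mul1r mulN1r.
(* [g'] is bounded on smaller discs, and averaging along rays does not increase suprema over
   them. *)
have Ulim (rho : R) : rho < 1 -> forall e : R, 0 < e -> exists N, forall n, (N <= n)%N ->
    forall z, modulus z <= rho -> modulus (U (u n) z - U l z) <= e.
  move=> r1 e e0; have [M M0 HM] := hol_bounded (hol_cderiv Hg) r1.
  have M1 : 0 < M + 1 by lra.
  have eM : 0 < e / (M + 1) by rewrite divr_gt0.
  have [N HN] := HF rho r1 _ eM; exists N => n nN z zr.
  rewrite -(UB _ _ _ (Hu n) Hl (le_lt_trans zr r1)).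
  apply: (ray_mean_le (hol_integrand Hg (HDB (Hu n) Hl)) zr r1) => w wr.
  have w1 := le_lt_trans wr r1.
  rewrite /integrand modulusM ext0B (ext0_to_disk _ w1).
  have := HN n nN w wr; rewrite ler_pdivlMr// => h1.
  have := HM w wr; have := modulus_ge0 (ext0 (u n) w - F w).
  by move: h1; clear; nra.
have small (e : R) : 0 < e -> exists N, forall n, (N <= n)%N ->
    (hardy_norm p (Cesaro g (u n - l)%R) <= e%:E)%E.
  move=> e0; have e2 : 0 < e / 2 by rewrite divr_gt0.
  have [N HN] := Cu _ e2; exists N => n nN.
  have Hd := HDB (Hu n) Hl.
  rewrite (CesaroE Hg Hd); apply: (hardy_norm_to_diskP p1 (HU _ Hd) (ltW e0)).2.
  (* The limit is in [m], with [n] fixed: [U (u n - u m)] has norm at most [e / 2] for large [m] and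
     tends locally uniformly to [U (u n - l)]. *)
  apply: (@hardy_le_lim R p (fun m => U (u n - u m)) _ (e / 2) e).
  - exact: p1.
  - by move=> m; exact: (HU _ (HDB (Hu n) (Hu m))).
  - exact: (HU _ Hd).
  - exact: e2.
  - by clear -e0; lra.
  - move=> rho r1 d d0; have [N' HN'] := Ulim rho r1 d d0; exists N' => m mN z zr.
    have z1 := le_lt_trans zr r1.
    rewrite (UB _ _ _ (Hu n) (Hu m) z1) (UB _ _ _ (Hu n) Hl z1).
    rewrite (_ : _ - _ = - (U (u m) z - U l z)); last by ring.
    by rewrite modulusN; exact: HN'.
  - exists N => m mN; have Hnm := HDB (Hu n) (Hu m).
    have := ltW (HN n m nN mN); rewrite (CesaroE Hg Hnm) => H.
    exact: (hardy_norm_to_diskP p1 (HU _ Hnm) (ltW e2)).1 H.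
exists l; last by apply: ereal_cvg0 => // n; exact: hardy_norm_ge0.
split => //; have [N /(_ N (leqnn _)) HN] := small 1 ltr01.
(* The limit has finite norm because it differs from [u N] by a function of norm at most 1. *)
have E : Cesaro g l = Cesaro g (u N) + scale (-1) (Cesaro g (u N - l)).
  rewrite (CesaroB Hg (Hu N) Hl); move: (Cesaro g l) (Cesaro g (u N)) => A B.
  by apply/funext => z; rewrite /scale !fctE mulN1r opprB addrC subrK.
rewrite E; have HC := HD_Cesaro Hg (HDB (Hu N) Hl).
apply: le_lt_trans (hardy_normD p1 (HD_Cesaro Hg (Hu N)) (@HDZ _ (-1) _ HC)) _.
rewrite (hardy_normZ (-1) p1 HC) modulusN modulus1 mul1e; apply: lte_add_pinfty; first exact: Nu.
by apply: le_lt_trans HN _; rewrite ltry.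
Qed.

End Operators.

(** * The optimal domain as a Banach space *)

Section Banach.
Context {R : realType}.
Local Notation C := (R[i]).
Implicit Types (f g : disk R -> C) (p : \bar R).

(** The operator preserves holomorphy on the disc, so membership reduces to finiteness of the
    norm. *)
Lemma optimal_domain_CesaroP p g f : HD g ->
  optimal_domain (Cesaro g) (Hardy p) f <-> HD f /\ (hardy_norm p (Cesaro g f) < +oo)%E.
Proof.
move=> Hg; split=> [[Hf [_ Nf]]|[Hf Nf]]; first exact: conj Hf Nf.
exact: conj Hf (conj (HD_Cesaro Hg Hf) Nf).
Qed.

Lemma optimal_domain_VolterraP p g f : HD g ->
  optimal_domain (Volterra g) (Hardy p) f <-> HD f /\ (hardy_norm p (Volterra g f) < +oo)%E.
Proof.
move=> Hg; split=> [[Hf [_ Nf]]|[Hf Nf]]; first exact: conj Hf Nf.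
exact: conj Hf (conj (HD_Volterra Hg Hf) Nf).
Qed.

Lemma HD0 : HD (0 : disk R -> C).
Proof.
apply: (proj2 (HDP _)); apply: (hol_near _ (hol_cst 0)) => z _.
by rewrite /ext0; case: insub.
Qed.

Lemma Cesaro0 g : HD g -> Cesaro g 0 = 0.
Proof.
move=> Hg; have scale0 f : scale 0 f = 0 by apply/funext => z; rewrite /scale mul0r.
have := CesaroZ 0 Hg HD0; by rewrite !scale0.
Qed.

(** A zero norm is below [e / K] for every positive [e], and point evaluation then bounds [f z] by
    [e]. *)
Lemma optimal_norm_eq0 p g f : (1 <= p)%E -> HD g -> (exists z w, g z <> g w) -> HD f ->
  hardy_norm p (Cesaro g f) = 0%E -> f = 0.
Proof.
move=> p1 Hg gnc Hf N0; apply/funext => z.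
have [K K0 HK] := optimal_point_evaluation p1 Hg gnc (disk_modulus z).
apply/eqP; rewrite -modulus_eq0 eq_le modulus_ge0 andbT.
apply/ler_addgt0Pl => e e0; rewrite addr0.
have eK : 0 < e / K by rewrite divr_gt0.
have N1 : (hardy_norm p (Cesaro g f) <= (e / K)%:E)%E by rewrite N0 lee_fin ltW.
have := HK f _ Hf eK N1 (val z) (lexx _).
by rewrite ext0_val mulrC divfK ?gt_eqF.
Qed.

Lemma optimal_Banach p g : (1 <= p)%E -> HD g -> (exists z w, g z <> g w) ->
  is_Banach_space (V := disk R -> R[i]^o)
    (optimal_domain (Cesaro g) (Hardy p)) (optimal_norm (Cesaro g) (hardy_norm p)).
Proof.
move=> p1 Hg gnc; have P f := optimal_domain_CesaroP p f Hg.
rewrite /optimal_norm; split.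
- apply: (proj2 (P 0)); split; first exact: HD0.
  by rewrite (Cesaro0 Hg) (hardy_norm0 p1 HD0).
- move=> x y /(proj1 (P x))[Hx Nx] /(proj1 (P y))[Hy Ny]; apply: (proj2 (P (x + y))).
  split; first exact: HDD Hx Hy.
  rewrite (CesaroD Hg Hx Hy).
  apply: le_lt_trans (hardy_normD p1 (HD_Cesaro Hg Hx) (HD_Cesaro Hg Hy)) _.
  exact: lte_add_pinfty Nx Ny.
- move=> a x /(proj1 (P x))[Hx Nx]; apply: (proj2 (P (scale a x))).
  split; first exact: (@HDZ _ a x Hx).
  rewrite (CesaroZ a Hg Hx) (hardy_normZ a p1 (HD_Cesaro Hg Hx)).
  by rewrite lte_mul_pinfty ?lee_fin ?modulus_ge0.
- by move=> x _; exact: hardy_norm_ge0.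
- by move=> x /(proj1 (P x))[].
- move=> x /(proj1 (P x))[Hx _]; exact: (optimal_norm_eq0 p1 Hg gnc Hx).
- move=> a x /(proj1 (P x))[Hx _].
  transitivity (hardy_norm p (scale a (Cesaro g x))).
    by rewrite -(CesaroZ a Hg Hx).
  exact: (hardy_normZ a p1 (HD_Cesaro Hg Hx)).
- move=> x y /(proj1 (P x))[Hx _] /(proj1 (P y))[Hy _]; rewrite (CesaroD Hg Hx Hy).
  exact: (hardy_normD p1 (HD_Cesaro Hg Hx) (HD_Cesaro Hg Hy)).
- move=> u Hu Cu.
  have Hu1 n : HD (u n) by have [] := proj1 (P _) (Hu n).
  have Hu2 n : (hardy_norm p (Cesaro g (u n)) < +oo)%E by have [] := proj1 (P _) (Hu n).
  have [l Hl Cl] := optimal_complete p1 Hg gnc Hu1 Hu2 Cu.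
  by exists l; [exact: (proj2 (P l))|exact: Cl].
Qed.

End Banach.

Theorem proposition3p13 (R : realType) (p : \bar R) (hp : (1 <= p)%E)
    (g : disk R -> R[i]) (hg : HD g)
    (hg_nonconst : exists z w : disk R, g z <> g w)
    (hV : continuous_on_space (Hardy p) (hardy_norm p) (Volterra g)) :
  [/\ optimal_domain (Volterra g) (Hardy p) = optimal_domain (Cesaro g) (Hardy p),
      forall f, optimal_domain (Volterra g) (Hardy p) f ->
        optimal_norm (Volterra g) (hardy_norm p) f
        = optimal_norm (Cesaro g) (hardy_norm p) f &
      is_Banach_space (V := disk R -> R[i]^o)
        (optimal_domain (Cesaro g) (Hardy p))
        (optimal_norm (Cesaro g) (hardy_norm p)) ].
Proof.
(* Valid on all of [HD] with [+oo] allowed, so it settles the domains together with the norms. *)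
have N f : HD f -> hardy_norm p (Volterra g f) = hardy_norm p (Cesaro g f).
  exact: (Volterra_Cesaro_norm hp hg).
have PV f := optimal_domain_VolterraP p f hg.
have PC f := optimal_domain_CesaroP p f hg.
split.
- apply/seteqP; split=> f.
    move=> /(proj1 (PV f))[Hf Nf]; apply: (proj2 (PC f)).
    by split; [exact: Hf|rewrite -(N f Hf)].
  move=> /(proj1 (PC f))[Hf Nf]; apply: (proj2 (PV f)).
  by split; [exact: Hf|rewrite (N f Hf)].
- by move=> f [Hf _]; exact: N.
- exact: optimal_Banach.
Qed.
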